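(* Let $(\mathbb{T}_n)_{n\ge1}$ be the binary search tree and $H_n$ the height of $\mathbb{T}_n$. Let $a>0$ be the unique positive solution of $2(a-1)e^a+1=0$ and let $b:=2ae^a$ (numerically $a\approx 0.76804$, $b\approx 3.31107$). Then, almost surely, \[\frac12=\liminf_{n\to\infty}\frac{b\log n-aH_n}{\log\log n}<\limsup_{n\to\infty}\frac{b\log n-aH_n}{\log\log n}=\frac32,\] and \[\frac{b\log n-aH_n}{\log\log n}\xrightarrow{\ \mathbb{P}\ }\frac32\quad\text{as } n\to\infty.\]
   Context: Let $\mathbb{T}$ be the complete rooted binary tree. The binary search tree is the random sequence of subtrees $(\mathbb{T}_n)_{n\ge1}$ defined recursively: $\mathbb{T}_1$ consists only of the root; given $\mathbb{T}_n$, a leaf $u$ of $\mathbb{T}_n$ is chosen uniformly at random among all leaves of $\mathbb{T}_n$ (independently of the past choices given $\mathbb{T}_n$), and $\mathbb{T}_{n+1}$ is $\mathbb{T}_n$ together with the two children of $u$. Thus $\mathbb{T}_n$ has $2n-1$ nodes, $n$ of which are leaves. The generation of a node is its distance from the root (the root has generation $0$). The height $H_n$ is the greatest generation of a node of $\mathbb{T}_n$. *)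

(* Defs.v *)
From Stdlib Require Import Reals List Arith.
Import ListNotations.
Open Scope R_scope.

(* A node of the complete rooted binary tree is its path from the root
   (false = left child, true = right child); its generation is the length. *)
Definition node := list bool.

Definition step (L : list node) (i : nat) : list node :=
  let u := nth i L nil in
  firstn i L ++ skipn (S i) L ++ [u ++ [false]; u ++ [true]].

(* Sample point: w : nat -> nat, where w k is the index (in {0,..,k}) of the
   leaf chosen at the k-th step, when the tree has k+1 leaves. *)
Fixpoint leaves_after (k : nat) (w : nat -> nat) : list node :=
  match k with
  | O => [nil]
  | S k' => step (leaves_after k' w) (w k')
  end.

(* Leaves of T_n (n >= 1): n leaves. *)
Definition bst_leaves (n : nat) (w : nat -> nat) : list node :=
  leaves_after (n - 1) w.

Definition bst_node (n : nat) (w : nat -> nat) (v : node) : Prop :=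
  exists u, In u (bst_leaves n w) /\ exists t, u = v ++ t.

(* Height H_n: greatest generation of a node of T_n (attained at a leaf). *)
Definition height (n : nat) (w : nat -> nat) : nat :=
  fold_right (fun u m => Nat.max (length u) m) O (bst_leaves n w).

(** * The probability space: product of uniform laws on {0,..,k}, k >= 0 *)

Definition valid (w : nat -> nat) : Prop := forall k, (w k <= k)%nat.

Definition valid_prefix (s : list nat) : Prop :=
  forall k, (k < length s)%nat -> (nth k s O <= k)%nat.

Definition cyl (s : list nat) (w : nat -> nat) : Prop :=
  forall k, (k < length s)%nat -> w k = nth k s O.

(* probability of a (valid) cylinder of length m: prod_{k<m} 1/(k+1) = 1/m! *)
Definition weight (s : list nat) : R := / INR (fact (length s)).

Definition outer_le (E : (nat -> nat) -> Prop) (r : R) : Prop :=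
  exists f : nat -> list nat,
    (forall i, valid_prefix (f i)) /\
    (forall w, valid w -> E w -> exists i, cyl (f i) w) /\
    (forall N, sum_f_R0 (fun i => weight (f i)) N <= r).

Definition almost_surely (P : (nat -> nat) -> Prop) : Prop :=
  forall d, 0 < d -> outer_le (fun w => ~ P w) d.

Definition Xn (a b : R) (n : nat) (w : nat -> nat) : R :=
  (b * ln (INR n) - a * INR (height n w)) / ln (ln (INR n)).

(* Main.v *)
(** Put V(u) = log M_n - a |u| for a leaf u of T_n, where M_n is the mean of the sum of exp (a |u|)
    over the leaves; thus log M_n = b log n + O(1), and X_n is min V / log log n up to o(1).  The
    value of a is critical: the sum of exp (-V) is a martingale whose spine makes a driftless walk V
    on the time scale log n, and everything reduces to estimates for this walk killed at a barrier.

    Lower bounds on min V: almost surely V stays above some -A.  On that event the expected number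
    of leaves of T_N with V <= x log log N is bounded by means of an explicit supersolution
    y tau^(-3/2+eps) (1 + y^2/(2 k a tau))^(-k) of the backward heat equation killed at 0, which
    gives (log N)^(x - 3/2 + o(1)).  This is small for x < 3/2, and summable along N = 2^j for
    x < 1/2.

    Upper bounds on min V: if phi is a small subsolution of the discrete KPP equation, the product
    of 1 - phi over the leaves is a supermartingale, so no second moment is needed.  The
    subsolution exp (-y) y^(1+eps) (1 - y^2/(2 k a tau))_+^k, seen from the barrier
    (3/2 + 3 eps) log (T / tau), shows that each leaf of T_m has probability bounded below of having a
    descendant with V close to (3/2) log T at time T.  To reach (1/2 + e) log T at some time of a
    long window it is followed, inside the window, by exp (-y) (log (sqrt tau / y) - const)_+. *)

Require Import Defs.
From Stdlib Require Import ZArith Reals List Arith Lra Lia Classical ClassicalEpsilon Cantor FinFun.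
Import ListNotations.
Open Scope R_scope.

(** The definitions provide no measure, only covers by cylinders of bounded total weight. What they
    yield is countable subadditivity and Ville's inequality. So every estimate, even that some leaf
    succeeds with good probability, is proved by exhibiting a non-negative supermartingale that is
    at least 1 on the exceptional event: a sum over the leaves when no leaf may do something, a
    product when some leaf must. The exact heat solution y tau^(-3/2) exp (-y^2/(2 a tau)) is
    unsuitable on a lattice: a jump multiplies it by about exp (a y/tau), which is unbounded.
    Rational or truncated polynomial profiles with a large power k replace the Gaussian. The
    finiteness of k is paid for by eps. A time step has length about b/n, and the errors of order
    1/n^2 are collected in factors exp (C incr^2), whose product converges. The equation for a is
    used in the form 1 + b = 2 exp a, which yields the martingale, and b = a (1 + b), which removes
    the drift of the walk. The value 1/2 reflects the width sqrt tau of the parabolic region. *)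

Lemma Rdiv_le_of_mul x y z : 0 < z -> x <= y * z -> x / z <= y.
Proof.
  intros Hz H. apply (Rmult_le_reg_r z); [assumption|].
  unfold Rdiv. rewrite Rmult_assoc, Rinv_l by lra. lra.
Qed.

Lemma Rdiv_ge_of_mul x y z : 0 < z -> y * z <= x -> y <= x / z.
Proof.
  intros Hz H. apply (Rmult_le_reg_r z); [assumption|].
  unfold Rdiv. rewrite Rmult_assoc, Rinv_l by lra. lra.
Qed.

Ltac mono := first [apply Rmult_le_compat_l; lra | apply Rmult_le_compat_r; lra].
Ltac pos := first
  [ lra | apply Rmult_le_pos; lra | apply Rmult_lt_0_compat; lra
  | apply Rdiv_lt_0_compat; lra | apply Rdiv_ge_of_mul; lra
  | apply Rdiv_ge_of_mul; [lra|rewrite Rmult_0_l; apply Rmult_le_pos; lra] ].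

(** * Covers by cylinders *)

Definition rsum {A : Type} (F : A -> R) (l : list A) : R :=
  fold_right (fun x acc => F x + acc) 0 l.

Lemma rsum_app {A} (F : A -> R) l1 l2 : rsum F (l1 ++ l2) = rsum F l1 + rsum F l2.
Proof. induction l1; simpl; [lra | rewrite IHl1; lra]. Qed.

Lemma rsum_map {A B} (h : A -> B) (F : B -> R) l :
  rsum F (map h l) = rsum (fun x => F (h x)) l.
Proof. induction l; simpl; [|rewrite IHl]; reflexivity. Qed.

Lemma rsum_le {A} (F G : A -> R) l :
  (forall x, In x l -> F x <= G x) -> rsum F l <= rsum G l.
Proof.
  induction l as [|x l IH]; simpl; intros H; [lra|].
  assert (F x <= G x) by auto. assert (rsum F l <= rsum G l) by auto. lra.
Qed.

Lemma rsum_ext {A} (F G : A -> R) l :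
  (forall x, In x l -> F x = G x) -> rsum F l = rsum G l.
Proof. intros H; apply Rle_antisym; apply rsum_le; intros x Hx; rewrite (H x Hx); lra. Qed.

Lemma rsum_nonneg {A} (F : A -> R) l : (forall x, In x l -> 0 <= F x) -> 0 <= rsum F l.
Proof.
  induction l as [|x l IH]; simpl; intros H; [lra|].
  assert (0 <= F x) by auto. assert (0 <= rsum F l) by auto. lra.
Qed.

Lemma rsum_plus {A} (F G : A -> R) l : rsum (fun x => F x + G x) l = rsum F l + rsum G l.
Proof. induction l; simpl; lra. Qed.

Lemma rsum_scal {A} c (F : A -> R) l : rsum (fun x => c * F x) l = c * rsum F l.
Proof. induction l; simpl; [lra | rewrite IHl; lra]. Qed.

Lemma rsum_const {A} c (l : list A) : rsum (fun _ => c) l = INR (length l) * c.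
Proof.
  induction l; [simpl; lra|]. cbn [rsum fold_right length]. rewrite S_INR.
  fold (rsum (fun _ : A => c) l). rewrite IHl. lra.
Qed.

Lemma rsum_flat_map {A B} (h : A -> list B) (F : B -> R) l :
  rsum F (flat_map h l) = rsum (fun x => rsum F (h x)) l.
Proof. induction l; simpl; [reflexivity | rewrite rsum_app, IHl; reflexivity]. Qed.

Lemma rsum_filter {A} (d : A -> bool) (F : A -> R) l :
  rsum F l = rsum F (filter d l) + rsum F (filter (fun x => negb (d x)) l).
Proof. induction l as [|x l IH]; simpl; [lra|]. destruct (d x); simpl; lra. Qed.

Lemma rsum_member {A} (F : A -> R) l x :
  (forall y, In y l -> 0 <= F y) -> In x l -> F x <= rsum F l.
Proof.
  induction l as [|y l IH]; simpl; intros HF [].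
  - subst y. assert (0 <= rsum F l) by (apply rsum_nonneg; auto). lra.
  - assert (F x <= rsum F l) by auto. assert (0 <= F y) by auto. lra.
Qed.

Lemma rsum_incl {A} (F : A -> R) (l l' : list A) :
  (forall x, 0 <= F x) -> NoDup l -> incl l l' -> rsum F l <= rsum F l'.
Proof.
  intros HF Hnd; revert l'; induction Hnd as [|x l Hx Hnd IH]; intros l' Hi.
  - apply rsum_nonneg; auto.
  - destruct (in_split x l' (Hi x (or_introl eq_refl))) as [l1 [l2 ->]].
    rewrite rsum_app; simpl. specialize (IH (l1 ++ l2)).
    rewrite rsum_app in IH. enough (incl l (l1 ++ l2)) by (specialize (IH H); lra).
    intros y Hy. specialize (Hi y (or_intror Hy)).
    apply in_app_iff in Hi; apply in_app_iff; simpl in Hi.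
    destruct Hi as [?|[->|?]]; auto. contradiction.
Qed.

Lemma sum_f_R0_rsum (F : nat -> R) N : sum_f_R0 F N = rsum F (seq 0 (S N)).
Proof.
  induction N as [|N IH]; [simpl; lra|].
  rewrite tech5, IH, (seq_S (S N) 0), rsum_app. simpl. lra.
Qed.

Lemma rsum_list_prod {A B} (F : A * B -> R) l1 l2 :
  rsum F (list_prod l1 l2) = rsum (fun x => rsum (fun y => F (x, y)) l2) l1.
Proof.
  induction l1; simpl; [reflexivity|]. rewrite rsum_app, rsum_map, IHl1; reflexivity.
Qed.

Lemma weight_pos s : 0 < weight s.
Proof. apply Rinv_0_lt_compat, INR_fact_lt_0. Qed.

Lemma outer_mono (E E' : (nat -> nat) -> Prop) r r' :
  (forall w, valid w -> E w -> E' w) -> r' <= r -> outer_le E' r' -> outer_le E r.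
Proof.
  intros HE Hr (f & H1 & H2 & H3). exists f; split; [exact H1|split].
  - intros w Hw Ew; apply H2; auto.
  - intros N; specialize (H3 N); lra.
Qed.

(** Countable subadditivity: choice selects a cover of each event, and Cantor's pairing merges these
    covers into one sequence. *)
Lemma outer_union (E : nat -> (nat -> nat) -> Prop) (r : nat -> R) R0 :
  (forall i, outer_le (E i) (r i)) -> (forall N, sum_f_R0 r N <= R0) ->
  outer_le (fun w => exists i, E i w) R0.
Proof.
  intros H HR.
  set (F := fun i => proj1_sig (constructive_indefinite_description _ (H i))).
  assert (HF : forall i, (forall j, valid_prefix (F i j)) /\
     (forall w, valid w -> E i w -> exists j, cyl (F i j) w) /\
     (forall N, sum_f_R0 (fun j => weight (F i j)) N <= r i)).
  { intros i; unfold F; destruct (constructive_indefinite_description _ (H i)); auto. }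
   exists (fun n => F (fst (of_nat n)) (snd (of_nat n))).
  split; [intros n; apply HF|split].
  - intros w Hw [i Ei]. destruct (HF i) as (_ & Hc & _). destruct (Hc w Hw Ei) as [j Hj].
    exists (to_nat (i, j)). rewrite cancel_of_to; exact Hj.
  - intros N. set (G := fun q : nat * nat => weight (F (fst q) (snd q))).
    rewrite sum_f_R0_rsum.
    rewrite <- (rsum_map of_nat G).
    (* Both coordinates of a pair are at most its code, so the first [S N] pairs lie in a square,
       over which the sum splits into rows. *)
    apply Rle_trans with (rsum G (list_prod (seq 0 (S N)) (seq 0 (S N)))).
    + apply rsum_incl.
      * intros q; apply Rlt_le, weight_pos.
      * apply FinFun.Injective_map_NoDup; [|apply seq_NoDup].
        intros x y Hxy. rewrite <- (cancel_to_of x), <- (cancel_to_of y), Hxy; reflexivity.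
      * intros q Hq. apply in_map_iff in Hq. destruct Hq as [n [<- Hn]].
        apply in_seq in Hn. destruct (of_nat n) as [i j] eqn:Eij.
        assert (to_nat (i, j) = n) by (rewrite <- Eij; apply cancel_to_of).
        pose proof (to_nat_non_decreasing i j). apply in_prod; apply in_seq; lia.
    + rewrite rsum_list_prod. apply Rle_trans with (2 := HR N). rewrite sum_f_R0_rsum.
      apply rsum_le. intros i _. simpl. destruct (HF i) as (_ & _ & Hs).
      specialize (Hs N). rewrite sum_f_R0_rsum in Hs. exact Hs.
Qed.

Lemma sum_half_pow N : sum_f_R0 (fun i => (/2) ^ i) N <= 2.
Proof.
  enough (sum_f_R0 (fun i => (/2) ^ i) N = 2 - (/2) ^ N) as ->.
  { assert (0 < (/2) ^ N) by (apply pow_lt; lra). lra. }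
  induction N; [simpl; lra|]. rewrite tech5, IHN. simpl. lra.
Qed.

Lemma fact_ge_double K i : (S K * 2 ^ i <= fact (S K + i))%nat.
Proof.
  induction i as [|i IH].
  - rewrite Nat.add_0_r, Nat.pow_0_r. simpl. pose proof (lt_O_fact K). nia.
  - rewrite Nat.add_succ_r, Nat.pow_succ_r'. cbn [fact].
    assert (2 <= S (S K + i))%nat by lia. nia.
Qed.

(* The cover must be an infinite sequence of cylinders, so a finite one is padded by cylinders of
   rapidly decreasing weight. *)
Lemma outer_finite (E : (nat -> nat) -> Prop) (l : list (list nat)) r :
  (forall s, In s l -> valid_prefix s) ->
  (forall w, valid w -> E w -> exists s, In s l /\ cyl s w) ->
  rsum weight l < r -> outer_le E r.
Proof.
  intros Hv Hc Hr.
  (* The padding cylinder number [i] has length [S K + i], hence weight at most 2^(-i) / (K + 1).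
     The whole padding weighs at most 2 / (K + 1), which this choice of [K] puts below the slack. *)
  destruct (INR_unbounded (2 / (r - rsum weight l))) as [K HK].
  set (pad := fun i => repeat O (S K + i)).
  exists (fun i => nth i l (pad i)). split; [|split].
  - intros i. destruct (Nat.lt_ge_cases i (length l)) as [Hi|Hi].
    + apply Hv, nth_In, Hi.
    + rewrite nth_overflow by exact Hi. intros k _. unfold pad.
      rewrite nth_repeat. lia.
  - intros w Hw Ew. destruct (Hc w Hw Ew) as (s & Hs & Hcyl).
    destruct (In_nth _ _ (pad O) Hs) as (i & Hi & <-). exists i.
    rewrite (nth_indep _ _ (pad O) Hi). exact Hcyl.
  - intros N.
    apply Rle_trans with (rsum weight l + sum_f_R0 (fun i => / INR (S K) * (/2) ^ i) N).
    + rewrite !sum_f_R0_rsum.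
      apply Rle_trans with (rsum (fun i => (if i <? length l then weight (nth i l nil) else 0)
           + / INR (S K) * (/2) ^ i) (seq 0 (S N))).
      * apply rsum_le. intros i _. destruct (Nat.ltb_spec i (length l)) as [Hi|Hi].
        -- rewrite (nth_indep _ _ nil Hi).
           assert (0 < / INR (S K) * (/2) ^ i); [|lra].
           apply Rmult_lt_0_compat; [apply Rinv_0_lt_compat, lt_0_INR; lia | apply pow_lt; lra].
        -- rewrite nth_overflow by exact Hi. unfold weight, pad. rewrite repeat_length.
           rewrite Rplus_0_l, pow_inv, <- Rinv_mult.
           apply Rinv_le_contravar.
           ++ apply Rmult_lt_0_compat; [apply lt_0_INR; lia | apply pow_lt; lra].
           ++ replace 2 with (INR 2) by (simpl; lra). rewrite <- pow_INR, <- mult_INR.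
              apply le_INR, fact_ge_double.
      * rewrite rsum_plus. apply Rplus_le_compat_r.
        set (H := fun i => if i <? length l then weight (nth i l nil) else 0).
        apply Rle_trans with (rsum H (seq 0 (length l))).
        -- rewrite (rsum_filter (fun i => i <? length l) H).
           assert (Z : rsum H (filter (fun x => negb (x <? length l)) (seq 0 (S N))) = 0).
           { rewrite (rsum_ext _ (fun _ => 0)); [rewrite rsum_const; lra|].
             intros i Hi. apply filter_In in Hi. unfold H.
             destruct (i <? length l); [simpl in Hi; destruct Hi; discriminate | reflexivity]. }
           rewrite Z, Rplus_0_r. apply rsum_incl.
           ++ intros i; unfold H. destruct (i <? length l); [apply Rlt_le, weight_pos | lra].
           ++ apply NoDup_filter, seq_NoDup.
           ++ intros i Hi. apply filter_In in Hi. destruct Hi as [_ Hi].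
              apply Nat.ltb_lt in Hi. apply in_seq; lia.
        -- apply Req_le. rewrite (rsum_ext _ (fun i => weight (nth i l nil))).
           ++ rewrite <- (rsum_map (fun i => nth i l nil) weight). f_equal.
              apply nth_ext with nil nil; rewrite length_map, length_seq; [reflexivity|].
              intros i Hi.
              rewrite (nth_indep _ _ (nth O l nil)) by (rewrite length_map, length_seq; exact Hi).
              rewrite (map_nth (fun i => nth i l nil)), seq_nth; auto.
           ++ intros i Hi. apply in_seq in Hi. unfold H.
              destruct (Nat.ltb_spec i (length l)); [reflexivity | lia].
    + assert (Hs : sum_f_R0 (fun i => / INR (S K) * (/2) ^ i) N <= / INR (S K) * 2).
      { rewrite sum_f_R0_rsum, rsum_scal, <- sum_f_R0_rsum.
        apply Rmult_le_compat_l; [left; apply Rinv_0_lt_compat, lt_0_INR; lia | apply sum_half_pow]. }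
      assert (/ INR (S K) * 2 <= r - rsum weight l); [|lra].
      assert (0 < INR (S K)) by (apply lt_0_INR; lia).
      apply (Rmult_le_reg_l (INR (S K))); [assumption|].
      rewrite <- Rmult_assoc, Rinv_r, Rmult_1_l by lra.
      rewrite S_INR in *. set (q := r - rsum weight l) in *.
      assert (0 < q) by (unfold q; lra).
      apply (Rmult_lt_compat_r q) in HK; [|assumption].
      unfold Rdiv in HK. rewrite Rmult_assoc, Rinv_l in HK by lra. lra.
Qed.

Lemma sum_f_R0_half_le d N : 0 <= d -> sum_f_R0 (fun i => d * (/2) ^ (S i)) N <= d.
Proof.
  intros Hd. rewrite sum_f_R0_rsum.
  apply Rle_trans with (rsum (fun i => d * / 2 * (/2) ^ i) (seq 0 (S N))).
  - apply rsum_le; intros i _. rewrite <- tech_pow_Rmult. lra.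
  - rewrite rsum_scal, <- sum_f_R0_rsum. pose proof (sum_half_pow N) as Hs.
    set (q := sum_f_R0 _ N) in *. change (q <= 2) in Hs. nra.
Qed.

Lemma as_forall (P : nat -> (nat -> nat) -> Prop) :
  (forall i, almost_surely (P i)) -> almost_surely (fun w => forall i, P i w).
Proof.
  intros H d Hd.
  apply outer_mono with (fun w => exists i, ~ P i w) d; [|lra|].
  - intros w _ Hn. apply not_all_ex_not; exact Hn.
  - apply outer_union with (fun i => d * (/2) ^ (S i)).
    + intros i. apply H. apply Rmult_lt_0_compat; [lra | apply pow_lt; lra].
    + intros N. apply sum_f_R0_half_le; lra.
Qed.

(** The strict inequality leaves room for the remaining members of the sequence of events, which are
    empty: even a cover of the empty event has positive weight. *)
Lemma outer_or (E1 E2 : (nat -> nat) -> Prop) r1 r2 r :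
  outer_le E1 r1 -> outer_le E2 r2 -> r1 + r2 < r -> outer_le (fun w => E1 w \/ E2 w) r.
Proof.
  intros H1 H2 Hr. set (d := r - r1 - r2).
  assert (Hempty : forall q, 0 < q -> outer_le (fun _ => False) q).
  { intros q Hq. apply outer_finite with nil; simpl; [tauto | tauto | lra]. }
  apply outer_mono with
    (fun w => exists i, (fun i => match i with O => E1 | 1%nat => E2 | _ => fun _ => False end) i w) r;
    [|lra|].
  - intros w _ [?|?]; [exists O | exists 1%nat]; auto.
  - apply outer_union with (fun i => match i with O => r1 | 1%nat => r2
        | S (S i) => d * (/2) ^ (S i) end).
    + intros [|[|i]]; auto. apply Hempty.
      apply Rmult_lt_0_compat; [unfold d; lra | apply pow_lt; lra].
    + assert (H0 : forall E q, outer_le E q -> 0 <= q).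
      { intros E q (f & _ & _ & Hf). specialize (Hf O). simpl in Hf.
        pose proof (weight_pos (f O)). lra. }
       pose proof (H0 _ _ H2).
      intros [|[|N]]; simpl; [unfold d in *; lra..|].
      enough (E : sum_f_R0 (fun i => match i with O => r1 | 1%nat => r2
        | S (S i) => d * (/2) ^ (S i) end) (S (S N)) =
        r1 + r2 + sum_f_R0 (fun i => d * (/2) ^ (S i)) N).
      { pose proof (sum_f_R0_half_le d N). simpl in E.
        unfold d in *. simpl in *. lra. }
      clear. induction N; [simpl; lra|].
      rewrite tech5, IHN, (tech5 _ N). simpl. lra.
Qed.

(** * Ville's inequality and the tree *)

Definition prefix (w : nat -> nat) (k : nat) : list nat := map w (seq 0 k).

Lemma prefix_S w k : prefix w (S k) = prefix w k ++ [w k].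
Proof. unfold prefix. rewrite seq_S, map_app. reflexivity. Qed.

Lemma prefix_length w k : length (prefix w k) = k.
Proof. unfold prefix. rewrite length_map, length_seq. reflexivity. Qed.

Lemma prefix_nth w k i : (i < k)%nat -> nth i (prefix w k) O = w i.
Proof.
  intros H. unfold prefix. rewrite (nth_indep _ O (w O)) by (rewrite length_map, length_seq; auto).
  rewrite map_nth, seq_nth; auto.
Qed.

Lemma prefix_valid w k : valid w -> valid_prefix (prefix w k).
Proof. intros Hw i Hi. rewrite prefix_length in Hi. rewrite prefix_nth by exact Hi. apply Hw. Qed.

Lemma cyl_prefix w k : cyl (prefix w k) w.
Proof. intros i Hi. rewrite prefix_length in Hi. rewrite prefix_nth; auto. Qed.

Lemma firstn_prefix w k j : (j <= k)%nat -> firstn j (prefix w k) = prefix w j.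
Proof.
  intros H. unfold prefix. rewrite firstn_map. f_equal.
  replace k with (j + (k - j))%nat by lia. rewrite seq_app, firstn_app, length_seq, Nat.sub_diag.
  rewrite firstn_all2 by (rewrite length_seq; lia). apply app_nil_r.
Qed.

Lemma valid_snoc s i : valid_prefix s -> (i <= length s)%nat -> valid_prefix (s ++ [i]).
Proof.
  intros Hs Hi k Hk. rewrite length_app in Hk; simpl in Hk.
  destruct (Nat.lt_ge_cases k (length s)).
  - rewrite app_nth1 by assumption. apply Hs; assumption.
  - rewrite app_nth2 by assumption. replace (k - length s)%nat with O by lia. simpl. lia.
Qed.

Lemma weight_snoc s i : weight (s ++ [i]) = weight s / INR (S (length s)).
Proof.
  unfold weight. rewrite length_app. simpl length. rewrite Nat.add_1_r, fact_simpl, mult_INR.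
  rewrite Rinv_mult. unfold Rdiv. ring.
Qed.

Section Ville.
Variables (bad : list nat -> bool) (v : list nat -> R).

Definition children (s : list nat) := map (fun i => s ++ [i]) (seq 0 (S (length s))).

(** A bad prefix gets no children, so these are the prefixes of length [k] without a bad proper
    prefix: the branches not yet stopped. *)
Fixpoint alive (k : nat) : list (list nat) :=
  match k with
  | O => [nil]
  | S k => flat_map children (filter (fun s => negb (bad s)) (alive k))
  end.

Definition first_bad (k : nat) := filter bad (alive k).

Lemma alive_prefix k s : In s (alive k) -> length s = k /\ valid_prefix s.
Proof.
  revert s; induction k as [|k IH]; intros s; simpl.
  - intros [<-|[]]. split; [reflexivity|]. intros i Hi; simpl in Hi; lia.
  - intros H. apply in_flat_map in H. destruct H as (t & Ht & Hs).
    apply filter_In in Ht. destruct (IH t (proj1 Ht)) as [<- Hv].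
    apply in_map_iff in Hs. destruct Hs as (i & <- & Hi). apply in_seq in Hi.
    split; [rewrite length_app; simpl; lia|]. apply valid_snoc; [exact Hv|lia].
Qed.

Lemma first_bad_or_alive w k : valid w ->
  (exists j, (j < k)%nat /\ In (prefix w j) (first_bad j)) \/ In (prefix w k) (alive k).
Proof.
  intros Hw. induction k as [|k IH]; [right; simpl; auto|].
  destruct IH as [(j & Hj & Hb)|Ha]; [left; exists j; split; [lia|assumption]|].
  destruct (bad (prefix w k)) eqn:Eb.
  - left. exists k. split; [lia|]. apply filter_In; auto.
  - right. simpl. apply in_flat_map. exists (prefix w k). split.
    + apply filter_In. rewrite Eb; auto.
    + rewrite prefix_S. apply in_map_iff. exists (w k). split; [reflexivity|].
      apply in_seq. rewrite prefix_length. specialize (Hw k). lia.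
Qed.

Hypothesis v_nonneg : forall s, valid_prefix s -> 0 <= v s.
Hypothesis v_bad : forall s, valid_prefix s -> bad s = true -> 1 <= v s.
Hypothesis v_super : forall s, valid_prefix s -> bad s = false ->
  rsum (fun i => v (s ++ [i])) (seq 0 (S (length s))) <= INR (S (length s)) * v s.

(** Optional stopping: a bad prefix has [v]-mass at least its weight, and the mass of the other
    prefixes passes to their children without increasing. So the stopped weight and the running mass
    together never exceed the initial mass. *)
Lemma ville_mass N :
  sum_f_R0 (fun k => rsum weight (first_bad k)) N
  + rsum (fun s => weight s * v s) (alive (S N)) <= v nil.
Proof.
  assert (Hstep : forall k, rsum weight (first_bad k)
     + rsum (fun s => weight s * v s) (alive (S k)) <= rsum (fun s => weight s * v s) (alive k)).
  { intros k. rewrite (rsum_filter bad _ (alive k)). apply Rplus_le_compat.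
    - apply rsum_le. intros s Hs. apply filter_In in Hs. destruct Hs as [Hs Hb].
      pose proof (v_bad s (proj2 (alive_prefix k s Hs)) Hb). pose proof (weight_pos s). nra.
    - simpl. rewrite rsum_flat_map. apply rsum_le. intros s Hs.
      apply filter_In in Hs. destruct Hs as [Hs Hb]. apply Bool.negb_true_iff in Hb.
      pose proof (v_super s (proj2 (alive_prefix k s Hs)) Hb) as H.
      unfold children. rewrite rsum_map.
      rewrite (rsum_ext _ (fun i => weight s / INR (S (length s)) * v (s ++ [i])))
        by (intros; rewrite weight_snoc; reflexivity).
      rewrite rsum_scal. pose proof (weight_pos s).
      assert (0 < INR (S (length s))) by (apply lt_0_INR; lia).
      replace (weight s * v s) with (weight s / INR (S (length s)) * (INR (S (length s)) * v s))
        by (field; lra).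
      apply Rmult_le_compat_l; [|exact H].
      apply Rlt_le, Rdiv_lt_0_compat; assumption. }
  induction N as [|N IH].
  - simpl sum_f_R0. specialize (Hstep O). simpl in Hstep |- *.
    unfold weight at 3 in Hstep. simpl in Hstep. lra.
  - rewrite tech5. specialize (Hstep (S N)). lra.
Qed.

(* Ville's maximal inequality; the first bad prefixes are the covering cylinders. *)
Theorem ville r : v nil < r -> outer_le (fun w => exists k, bad (prefix w k) = true) r.
Proof.
  intros Hr. set (d := (r - v nil) / 2). assert (0 < d) by pos.
  apply outer_mono with (fun w => exists k, exists s, In s (first_bad k) /\ cyl s w) r; [|lra|].
  - intros w Hw [k Hk]. destruct (first_bad_or_alive w k Hw) as [(j & _ & Hj)|Ha].
    + exists j, (prefix w j). split; [assumption | apply cyl_prefix].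
    + exists k, (prefix w k). split; [|apply cyl_prefix]. apply filter_In; auto.
  - apply outer_union with (fun k => rsum weight (first_bad k) + d * (/2) ^ (S k)).
    + intros k. apply outer_finite with (first_bad k).
      * intros s Hs. apply filter_In in Hs. apply (alive_prefix k), Hs.
      * auto.
      * assert (0 < d * (/2) ^ (S k)); [|lra].
        apply Rmult_lt_0_compat; [assumption | apply pow_lt; lra].
    + intros N. rewrite sum_f_R0_rsum, rsum_plus, <- !sum_f_R0_rsum.
      pose proof (sum_f_R0_half_le d N). pose proof (ville_mass N).
      assert (0 <= rsum (fun s => weight s * v s) (alive (S N))).
      { apply rsum_nonneg. intros s Hs. pose proof (weight_pos s).
        pose proof (v_nonneg s (proj2 (alive_prefix _ s Hs))). nra. }
      unfold d in *. lra.
Qed.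
End Ville.

(** * The tree as a function of the finite history of choices *)

Definition tree (s : list nat) : list node := fold_left step s [nil].

Lemma tree_snoc s i : tree (s ++ [i]) = step (tree s) i.
Proof. unfold tree. rewrite fold_left_app. reflexivity. Qed.

Lemma leaves_after_tree k w : leaves_after k w = tree (prefix w k).
Proof. induction k; [reflexivity|]. rewrite prefix_S, tree_snoc, <- IHk. reflexivity. Qed.

Lemma step_split (L : list node) i : (i < length L)%nat -> exists (l1 l2 : list node) (u : node),
  u = nth i L nil /\ L = l1 ++ u :: l2 /\
  step L i = l1 ++ l2 ++ [u ++ [false]; u ++ [true]].
Proof.
  intros Hi. exists (firstn i L), (skipn (S i) L), (nth i L nil). split; [reflexivity|].
  split; [|reflexivity].
  rewrite <- (firstn_skipn i L) at 1. f_equal. clear -Hi. revert i Hi.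
  induction L as [|x L IH]; intros [|i] Hi; simpl in *; try lia; [reflexivity|].
  apply IH. lia.
Qed.

Lemma step_length L i : (i < length L)%nat -> length (step L i) = S (length L).
Proof.
  intros Hi. destruct (step_split L i Hi) as (l1 & l2 & u & Eu & E1 & E2).
  rewrite E2, E1, !length_app. simpl. lia.
Qed.

Lemma valid_snoc_inv s i : valid_prefix (s ++ [i]) -> valid_prefix s /\ (i <= length s)%nat.
Proof.
  intros H. split.
  - intros k Hk. specialize (H k). rewrite app_nth1 in H by assumption. apply H.
    rewrite length_app; simpl; lia.
  - specialize (H (length s)). rewrite nth_middle in H. apply H. rewrite length_app; simpl; lia.
Qed.

Lemma tree_length s : valid_prefix s -> length (tree s) = S (length s).
Proof.
  induction s as [|i s IH] using rev_ind; intros Hv; [reflexivity|].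
  apply valid_snoc_inv in Hv. destruct Hv as [Hv Hi].
  specialize (IH Hv). rewrite tree_snoc, step_length, IH, length_app by (rewrite IH; lia).
  simpl. lia.
Qed.

Lemma step_rsum (F : nat -> R) L i : (i < length L)%nat ->
  rsum (fun u => F (length u)) (step L i) =
  rsum (fun u => F (length u)) L - F (length (nth i L nil)) + 2 * F (S (length (nth i L nil))).
Proof.
  intros Hi. destruct (step_split L i Hi) as (l1 & l2 & u & Eu & E1 & E2).
  unfold node in *. rewrite E2, <- Eu, E1, !rsum_app. simpl.
  rewrite !length_app. simpl. rewrite Nat.add_1_r. lra.
Qed.

Lemma rsum_nth (F : node -> R) L :
  rsum (fun i => F (nth i L nil)) (seq 0 (length L)) = rsum F L.
Proof.
  rewrite <- (rsum_map (fun i => nth i L nil) F). f_equal.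
  apply nth_ext with nil nil; rewrite length_map, length_seq; [reflexivity|].
  intros i Hi.
  rewrite (nth_indep _ _ (nth O L nil)) by (rewrite length_map, length_seq; exact Hi).
  rewrite (map_nth (fun i => nth i L nil)), seq_nth; auto.
Qed.

(** Seen from one leaf of depth [h]: of the [n] equally likely choices, [n - 1] keep it and one
    replaces it by two leaves of depth [S h]. Expectations of sums over the leaves reduce to this
    exchange of summations. *)
Lemma sum_step_rsum (F : nat -> R) L :
  rsum (fun i => rsum (fun u => F (length u)) (step L i)) (seq 0 (length L)) =
  rsum (fun u => (INR (length L) - 1) * F (length u) + 2 * F (S (length u))) L.
Proof.
  rewrite (rsum_ext _ (fun i => rsum (fun u => F (length u)) L +
     (2 * F (S (length (nth i L nil))) + (-1) * F (length (nth i L nil))))).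
  - rewrite rsum_plus, rsum_const, length_seq.
    rewrite (rsum_nth (fun u => 2 * F (S (length u)) + (-1) * F (length u))).
    rewrite !rsum_plus, !rsum_scal. unfold node in *. lra.
  - intros i Hi. apply in_seq in Hi. rewrite step_rsum by lia. lra.
Qed.

Lemma height_ge L h :
  (1 <= h)%nat -> (h <= fold_right (fun u m => Nat.max (length u) m) O L)%nat <->
  exists u : node, In u L /\ (h <= length u)%nat.
Proof.
  intros Hh. induction L as [|x L IH]; simpl.
  - split; [lia | intros (u & [] & _)].
  - rewrite Nat.max_le_iff, IH. split.
    + intros [H|(u & Hu & H)]; [exists x | exists u]; auto.
    + intros (u & [->|Hu] & H); [left | right; exists u]; auto.
Qed.

Lemma height_attained L : L <> nil -> exists u : node,
  In u L /\ length u = fold_right (fun u m => Nat.max (length u) m) O L.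
Proof.
  induction L as [|x L IH]; [congruence|]. intros _. destruct L as [|y L].
  - exists x. simpl. rewrite Nat.max_0_r; auto.
  - destruct IH as (u & Hu & E); [congruence|].
    change (fold_right _ _ (x :: y :: L)) with
      (Nat.max (length x) (fold_right (fun u m => Nat.max (length u) m) O (y :: L))).
    rewrite <- E. destruct (Nat.max_spec (length x) (length u)) as [[_ ->]|[_ ->]].
    + exists u; simpl in *; tauto.
    + exists x; simpl; tauto.
Qed.

Lemma height_step L i : (i < length L)%nat ->
  (fold_right (fun u m => Nat.max (length u) m) O L <=
   fold_right (fun u m => Nat.max (length u) m) O (step L i))%nat.
Proof.
  intros Hi. set (h := fold_right _ O L).
  destruct (Nat.eq_dec h 0) as [->|Hh]; [lia|].
  apply height_ge; [lia|].
  destruct (proj1 (height_ge L h ltac:(lia)) (le_n h)) as (u & Hu & Hl).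
  destruct (step_split L i Hi) as (l1 & l2 & x & _ & E1 & E2).
  rewrite E1 in Hu. apply in_app_iff in Hu. simpl in Hu. destruct Hu as [Hu|[<-|Hu]].
  - exists u. rewrite E2, in_app_iff. auto.
  - exists (x ++ [false]). rewrite E2, !in_app_iff, length_app. simpl. split; [auto|lia].
  - exists u. rewrite E2, !in_app_iff. auto.
Qed.

Lemma height_mono w n n' : valid w -> (1 <= n <= n')%nat -> (height n w <= height n' w)%nat.
Proof.
  intros Hw [Hn Hn']. induction Hn' as [|n' Hn' IH]; [lia|].
  apply Nat.le_trans with (1 := IH). unfold height, bst_leaves.
  replace (S n' - 1)%nat with (S (n' - 1)) by lia. simpl leaves_after.
  apply height_step. rewrite leaves_after_tree, tree_length by (apply prefix_valid; auto).
  rewrite prefix_length. specialize (Hw (n' - 1)%nat). lia.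
Qed.

(** * Super- and subsolutions control the tree *)

(** Ville's inequality is stated for a boolean [bad], whereas the stopping conditions involve real
    inequalities and quantifiers over the leaves; excluded middle bridges the two. *)
Definition decide (P : Prop) : bool := if excluded_middle_informative P then true else false.

Lemma decide_true P : decide P = true <-> P.
Proof. unfold decide. destruct (excluded_middle_informative P); split; auto; discriminate. Qed.

Lemma decide_false P : decide P = false <-> ~ P.
Proof. unfold decide. destruct (excluded_middle_informative P); split; auto; try discriminate; contradiction. Qed.

Lemma bst_leaves_tree n w : bst_leaves n w = tree (prefix w (n - 1)).
Proof. apply leaves_after_tree. Qed.

Definition leaf_sum (F : nat -> R) (s : list nat) : R := rsum (fun u => F (length u)) (tree s).

Lemma leaf_sum_nonneg F s : (forall h, 0 <= F h) -> 0 <= leaf_sum F s.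
Proof. intros H. apply rsum_nonneg. auto. Qed.

Lemma leaf_sum_member F s u : (forall h, 0 <= F h) -> In u (tree s) -> F (length u) <= leaf_sum F s.
Proof. intros H Hu. apply (rsum_member (fun u : node => F (length u))); auto. Qed.

Lemma leaf_sum_children F G s : valid_prefix s ->
  (forall u, In u (tree s) -> INR (length s) * G (length u) + 2 * G (S (length u))
     <= INR (S (length s)) * F (length u)) ->
  rsum (fun i => leaf_sum G (s ++ [i])) (seq 0 (S (length s)))
    <= INR (S (length s)) * leaf_sum F s.
Proof.
  intros Hv H. rewrite (rsum_ext _ (fun i => rsum (fun u => G (length u)) (step (tree s) i))).
  - rewrite <- (tree_length s Hv), sum_step_rsum. unfold leaf_sum. rewrite <- rsum_scal.
    apply rsum_le. intros u Hu. specialize (H u Hu). rewrite tree_length by exact Hv.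
    rewrite S_INR in *. lra.
  - intros i _. unfold leaf_sum. rewrite tree_snoc. reflexivity.
Qed.

(** The sum of [f n] over the leaves is a supermartingale, and one leaf with value at least 1
    already makes the sum at least 1. *)
Theorem maximal_inequality (f : nat -> nat -> R) r :
  (forall n h, 0 <= f n h) ->
  (forall n h, (1 <= n)%nat ->
     (INR n - 1) * f (S n) h + 2 * f (S n) (S h) <= INR n * f n h) ->
  f 1%nat O < r ->
  outer_le (fun w => exists n u, (1 <= n)%nat /\ In u (bst_leaves n w) /\ 1 <= f n (length u)) r.
Proof.
  intros Hf Hstep Hr.
  set (bad := fun s => decide (exists u, In u (tree s) /\ 1 <= f (S (length s)) (length u))).
  apply outer_mono with (fun w => exists k, bad (prefix w k) = true) r; [|lra|].
  - intros w _ (n & u & Hn & Hu & H1). exists (n - 1)%nat. apply decide_true. exists u.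
    rewrite prefix_length, <- bst_leaves_tree. replace (S (n - 1)) with n by lia. auto.
  - apply ville with (fun s => leaf_sum (f (S (length s))) s).
    + intros s _. apply leaf_sum_nonneg; auto.
    + intros s _ Hb. apply (proj1 (decide_true _)) in Hb. destruct Hb as (u & Hu & H1).
      apply Rle_trans with (1 := H1). apply leaf_sum_member; auto.
    + intros s Hv _.
      rewrite (rsum_ext _ (fun i => leaf_sum (f (S (S (length s)))) (s ++ [i])))
        by (intros; rewrite length_app; simpl; rewrite Nat.add_1_r; reflexivity).
      apply leaf_sum_children; [exact Hv|]. intros u _.
      specialize (Hstep (S (length s)) (length u) ltac:(lia)).
      rewrite (S_INR (length s)) in *. lra.
    + unfold leaf_sum; simpl. lra.
Qed.

(** The supermartingale is set to 0 as soon as any leaf of the tree has crossed, not only along the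
    line of descent of that leaf. The step inequality is therefore required only away from
    [cross]. *)
Theorem first_moment_bound (f : nat -> nat -> R) (cross : nat -> nat -> Prop)
    (tgt : nat -> Prop) N r :
  (1 <= N)%nat ->
  (forall n h, 0 <= f n h) ->
  (forall n h, (1 <= n < N)%nat -> ~ cross n h ->
     (INR n - 1) * f (S n) h + 2 * f (S n) (S h) <= INR n * f n h) ->
  (forall h, ~ cross N h -> tgt h -> 1 <= f N h) ->
  f 1%nat O < r ->
  outer_le (fun w =>
    (forall n u, (1 <= n <= N)%nat -> In u (bst_leaves n w) -> ~ cross n (length u)) /\
    exists u, In u (bst_leaves N w) /\ tgt (length u)) r.
Proof.
  intros HN Hf Hstep Htgt Hr.
  set (ok := fun s => forall j u, (j <= length s)%nat -> In u (tree (firstn j s)) ->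
                      ~ cross (S j) (length u)).
  set (bad := fun s => decide (length s = (N - 1)%nat /\ ok s /\
                      exists u, In u (tree s) /\ tgt (length u))).
  set (v := fun s => if decide (ok s /\ (length s <= N - 1)%nat)
                     then leaf_sum (f (S (length s))) s else 0).
  assert (Hv0 : forall s, 0 <= v s).
  { intros s. unfold v. destruct (decide _); [apply leaf_sum_nonneg; auto | lra]. }
  assert (Hvle : forall s, v s <= leaf_sum (f (S (length s))) s).
  { intros s. unfold v. destruct (decide _); [lra | apply leaf_sum_nonneg; auto]. }
  assert (Hok : forall s i, ok (s ++ [i]) -> ok s).
  { intros s i H j u Hj Hu. apply H; [rewrite length_app; lia|].
    rewrite firstn_app. replace (j - length s)%nat with O by lia.
    simpl. rewrite app_nil_r. exact Hu. }
  apply outer_mono with (fun w => exists k, bad (prefix w k) = true) r; [|lra|].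
  - intros w _ (Hc & u & Hu & Ht). exists (N - 1)%nat. apply decide_true.
    rewrite prefix_length. split; [reflexivity|split].
    + intros j x Hj Hx. rewrite prefix_length in Hj. rewrite firstn_prefix in Hx by exact Hj.
      apply Hc; [lia|]. rewrite bst_leaves_tree. simpl. rewrite Nat.sub_0_r. exact Hx.
    + exists u. rewrite <- bst_leaves_tree. auto.
  - apply ville with v.
    + auto.
    + intros s _ Hb. apply (proj1 (decide_true _)) in Hb. destruct Hb as (Hl & Hs & u & Hu & Ht).
      unfold v. rewrite (proj2 (decide_true _)) by (split; [exact Hs|lia]).
      apply Rle_trans with (f (S (length s)) (length u)).
      * rewrite Hl. replace (S (N - 1)) with N by lia. apply Htgt; [|exact Ht].
        specialize (Hs (length s) u (le_n _)). rewrite firstn_all in Hs.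
        rewrite Hl in Hs. replace (S (N - 1)) with N in Hs by lia. auto.
      * apply leaf_sum_member; auto.
    + intros s Hv _. destruct (decide (ok s /\ (length s < N - 1)%nat)) eqn:E.
      * apply (proj1 (decide_true _)) in E. destruct E as [E1 E2].
        apply Rle_trans with
          (rsum (fun i => leaf_sum (f (S (S (length s)))) (s ++ [i])) (seq 0 (S (length s)))).
        -- apply rsum_le. intros i _. apply Rle_trans with (1 := Hvle _).
           rewrite length_app; simpl; rewrite Nat.add_1_r; lra.
        -- unfold v. rewrite (proj2 (decide_true _)) by (split; [exact E1|lia]).
           apply leaf_sum_children; [exact Hv|]. intros u Hu.
           specialize (Hstep (S (length s)) (length u) ltac:(lia)).
           rewrite (S_INR (length s)) in *.
           enough (~ cross (S (length s)) (length u)) by (specialize (Hstep H); lra).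
           apply E1; [lia|]. rewrite firstn_all. exact Hu.
      * apply (proj1 (decide_false _)) in E. rewrite (rsum_ext _ (fun _ => 0)).
        -- rewrite rsum_const. pose proof (pos_INR (S (length s))). specialize (Hv0 s). nra.
        -- intros i _. unfold v. rewrite (proj2 (decide_false _)); [reflexivity|].
           intros [H1 H2]. apply E. rewrite length_app in H2. simpl in H2.
           split; [exact (Hok s i H1) | lia].
    + apply Rle_lt_trans with (1 := Hvle nil). unfold leaf_sum; simpl. lra.
Qed.

(** * Products over the leaves and the discrete KPP recursion *)

Definition rprod {A : Type} (F : A -> R) (l : list A) : R :=
  fold_right (fun x acc => F x * acc) 1 l.

Lemma rprod_app {A} (F : A -> R) l1 l2 : rprod F (l1 ++ l2) = rprod F l1 * rprod F l2.
Proof. induction l1; simpl; [lra | rewrite IHl1; lra]. Qed.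

Lemma rprod_pos {A} (F : A -> R) l : (forall x, 0 < F x) -> 0 < rprod F l.
Proof.
  intros H. induction l as [|x l IH]; simpl; [lra|]. apply Rmult_lt_0_compat; auto.
Qed.

Lemma rprod_le {A} (F G : A -> R) l :
  (forall x, In x l -> 0 <= F x <= G x) -> 0 <= rprod F l <= rprod G l.
Proof.
  induction l as [|x l IH]; simpl; intros H; [lra|].
  assert (0 <= F x <= G x) by auto. assert (0 <= rprod F l <= rprod G l) by auto.
  split; [pos | apply Rmult_le_compat; lra].
Qed.

Lemma rprod_mult_exp {A} (F H : A -> R) l :
  rprod (fun x => F x * exp (H x)) l = rprod F l * exp (rsum H l).
Proof.
  induction l as [|x l IH]; simpl; [rewrite exp_0; lra|]. rewrite IH, exp_plus. lra.
Qed.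

Lemma rprod_const_exp {A} c (l : list A) : rprod (fun _ => exp c) l = exp (INR (length l) * c).
Proof.
  induction l; [simpl; rewrite Rmult_0_l, exp_0; reflexivity|].
  cbn [rprod fold_right length]. fold (rprod (fun _ : A => exp c) l).
  rewrite IHl, S_INR, <- exp_plus. f_equal. lra.
Qed.

Lemma step_rprod (q : nat -> R) L i : (i < length L)%nat -> (forall h, 0 < q h) ->
  rprod (fun u => q (length u)) (step L i) =
  rprod (fun u => q (length u)) L
   * (q (S (length (nth i L nil))) ^ 2 / q (length (nth i L nil))).
Proof.
  intros Hi Hq. destruct (step_split L i Hi) as (l1 & l2 & u & Eu & E1 & E2).
  unfold node in *. rewrite E2, <- Eu, E1, !rprod_app. simpl.
  rewrite !length_app. simpl. rewrite Nat.add_1_r. specialize (Hq (length u)). field. lra.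
Qed.

(* Replacing the choice of one leaf by independent choices only decreases the product:
   1 - x <= exp (- x) turns the average over the leaves into a product. *)
Lemma sum_step_rprod (q : nat -> R) (q' : nat -> R) L : (0 < length L)%nat ->
  (forall h, 0 < q' h) ->
  (forall u, In u L -> q' (length u) *
     exp (- (1 - q' (S (length u)) ^ 2 / q' (length u)) / INR (length L)) <= q (length u)) ->
  rsum (fun i => rprod (fun u => q' (length u)) (step L i)) (seq 0 (length L))
   <= INR (length L) * rprod (fun u => q (length u)) L.
Proof.
  intros HL Hq' H. set (n := INR (length L)). assert (0 < n) by (apply lt_0_INR; exact HL).
  set (P := rprod (fun u : node => q' (length u)) L).
  assert (HP : 0 < P) by (apply rprod_pos; auto).
  set (ra := fun u : list bool => q' (S (length u)) ^ 2 / q' (length u)).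
  assert (E : rsum (fun i => rprod (fun u => q' (length u)) (step L i)) (seq 0 (length L))
    = P * rsum ra L).
  { rewrite <- rsum_nth, <- rsum_scal. apply rsum_ext. intros i Hi. apply in_seq in Hi.
    rewrite step_rprod; [reflexivity | unfold node in *; lia | exact Hq']. }
  rewrite E.
  apply Rle_trans with (n * rprod (fun u => q' (length u) * exp (- (1 - ra u) / n)) L).
  - rewrite rprod_mult_exp.
    assert (Hs : rsum (fun u => - (1 - ra u) / n) L = rsum ra L / n - 1).
    { transitivity (rsum (fun u => / n * (ra u + -1)) L).
      - apply rsum_ext. intros u _. field. lra.
      - rewrite rsum_scal, rsum_plus, rsum_const. unfold node in *. fold n. field. lra. }
    rewrite Hs. pose proof (exp_ineq1_le (rsum ra L / n - 1)) as He.
    assert (rsum ra L <= n * exp (rsum ra L / n - 1)).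
    { replace (rsum ra L) with (n * (1 + (rsum ra L / n - 1))) at 1 by (field; lra).
      mono. }
    set (e := exp _) in *.
    apply Rle_trans with (P * (n * e)); [mono|].
    right. unfold P, node. ring.
  - apply Rmult_le_compat_l; [lra|]. apply rprod_le. intros u Hu. split; [|apply H, Hu].
    apply Rlt_le, Rmult_lt_0_compat; [auto | apply exp_pos].
Qed.

Lemma exp_neg_quadratic x : 0 <= x -> exp (- x) <= 1 - x + x ^ 2.
Proof.
  intros Hx. rewrite exp_Ropp.
  pose proof (exp_ineq1_le x).
  apply Rle_trans with (/ (1 + x)); [apply Rinv_le_contravar; lra|].
  apply (Rmult_le_reg_l (1 + x)); [lra|]. rewrite Rinv_r by lra. nra.
Qed.

(** Here [p] belongs to depth [S h] and [p'] to depth [h]. A leaf that splits with probability 1/n,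
    independently of the others, would give (2 p - p^2) / n; the doubled square is a reserve for the
    second-order error in [kpp_exp]. *)
Definition kpp (n : nat) (p p' : R) : R := (1 - / INR n) * p' + 2 / INR n * (p - p ^ 2).

Lemma kpp_mono n p p' r r' : (1 <= n)%nat ->
  p <= r -> r <= 1/2 -> p' <= r' -> kpp n p p' <= kpp n r r'.
Proof.
  intros Hn H1 H2 H3. unfold kpp.
  assert (1 <= INR n) by (replace 1 with (INR 1) by reflexivity; apply le_INR; exact Hn).
  assert (0 < / INR n <= 1).
  { split; [apply Rinv_0_lt_compat; lra|]. rewrite <- Rinv_1. apply Rinv_le_contravar; lra. }
  assert (p - p ^ 2 <= r - r ^ 2) by nra.
  nra.
Qed.

(** The left side is the factor that [sum_step_rprod] attaches to one leaf. Expanding the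
    exponential to second order leaves an error of at most 8 p^2 / n^2, and for [8 <= n] this fits
    into the reserve p^2 / n contained in [kpp]. *)
Lemma kpp_exp n p p' : (8 <= n)%nat -> 0 <= p' <= p -> p <= 1/2 ->
  (1 - p') * exp (- (1 - (1 - p) ^ 2 / (1 - p')) / INR n) <= 1 - kpp n p p'.
Proof.
  intros Hn Hp Hp2.
  assert (8 <= INR n) by (replace 8 with (INR 8) by (simpl; lra); apply le_INR; exact Hn).
  set (d := / INR n). assert (0 < d <= 1/8).
  { unfold d. split; [apply Rinv_0_lt_compat; lra|].
    replace (1/8) with (/ 8) by lra. apply Rinv_le_contravar; lra. }
  set (y := 2 * p - p ^ 2 - p'). assert (0 <= y <= 2 * p) by (unfold y; nra).
  set (x := (1 - (1 - p) ^ 2 / (1 - p')) / INR n).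
  assert (Ex : (1 - p') * x = y * d) by (unfold x, y, d; field; lra).
  assert (Hx : 0 <= x) by (assert (0 <= y * d) by nra; nra).
  replace (- (1 - (1 - p) ^ 2 / (1 - p')) / INR n) with (- x) by (unfold x; field; lra).
  pose proof (exp_neg_quadratic x Hx) as He.
  apply Rle_trans with ((1 - p') * (1 - x + x ^ 2)); [mono|].
  unfold kpp. unfold Rdiv. fold d.
  assert (x <= 2 * (y * d)) by nra.
  assert ((1 - p') * x ^ 2 <= (y * d) * (2 * (y * d))).
  { replace ((1 - p') * x ^ 2) with ((1 - p') * x * x) by ring. rewrite Ex.
    apply Rmult_le_compat_l; [nra | assumption]. }
  assert (y * y <= 4 * (p * p)) by nra.
  assert (d * (y * y) <= d * (4 * (p * p))) by mono.
  unfold y in *. nra.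
Qed.

Fixpoint run_max (F : nat -> R) (h : nat) : R :=
  match h with O => F O | S h' => Rmax (run_max F h') (F (S h')) end.

Lemma run_max_ge F h h' : (h' <= h)%nat -> F h' <= run_max F h.
Proof.
  induction h as [|h IH]; intros H.
  - replace h' with O by lia. simpl; lra.
  - simpl. destruct (Nat.eq_dec h' (S h)) as [->|]; [apply Rmax_r|].
    apply Rle_trans with (2 := Rmax_l _ _). apply IH; lia.
Qed.

Lemma run_max_attained F h : exists h', (h' <= h)%nat /\ run_max F h = F h'.
Proof.
  induction h as [|h (h' & H1 & H2)]; [exists O; auto|]. simpl.
  destruct (Rle_dec (run_max F h) (F (S h))).
  - exists (S h). rewrite Rmax_right by assumption. auto.
  - exists h'. rewrite Rmax_left by lra. auto.
Qed.

Lemma run_max_mono F h h' : (h <= h')%nat -> run_max F h <= run_max F h'.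
Proof.
  intros H. destruct (run_max_attained F h) as (j & Hj & ->). apply run_max_ge; lia.
Qed.

(* [phi] is a subsolution of the discrete KPP equation outside [D]; passing to its running maximum
   lets every leaf of T_m, whatever its depth, contribute at least [phi m 0]. *)
Theorem kpp_lower_bound (phi : nat -> nat -> R) (D : nat -> nat -> Prop) m N r :
  (8 <= m <= N)%nat ->
  (forall n h, 0 <= phi n h <= 1/2) ->
  (forall n h h', (m <= n <= N)%nat -> (h <= h')%nat -> D n h -> D n h') ->
  (forall n h, (m <= n < N)%nat -> ~ D n h ->
     phi n h <= kpp n (phi (S n) (S h)) (phi (S n) h)) ->
  (forall h, ~ D N h -> phi N h = 0) ->
  exp (- INR m * phi m O) < r ->
  outer_le (fun w => forall n u, (m <= n <= N)%nat -> In u (bst_leaves n w) -> ~ D n (length u)) r.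
Proof.
  intros Hm Hphi HD Hsub HN Hr.
  set (ps := fun n => run_max (phi n)).
  assert (Hps : forall n h, 0 <= ps n h <= 1/2).
  { intros n h. unfold ps. destruct (run_max_attained (phi n) h) as (j & _ & ->). apply Hphi. }
  assert (Hsub' : forall n h, (m <= n < N)%nat -> ~ D n h ->
     ps n h <= kpp n (ps (S n) (S h)) (ps (S n) h)).
  { intros n h Hn Hd. unfold ps at 1.
    destruct (run_max_attained (phi n) h) as (j & Hj & ->).
    apply Rle_trans with (1 := Hsub n j Hn ltac:(intros Hdj; apply Hd, (HD n j h); auto; lia)).
    apply kpp_mono; [lia| |apply Hps|]; apply run_max_ge; lia. }
  assert (HN' : forall h, ~ D N h -> ps N h = 0).
  { intros h Hd. unfold ps. destruct (run_max_attained (phi N) h) as (j & Hj & ->).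
    apply HN. intros Hdj. apply Hd, (HD N j h); auto; lia. }
  set (ok := fun s => forall j u, (m - 1 <= j <= length s)%nat -> In u (tree (firstn j s)) ->
                      ~ D (S j) (length u)).
  set (bad := fun s => decide (length s = (N - 1)%nat /\ ok s)).
  set (Y := fun s => rprod (fun u => 1 - ps (S (length s)) (length u)) (tree s)).
  (* Before time [m] the supermartingale is this constant. It dominates the product at time [m],
     because each of the [m] leaves has [ps] at least [phi m O] and 1 - x <= exp (-x). *)
  set (v0 := exp (- INR m * phi m O)).
  set (v := fun s => if (length s <? m - 1)%nat then v0 else
                     if decide (ok s /\ (length s <= N - 1)%nat) then Y s else 0).
  assert (HY : forall s, 0 < Y s).
  { intros s. apply rprod_pos. intros u. specialize (Hps (S (length s)) (length u)). lra. }
  assert (Hv0 : forall s, 0 <= v s).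
  { intros s. unfold v. destruct (_ <? _)%nat; [apply Rlt_le, exp_pos|].
    destruct (decide _); [apply Rlt_le, HY | lra]. }
  assert (HYm : forall s, valid_prefix s -> length s = (m - 1)%nat -> Y s <= v0).
  { intros s Hv Hl. unfold Y. rewrite Hl. replace (S (m - 1)) with m by lia.
    apply Rle_trans with (rprod (fun _ => exp (- phi m O)) (tree s)).
    - apply rprod_le. intros u _. split; [specialize (Hps m (length u)); lra|].
      apply Rle_trans with (1 + - phi m O); [|apply exp_ineq1_le].
      assert (phi m O <= ps m (length u)) by (apply run_max_ge; lia). lra.
    - rewrite rprod_const_exp, tree_length by exact Hv. rewrite Hl. apply Req_le.
      unfold v0. f_equal. replace (S (m - 1)) with m by lia. ring. }
  assert (Hok : forall s i, ok (s ++ [i]) -> ok s).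
  { intros s i H j u Hj Hu. apply H; [rewrite length_app; lia|].
    rewrite firstn_app. replace (j - length s)%nat with O by lia.
    simpl. rewrite app_nil_r. exact Hu. }
  apply outer_mono with (fun w => exists k, bad (prefix w k) = true) r; [|lra|].
  - intros w _ Hc. exists (N - 1)%nat. apply decide_true.
    rewrite prefix_length. split; [reflexivity|].
    intros j x Hj Hx. rewrite prefix_length in Hj. rewrite firstn_prefix in Hx by lia.
    apply Hc; [lia|]. rewrite bst_leaves_tree. simpl. rewrite Nat.sub_0_r. exact Hx.
  - apply ville with v.
    + auto.
    + intros s _ Hb. apply (proj1 (decide_true _)) in Hb. destruct Hb as (Hl & Hs).
      unfold v. destruct (Nat.ltb_spec (length s) (m - 1)); [lia|].
      rewrite (proj2 (decide_true _)) by (split; [exact Hs|lia]).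
      unfold Y. apply Rle_trans with (rprod (fun _ => exp 0) (tree s));
        [rewrite rprod_const_exp, Rmult_0_r, exp_0; lra|].
      apply rprod_le. intros u Hu. rewrite exp_0. rewrite Hl.
      replace (S (N - 1)) with N by lia. rewrite HN'; [lra|].
      specialize (Hs (length s) u). rewrite firstn_all, Hl in Hs.
      replace (S (N - 1)) with N in Hs by lia. apply Hs; [lia | exact Hu].
    + intros s Hv _.
      assert (Hpos : 0 < INR (S (length s))) by (apply lt_0_INR; lia).
      destruct (Nat.lt_ge_cases (length s) (m - 1)) as [Hlt|Hge].
      * apply Rle_trans with (rsum (fun _ => v0) (seq 0 (S (length s)))).
        -- apply rsum_le. intros i Hi. apply in_seq in Hi. unfold v at 1.
           destruct (Nat.ltb_spec (length (s ++ [i])) (m - 1)) as [H|H]; [lra|].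
           rewrite length_app in H. simpl in H.
           destruct (decide _); [|apply Rlt_le, exp_pos].
           apply HYm; [apply valid_snoc; [exact Hv|lia]|].
           rewrite length_app; simpl; lia.
        -- rewrite rsum_const, length_seq. unfold v.
           destruct (Nat.ltb_spec (length s) (m - 1)); [lra|lia].
      * destruct (decide (ok s /\ (length s < N - 1)%nat)) eqn:E.
        -- apply (proj1 (decide_true _)) in E. destruct E as [E1 E2].
           unfold v at 2. destruct (Nat.ltb_spec (length s) (m - 1)); [lia|].
           rewrite (proj2 (decide_true _)) by (split; [exact E1|lia]).
           apply Rle_trans with (rsum (fun i =>
             rprod (fun u => 1 - ps (S (S (length s))) (length u)) (step (tree s) i))
             (seq 0 (length (tree s)))).
           ++ rewrite tree_length by exact Hv. apply rsum_le. intros i _.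
              assert (Hvs : v (s ++ [i]) <= Y (s ++ [i])).
              { unfold v. destruct (Nat.ltb_spec (length (s ++ [i])) (m - 1)) as [H1|H1];
                  [rewrite length_app in H1; simpl in H1; lia|].
                destruct (decide _); [lra | apply Rlt_le, HY]. }
              apply Rle_trans with (1 := Hvs). unfold Y. rewrite tree_snoc, length_app.
              simpl length. rewrite Nat.add_1_r. lra.
           ++ apply Rle_trans with (INR (length (tree s)) * Y s);
                [|rewrite tree_length by exact Hv; lra].
              apply (sum_step_rprod (fun h => 1 - ps (S (length s)) h)
                       (fun h => 1 - ps (S (S (length s))) h)).
              ** rewrite tree_length by exact Hv; lia.
              ** intros h. specialize (Hps (S (S (length s))) h). lra.
              ** intros u Hu. rewrite tree_length by exact Hv.
                 assert (Hd : ~ D (S (length s)) (length u))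
                   by (apply E1; [lia|]; rewrite firstn_all; exact Hu).
                 apply Rle_trans with (1 - kpp (S (length s)) (ps (S (S (length s))) (S (length u)))
                    (ps (S (S (length s))) (length u))).
                 --- apply kpp_exp; [lia| |apply Hps]. split; [apply Hps|].
                     apply run_max_mono; lia.
                 --- specialize (Hsub' (S (length s)) (length u) ltac:(lia) Hd). lra.
        -- apply (proj1 (decide_false _)) in E. rewrite (rsum_ext _ (fun _ => 0)).
           ++ rewrite rsum_const. specialize (Hv0 s). nra.
           ++ intros i _. unfold v.
              destruct (Nat.ltb_spec (length (s ++ [i])) (m - 1)) as [H1|H1];
                [rewrite length_app in H1; simpl in H1; lia|].
              rewrite (proj2 (decide_false _)); [reflexivity|].
              intros [H2 H3]. apply E. rewrite length_app in H3. simpl in H3.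
              split; [exact (Hok s i H2) | lia].
    + unfold v. destruct (Nat.ltb_spec (length (@nil nat)) (m - 1)) as [H|H]; [exact Hr|].
      simpl in H; lia.
Qed.

(** * A supersolution of the barrier problem *)

Lemma exp_le_compat x y : x <= y -> exp x <= exp y.
Proof. intros [H|H]; [left; apply exp_increasing, H | rewrite H; lra]. Qed.

(** Second-order Taylor expansion with a cubic remainder whose constant depends on [k] alone. The
    role of [w] will be played by the relative change of tau + be y^2 in one step. *)
Lemma pow_inv_one_minus_le k : exists C, 0 <= C /\ forall w, Rabs w <= 1/2 ->
  (/ (1 - w)) ^ k <= 1 + INR k * w + INR k * (INR k + 1) / 2 * w ^ 2 + C * Rabs w ^ 3.
Proof.
  induction k as [|k (C & HC & IH)].
  - exists 0. split; [lra|]. intros w _. simpl. lra.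
  - set (m := INR k) in *. assert (Hm : 0 <= m) by apply pos_INR.
    exists (2 * C + 2 * (1 + m + m * (m + 1))). split; [nra|]. intros w Hw.
    specialize (IH w Hw). set (r := Rabs w) in *.
    assert (Hr : 0 <= r) by apply Rabs_pos.
    assert (Hwr : - r <= w <= r).
    { unfold r. split; [|apply Rle_abs]. pose proof (Rle_abs (- w)). rewrite Rabs_Ropp in H. lra. }
    assert (Hw2 : w ^ 2 = r ^ 2) by (unfold r; rewrite pow2_abs; reflexivity).
    assert (Hinv : 0 < / (1 - w) <= 2).
    { split; [apply Rinv_0_lt_compat; lra|]. replace 2 with (/ (1/2)) by lra.
      apply Rinv_le_contravar; lra. }
    rewrite <- tech_pow_Rmult, S_INR. fold m.
    set (A := 1 + m * w + m * (m + 1) / 2 * w ^ 2) in *.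
    assert (Hr3 : 0 <= r ^ 3) by (apply pow_le; assumption).
    assert (H1 : / (1 - w) * (C * r ^ 3) <= 2 * (C * r ^ 3)) by (apply Rmult_le_compat_r; nra).
    assert (E : / (1 - w) * A = 1 + (m + 1) * w + (m + 1) * (m + 1 + 1) / 2 * w ^ 2
       + w ^ 3 * ((1 + m + m * (m + 1) / 2) * / (1 - w))).
    { unfold A. field. lra. }
    assert (H2 : w ^ 3 * ((1 + m + m * (m + 1) / 2) * / (1 - w))
         <= r ^ 3 * (2 * (1 + m + m * (m + 1)))).
    { apply Rle_trans with (r ^ 3 * ((1 + m + m * (m + 1) / 2) * / (1 - w))).
      - apply Rmult_le_compat_r; [nra|].
        assert (w * w ^ 2 <= r * r ^ 2) by (rewrite Hw2; nra). lra.
      - apply Rmult_le_compat_l; [assumption|]. nra. }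
    nra.
Qed.

Lemma ln_le_minus_one x : 0 < x -> ln x <= x - 1.
Proof. intros H. pose proof (exp_ineq1_le (ln x)). rewrite exp_ln in H0 by assumption. lra. Qed.

Lemma Rpower_sub_le al tau g : 0 <= al -> 0 < g < tau ->
  Rpower (tau - g) al <= Rpower tau al * exp (- (al * g / tau)).
Proof.
  intros Hal Hg. unfold Rpower. rewrite <- exp_plus.
  assert (Hl : ln (tau - g) <= ln tau - g / tau).
  { replace (tau - g) with (tau * (1 - g / tau)) by (field; lra).
    assert (0 < 1 - g / tau).
    { assert (g / tau < 1) by (apply (Rmult_lt_reg_r tau); [lra|]; unfold Rdiv;
        rewrite Rmult_assoc, Rinv_l; lra). lra. }
    rewrite ln_mult by lra. pose proof (ln_le_minus_one (1 - g / tau) H). lra. }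
  assert (al * ln (tau - g) <= al * ln tau + - (al * g / tau)).
  { replace (al * g / tau) with (al * (g / tau)) by (unfold Rdiv; ring). nra. }
  destruct H as [H|H]; [left; apply exp_increasing, H | right; rewrite H; reflexivity].
Qed.

(** With [D = x - tau] the claim is positivity of the quadratic form (eps/2) x^2 - (5/2) x D + (k+1)
    D^2; the condition involving 25/8 says that its discriminant is not positive. *)
Lemma super_main_ineq k eps tau x : 0 < eps -> 25 / 8 <= eps * (k + 1) -> 0 < tau <= x ->
  (k - 3/2) / x + (k + 1) * (x - tau) / x ^ 2 <= (k - 3/2 + eps / 2) / tau.
Proof.
  intros He Hk Hx.
  apply (Rmult_le_reg_r (x ^ 2 * tau)); [apply Rmult_lt_0_compat; [apply pow_lt|]; lra|].
  replace (((k - 3/2) / x + (k + 1) * (x - tau) / x ^ 2) * (x ^ 2 * tau))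
    with ((k - 3/2) * x * tau + (k + 1) * (x - tau) * tau) by (field; lra).
  replace ((k - 3/2 + eps / 2) / tau * (x ^ 2 * tau)) with ((k - 3/2 + eps / 2) * x ^ 2)
    by (field; lra).
  set (D := x - tau). replace tau with (x - D) by (unfold D; ring).
  assert (0 <= (eps * x - 5/2 * D) ^ 2) by apply pow2_ge_0.
  apply (Rmult_le_reg_l eps); [assumption|].
  nra.
Qed.

(** The supersolution of the overview with tau^k multiplied through. As [k] grows it tends to y
    tau^(-s) exp (-y^2/(2 a tau)), which for s = 3/2 solves the heat equation of variance [a] and
    vanishes at 0. *)
Definition Fsup (k : nat) (a s tau y : R) : R :=
  y * Rpower tau (INR k - s) / (tau + y ^ 2 / (2 * INR k * a)) ^ k.

(** The branch in which the walk jumps. Its probability is of order [g], so an error of order [g] is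
    affordable, and the displacement [g - a] may be compared with the pure jump [-a], for which [w]
    is the relative decrease of [x]. *)
Lemma super_jump k C a be tau g y : 0 <= C ->
  (forall w, Rabs w <= 1/2 ->
    (/ (1 - w)) ^ k <= 1 + INR k * w + INR k * (INR k + 1) / 2 * w ^ 2 + C * Rabs w ^ 3) ->
  0 < a <= 1 -> 0 < be -> 1 <= y -> 0 < g -> 1 <= tau ->
  let x := tau + be * y ^ 2 in
  let w := (2 * be * y * a - be * a ^ 2) / x in
  w <= 1/4 -> g * (1 + 2 * a * be) / x <= 1/4 ->
  (1 - (a - g) / y) * (x / (tau - g + be * (y + g - a) ^ 2)) ^ k <=
  (1 - a / y) * (1 + INR k * w + INR k * (INR k + 1) / 2 * w ^ 2 + C * w ^ 3)
  + ((INR k + INR k * (INR k + 1) / 2 + C) * (1 + 2 * a * be) + 2 ^ k) * g.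
Proof.
  intros HC Hinv Ha Hbe Hy Hg Htau x w Hw Hgx.
  set (m := INR k) in *. assert (Hm : 0 <= m) by apply pos_INR.
  assert (Hx : 1 <= x) by (unfold x; pose proof (pow2_ge_0 y); nra).
  assert (Hw0 : 0 <= w).
  { unfold w. apply Rdiv_ge_of_mul; [lra|].
    assert (0 <= be * a * (2 * y - a)) by (apply Rmult_le_pos; [apply Rmult_le_pos|]; lra). lra. }
  set (w1 := w + g * (1 + 2 * a * be) / x).
  set (gd := g * (1 + 2 * a * be)) in *.
  assert (Hab : 0 < a * be) by pos.
  assert (Hgd : 0 < gd) by pos.
  assert (Hgdx : 0 <= gd / x <= gd).
  { split; [pos | apply Rdiv_le_of_mul; nra]. }
  assert (Hw1 : w <= w1 <= w + gd /\ w1 <= 1/2) by (unfold w1; lra).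
  set (xj := tau - g + be * (y + g - a) ^ 2).
  assert (Hxj : x * (1 - w1) <= xj).
  { replace (x * (1 - w1)) with (x - (2 * be * y * a - be * a ^ 2) - gd)
      by (unfold w1, w; field; lra).
    unfold x, xj, gd. assert (0 <= 2 * be * y * g) by (repeat apply Rmult_le_pos; lra).
     nra. }
  assert (Hxw : 0 < x * (1 - w1)) by pos.
  assert (Hr0 : 0 < x / xj) by pos.
  assert (Hr1 : x / xj <= / (1 - w1)).
  { apply Rdiv_le_of_mul; [lra|]. apply (Rmult_le_reg_l (1 - w1)); [lra|].
    rewrite <- Rmult_assoc, Rinv_r by lra. lra. }
  set (Rj := (x / xj) ^ k).
  assert (HRj : Rj <= (/ (1 - w1)) ^ k) by (apply pow_incr; lra).
  assert (HRj0 : 0 < Rj) by (apply pow_lt; assumption).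
  assert (HRj2 : Rj <= 2 ^ k).
  { apply Rle_trans with (1 := HRj). apply pow_incr.
    split; [left; apply Rinv_0_lt_compat; lra|]. replace 2 with (/ (1/2)) by lra.
    apply Rinv_le_contravar; lra. }
  assert (Habs : Rabs w1 = w1) by (apply Rabs_pos_eq; lra).
  pose proof (Hinv w1 ltac:(rewrite Habs; lra)) as HP. rewrite Habs in HP.
  set (P := 1 + m * w + m * (m + 1) / 2 * w ^ 2 + C * w ^ 3).
  assert (HRjP : Rj <= P + (m + m * (m + 1) / 2 + C) * gd).
  { assert (w1 ^ 2 <= w ^ 2 + gd) by nra.
    assert (w1 ^ 3 <= w ^ 3 + gd).
    { replace (w1 ^ 3) with (w1 ^ 2 * w1) by ring.
      assert (w1 ^ 2 <= 1/4) by nra.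
      assert (w1 ^ 2 + w1 * w + w ^ 2 <= 1) by nra.
      assert ((w1 - w) * (w1 ^ 2 + w1 * w + w ^ 2) <= (w1 - w) * 1)
        by mono. lra. }
    assert (m * w1 <= m * w + m * gd) by nra.
    assert (m * (m + 1) / 2 * w1 ^ 2 <= m * (m + 1) / 2 * (w ^ 2 + gd))
      by (apply Rmult_le_compat_l; nra).
    assert (C * w1 ^ 3 <= C * (w ^ 3 + gd)) by mono.
    unfold P. lra. }
  replace ((m + m * (m + 1) / 2 + C) * (1 + 2 * a * be) + 2 ^ k) with
    ((m + m * (m + 1) / 2 + C) * (1 + 2 * a * be) + 2 ^ k) by ring.
  assert (Hay : 0 <= 1 - a / y <= 1).
  { assert (a / y <= 1) by (apply Rdiv_le_of_mul; lra).
    assert (0 <= a / y) by pos. lra. }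
  assert (Hgy : 0 <= g / y <= g).
  { split; [pos | apply Rdiv_le_of_mul; nra]. }
  replace ((1 - (a - g) / y) * Rj) with ((1 - a / y) * Rj + g / y * Rj) by (field; lra).
  assert (g / y * Rj <= g * 2 ^ k) by (apply Rmult_le_compat; lra).
  assert (0 <= (m + m * (m + 1) / 2 + C) * gd) by (apply Rmult_le_pos; nra).
  assert ((1 - a / y) * Rj <= (1 - a / y) * P + (m + m * (m + 1) / 2 + C) * gd).
  { apply Rle_trans with ((1 - a / y) * (P + (m + m * (m + 1) / 2 + C) * gd)).
    - mono.
    - rewrite Rmult_plus_distr_l.
      assert ((1 - a / y) * ((m + m * (m + 1) / 2 + C) * gd) <= 1 * ((m + m * (m + 1) / 2 + C) * gd))
        by mono. lra. }
  unfold gd in *. lra.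
Qed.

(** The branch without a jump has probability close to 1, so here the terms of order [g] are kept
    exactly and only an error of order g^2 is allowed. *)
Lemma super_drift k C be M G0 tau g y : 0 <= C ->
  (forall w, Rabs w <= 1/2 ->
    (/ (1 - w)) ^ k <= 1 + INR k * w + INR k * (INR k + 1) / 2 * w ^ 2 + C * Rabs w ^ 3) ->
  0 < be -> 1 <= y -> 0 < g <= G0 -> 1 <= tau -> 0 <= M ->
  let x := tau + be * y ^ 2 in
  Rabs ((1 - 2 * be * y - be * g) / x) <= M -> M * g <= 1/2 ->
  (1 + g / y) * (x / (tau - g + be * (y + g) ^ 2)) ^ k <=
  1 + g * (1 / y + INR k * (1 - 2 * be * y) / x)
  + (INR k + (INR k * (INR k + 1) / 2 + C) * M ^ 2 * (1 + G0)) * g ^ 2.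
Proof.
  intros HC Hinv Hbe Hy Hg Htau HM x HMx HMg.
  set (m := INR k) in *. assert (Hm : 0 <= m) by apply pos_INR.
  assert (Hx : 1 <= x) by (unfold x; pose proof (pow2_ge_0 y); nra).
  set (q := (1 - 2 * be * y - be * g) / x) in *.
  set (e := q * g).
  assert (He : Rabs e <= M * g).
  { unfold e. rewrite Rabs_mult, (Rabs_pos_eq g) by lra. mono. }
  assert (He2 : e <= 1/2) by (apply Rle_trans with (2 := HMg), Rle_trans with (2 := He), Rle_abs).
  assert (Exj : tau - g + be * (y + g) ^ 2 = x * (1 - e)).
  { unfold e, q, x. field. unfold x in Hx. lra. }
  rewrite Exj. replace (x / (x * (1 - e))) with (/ (1 - e)) by (field; lra).
  pose proof (Hinv e ltac:(lra)) as HP.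
  set (D := m * (m + 1) / 2 + C) in *.
  assert (Hee : e ^ 2 <= M ^ 2 * g ^ 2).
  { rewrite <- pow2_abs. replace (M ^ 2 * g ^ 2) with ((M * g) ^ 2) by ring.
    apply pow_incr. split; [apply Rabs_pos | exact He]. }
  assert (He3 : Rabs e ^ 3 <= M ^ 2 * g ^ 2).
  { replace (Rabs e ^ 3) with (Rabs e * Rabs e ^ 2) by ring. rewrite pow2_abs.
    pose proof (pow2_ge_0 e).
    assert (Rabs e * e ^ 2 <= 1 * e ^ 2) by mono. lra. }
  assert (H1 : (/ (1 - e)) ^ k <= 1 + m * e + D * (M ^ 2 * g ^ 2)).
  { assert (m * (m + 1) / 2 * e ^ 2 <= m * (m + 1) / 2 * (M ^ 2 * g ^ 2))
      by (apply Rmult_le_compat_l; nra).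
    assert (C * Rabs e ^ 3 <= C * (M ^ 2 * g ^ 2)) by mono.
    unfold D. lra. }
  set (q0 := (1 - 2 * be * y) / x).
  assert (Hq0 : q <= q0).
  { unfold q, q0, Rdiv. apply Rmult_le_compat_r; [left; apply Rinv_0_lt_compat; lra|].
    assert (0 < be * g) by pos. lra. }
  assert (Hq01 : q0 <= 1).
  { unfold q0. apply Rdiv_le_of_mul; [lra|]. assert (0 < be * y) by pos. lra. }
  assert (H2 : (/ (1 - e)) ^ k <= 1 + m * (q0 * g) + D * (M ^ 2 * g ^ 2)).
  { assert (m * e <= m * (q0 * g)); [|lra]. apply Rmult_le_compat_l; [lra|]. unfold e.
    mono. }
  assert (Hgy : 0 <= g / y <= g).
  { split; [pos | apply Rdiv_le_of_mul; nra]. }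
  apply Rle_trans with ((1 + g / y) * (1 + m * (q0 * g) + D * (M ^ 2 * g ^ 2))).
  { mono. }
  replace (g * (1 / y + m * (1 - 2 * be * y) / x)) with (g / y + m * (q0 * g))
    by (unfold q0; field; lra).
  assert (0 <= D) by (unfold D; nra).
  assert (0 <= D * (M ^ 2 * g ^ 2)) by (apply Rmult_le_pos; [lra|apply Rmult_le_pos; apply pow2_ge_0]).
  assert (g / y * (m * (q0 * g)) <= m * g ^ 2).
  { apply Rle_trans with (g / y * (m * g)).
    - apply Rmult_le_compat_l; [lra|]. apply Rmult_le_compat_l; [lra|].
      assert (q0 * g <= 1 * g) by mono. lra.
    - assert (0 <= m * g) by pos. nra. }
  nra.
Qed.

(** Since [p] is g/a up to g^2/a, the two branches add up to 1 plus [g] times the generator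
    [J1 + (Q - 1) / a], with everything else of order g^2. *)
Lemma super_combine a g p Bj B1 Q J1 C3 C4 M5 M6 :
  0 < a -> 0 < g -> 0 <= p <= 1 -> g / a - g ^ 2 / a <= p <= g / a ->
  0 <= C3 -> 0 <= C4 -> Bj <= Q + C3 * g -> B1 <= 1 + g * J1 + C4 * g ^ 2 ->
  Rabs J1 <= M5 -> 0 <= Q <= M6 -> 1 <= M6 ->
  p * Bj + (1 - p) * B1 <= 1 + g * (J1 + (Q - 1) / a) + (C4 + (M5 + C3 + M6) / a) * g ^ 2.
Proof.
  intros Ha Hg Hp Hpa HC3 HC4 HBj HB1 HJ HQ HM6.
  assert (H1 : p * Bj <= p * (Q + C3 * g)) by mono.
  assert (H2 : (1 - p) * B1 <= (1 - p) * (1 + g * J1 + C4 * g ^ 2)) by mono.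
  assert (Hg2 : 0 <= g ^ 2) by pos.
  assert (H3 : p * (C3 * g) <= C3 / a * g ^ 2).
  { apply Rle_trans with (g / a * (C3 * g)); [apply Rmult_le_compat_r; nra|]. right. field. lra. }
  assert (H4 : - (p * (g * J1)) <= M5 / a * g ^ 2).
  { assert (- J1 <= M5) by (pose proof (Rle_abs (- J1)); rewrite Rabs_Ropp in *; lra).
    pose proof (Rabs_pos J1).
    apply Rle_trans with (p * (g * M5)).
    - assert (p * g * (- J1) <= p * g * M5) by (apply Rmult_le_compat_l; nra). lra.
    - apply Rle_trans with (g / a * (g * M5)); [apply Rmult_le_compat_r; nra|]. right. field. lra. }
  assert (H5 : p * (Q - 1) <= g / a * (Q - 1) + M6 / a * g ^ 2).
  { assert (E : M6 / a * g ^ 2 = g ^ 2 / a * M6) by lra. rewrite E.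
    destruct (Rle_dec 1 Q).
    - assert (p * (Q - 1) <= g / a * (Q - 1)) by mono.
      assert (0 <= g ^ 2 / a * M6) by pos. lra.
    - assert ((g / a - p) * (1 - Q) <= g ^ 2 / a * M6) by (apply Rmult_le_compat; lra). lra. }
  assert (H6 : (1 - p) * (C4 * g ^ 2) <= C4 * g ^ 2).
  { assert (0 <= C4 * g ^ 2) by pos. nra. }
  replace ((C4 + (M5 + C3 + M6) / a) * g ^ 2) with
    (C4 * g ^ 2 + M5 / a * g ^ 2 + C3 / a * g ^ 2 + M6 / a * g ^ 2) by (field; lra).
  replace (g * (J1 + (Q - 1) / a)) with (g * J1 + g / a * (Q - 1)) by (field; lra).
  lra.
Qed.

(** By the inequality of the means, tau + be y^2 >= 2 sqrt (be tau) y; the ratio is thus small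
    uniformly in [y] once tau is large. *)
Lemma ratio_small be eta tau y : 0 < be -> 0 < eta -> 0 < tau -> 1 / (4 * be * eta ^ 2) <= tau ->
  y / (tau + be * y ^ 2) <= eta.
Proof.
  intros Hbe Heta Ht Htau. apply Rdiv_le_of_mul; [pose proof (pow2_ge_0 y); nra|].
  assert (H : 1 <= tau * (4 * be * eta ^ 2)).
  { apply (Rmult_le_compat_r (4 * be * eta ^ 2)) in Htau; [|pose proof (pow2_ge_0 eta); nra].
    replace (1 / (4 * be * eta ^ 2) * (4 * be * eta ^ 2)) with 1 in Htau by (field; lra). exact Htau. }
  assert (0 <= (2 * be * eta * y - 1) ^ 2) by apply pow2_ge_0.
  apply (Rmult_le_reg_l (4 * be * eta)); [nra|]. nra.
Qed.

(* The continuum inequality: [y tau^(-s) (1 + y^2/(2 k a tau))^(-k)] is a strict supersolution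
   of the backward heat equation of variance [a] once [k] is large. *)
Lemma super_rate k a eps C K eta tau y :
  0 < a <= 1 -> 0 < eps -> (2 <= k)%nat -> 25 / 8 <= eps * (INR k + 1) -> 0 <= C ->
  let be := 1 / (2 * INR k * a) in
  1 <= K -> 2 / eps <= K -> K <= y -> 0 < tau -> 0 < eta ->
  C * (2 * be ^ 2 * a ^ 2 * eta) <= eps / 4 ->
  let x := tau + be * y ^ 2 in
  y / x <= eta ->
  let w := (2 * be * y * a - be * a ^ 2) / x in
  1 / y + INR k * (1 - 2 * be * y) / x +
   ((1 - a / y) * (1 + INR k * w + INR k * (INR k + 1) / 2 * w ^ 2 + C * w ^ 3) - 1) / a
  <= (INR k - 3/2 + eps) / tau.
Proof.
  intros Ha Heps Hk Hk2 HC be HK HK2 Hy Htau Heta HCe x Hyx w.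
  set (m := INR k) in *. assert (Hm : 2 <= m) by (change 2 with (INR 2); apply le_INR; exact Hk).
  assert (Hbe : 0 < be) by (unfold be; apply Rdiv_lt_0_compat; nra).
  assert (Hmba : m * be * a = 1/2) by (unfold be; field; lra).
  clearbody be.
  assert (Hx : 0 < x /\ tau <= x) by (unfold x; pose proof (pow2_ge_0 y); nra).
  set (Z := y / x) in *.
  assert (HZ : 0 <= Z) by pos.
  assert (HZ2 : be * Z ^ 2 = (x - tau) / x ^ 2) by (unfold Z, x; field; unfold x in Hx; lra).
  assert (HZt : Z ^ 2 <= 1 / (4 * be * tau)).
  { unfold Z. replace ((y / x) ^ 2) with (y ^ 2 / x ^ 2) by (field; lra).
    apply Rdiv_le_of_mul; [apply pow_lt; lra|].
    replace (1 / (4 * be * tau) * x ^ 2) with (x ^ 2 / (4 * be * tau)) by (field; lra).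
    apply Rdiv_ge_of_mul; [nra|]. unfold x.
    pose proof (pow2_ge_0 (tau - be * y ^ 2)). nra. }
  assert (Hw0 : 0 <= w).
  { unfold w. apply Rdiv_ge_of_mul; [lra|].
    assert (0 <= be * a * (2 * y - a)) by (apply Rmult_le_pos; [apply Rmult_le_pos|]; lra). lra. }
  assert (Hw : w <= 2 * be * a * Z).
  { unfold w, Z. apply Rdiv_le_of_mul; [lra|].
    replace (2 * be * a * (y / x) * x) with (2 * be * y * a) by (field; lra). nra. }
  assert (Hw2 : w ^ 2 <= 4 * be ^ 2 * a ^ 2 * Z ^ 2).
  { replace (4 * be ^ 2 * a ^ 2 * Z ^ 2) with ((2 * be * a * Z) ^ 2) by ring. apply pow_incr; lra. }
  assert (Hw3 : C * w ^ 3 / a <= eps / 4 / tau).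
  { assert (Hc : w ^ 3 <= (2 * be * a * Z) ^ 3) by (apply pow_incr; lra).
    assert (Hz3 : Z ^ 3 <= eta / (4 * be * tau)).
    { replace (Z ^ 3) with (Z * Z ^ 2) by ring.
      replace (eta / (4 * be * tau)) with (eta * (1 / (4 * be * tau))) by (field; lra).
      apply Rmult_le_compat; [lra|apply pow2_ge_0|lra|exact HZt]. }
    apply Rdiv_le_of_mul; [lra|].
    apply Rle_trans with (C * (8 * be ^ 3 * a ^ 3 * (eta / (4 * be * tau)))).
    - apply Rmult_le_compat_l; [lra|]. apply Rle_trans with (1 := Hc).
      replace ((2 * be * a * Z) ^ 3) with (8 * be ^ 3 * a ^ 3 * Z ^ 3) by ring.
      apply Rmult_le_compat_l; [|exact Hz3].
      repeat apply Rmult_le_pos; try lra; apply pow_le; lra.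
    - replace (C * (8 * be ^ 3 * a ^ 3 * (eta / (4 * be * tau))))
        with (C * (2 * be ^ 2 * a ^ 2 * eta) * (a / tau)) by (field; lra).
      replace (eps / 4 / tau * a) with (eps / 4 * (a / tau)) by (field; lra).
      apply Rmult_le_compat_r; [pos | exact HCe]. }
  assert (Hy0 : 0 < y) by lra.
  assert (Hay : 0 <= 1 - a / y <= 1).
  { assert (a / y <= 1) by (apply Rdiv_le_of_mul; lra).
    assert (0 <= a / y) by pos. lra. }
  assert (Hrest : (1 - a / y) * (m * (m + 1) / 2 * w ^ 2 + C * w ^ 3) / a <=
     (m + 1) * (be * Z ^ 2) + eps / 4 / tau).
  { apply Rle_trans with ((m * (m + 1) / 2 * w ^ 2 + C * w ^ 3) / a).
    - unfold Rdiv. apply Rmult_le_compat_r; [left; apply Rinv_0_lt_compat; lra|].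
      assert (0 <= m * (m + 1) / 2 * w ^ 2 + C * w ^ 3).
      { apply Rplus_le_le_0_compat; apply Rmult_le_pos; try (apply pow_le; lra); nra. }
      unfold Rdiv in H. nra.
    - replace ((m * (m + 1) / 2 * w ^ 2 + C * w ^ 3) / a) with
        (m * (m + 1) / 2 / a * w ^ 2 + C * w ^ 3 / a) by (field; lra).
      apply Rplus_le_compat; [|exact Hw3].
      apply Rle_trans with (m * (m + 1) / 2 / a * (4 * be ^ 2 * a ^ 2 * Z ^ 2)).
      + apply Rmult_le_compat_l; [|exact Hw2]. apply Rdiv_ge_of_mul; nra.
      + right. replace (m * (m + 1) / 2 / a * (4 * be ^ 2 * a ^ 2 * Z ^ 2)) with
          ((m + 1) * be * Z ^ 2 * (2 * (m * be * a))) by (field; lra).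
        rewrite Hmba. lra. }
  (* The term 2 m be y will cancel the drift. The constant -3/2 is -3 m be a with m be a = 1/2: one
     part comes from the square of the jump in y^2, two from its product with the change of the
     factor [y]. This is where the exponent 3/2 arises. *)
  assert (Hlin : (1 - a / y) * (m * w) / a = (2 * m * be * y - 3 / 2 + a / (2 * y)) / x).
  { unfold w. replace ((1 - a / y) * (m * ((2 * be * y * a - be * a ^ 2) / x)) / a) with
      ((2 * m * be * y - 3 * (m * be * a) + (m * be * a) * a / y) / x) by (field; lra).
    rewrite Hmba. field. lra. }
  pose proof (super_main_ineq m eps tau x Heps Hk2 ltac:(lra)) as Hmain.
  assert (Hax : a / (2 * y) / x <= eps / 4 / tau).
  { assert (a / (2 * y) <= eps / 4).
    { apply Rdiv_le_of_mul; [lra|].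
      assert (2 <= K * eps).
      { apply (Rmult_le_compat_r eps) in HK2; [|lra].
        replace (2 / eps * eps) with 2 in HK2 by (field; lra). lra. }
      nra. }
    apply Rle_trans with (eps / 4 / x).
    - unfold Rdiv at 1 3. apply Rmult_le_compat_r; [left; apply Rinv_0_lt_compat; lra | lra].
    - unfold Rdiv. apply Rmult_le_compat_l; [lra|]. apply Rinv_le_contravar; lra. }
  replace (1 / y + m * (1 - 2 * be * y) / x +
   ((1 - a / y) * (1 + m * w + m * (m + 1) / 2 * w ^ 2 + C * w ^ 3) - 1) / a) with
   (m * (1 - 2 * be * y) / x + (1 - a / y) * (m * w) / a
    + (1 - a / y) * (m * (m + 1) / 2 * w ^ 2 + C * w ^ 3) / a) by (field; lra).
  rewrite Hlin. rewrite HZ2 in Hrest.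
  replace ((m - 3/2 + eps) / tau) with ((m - 3/2 + eps/2) / tau + eps / 4 / tau + eps / 4 / tau)
    by (field; lra).
  replace (m * (1 - 2 * be * y) / x) with ((m - 2 * m * be * y) / x) by (field; lra).
  replace ((m + 1) * ((x - tau) / x ^ 2)) with ((m + 1) * (x - tau) / x ^ 2) in Hrest by (field; lra).
  lra.
Qed.

Lemma Rpower_pos x y : 0 < Rpower x y.
Proof. apply exp_pos. Qed.

(** One step of the tilted walk moves [y] by [g - a] with probability [p] and by [g] otherwise. The
    restriction [K <= y] lets eps absorb the correction a/(2y) of the lattice and keeps the position
    after a jump non-negative; this is why the walk is later observed from a point [K] below its
    killing level. *)
Theorem super_step a eps G0 : 0 < a <= 1 -> 0 < eps <= 1/2 -> 0 < G0 ->
  exists (k : nat) (K tau0 C : R), (2 <= k)%nat /\ 1 <= K /\ 1 <= tau0 /\ 0 <= C /\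
  forall tau g p y, 0 < g <= G0 -> tau0 <= tau - g -> K <= y -> 0 <= p <= 1 ->
    g / a - g ^ 2 / a <= p <= g / a ->
    p * Fsup k a (3/2 - eps) (tau - g) (y + g - a) + (1 - p) * Fsup k a (3/2 - eps) (tau - g) (y + g)
    <= exp (C * g ^ 2) * Fsup k a (3/2 - eps) tau y.
Proof.
  intros Ha Heps HG0.
  destruct (INR_unbounded (25 / 8 / eps)) as [k0 Hk0].
  set (k := (k0 + 2)%nat). destruct (pow_inv_one_minus_le k) as (C & HC & Hinv).
  assert (Hkk : (2 <= k)%nat) by (unfold k; lia).
  set (m := INR k) in *.
  assert (Hm : 2 <= m) by (change 2 with (INR 2); apply le_INR; exact Hkk).
  assert (Hk2 : 25 / 8 <= eps * (m + 1)).
  { assert (INR k0 <= m) by (apply le_INR; unfold k; lia).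
    apply (Rmult_lt_compat_r eps) in Hk0; [|lra].
    replace (25 / 8 / eps * eps) with (25 / 8) in Hk0 by (field; lra). nra. }
  set (be := 1 / (2 * m * a)).
  assert (Hbe : 0 < be) by (unfold be; apply Rdiv_lt_0_compat; nra).
  set (M := 1 / (2 * (G0 + 1))).
  assert (HM : 0 < M) by pos.
  assert (HMG : M * G0 <= 1/2).
  { unfold M. replace (1 / (2 * (G0 + 1)) * G0) with (G0 / (2 * (G0 + 1))) by (field; lra).
    apply Rdiv_le_of_mul; lra. }
  (* For large tau, y/x is at most eta for every [y]. The four bounds serve in turn to bound [J1],
     to get [w <= 1/4], to keep the relative change without a jump below [M * g], and to make the
     cubic error at most eps/4. *)
  set (eta := Rmin (Rmin 1 (1 / (8 * be))) (Rmin (M / (4 * be)) (eps / (8 * (C + 1) * be ^ 2)))).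
  assert (Heta0 : 0 < eta).
  { unfold eta. repeat apply Rmin_glb_lt; try lra; apply Rdiv_lt_0_compat; try lra.
    apply Rmult_lt_0_compat; [lra | apply pow_lt; lra]. }
  assert (Heta1 : eta <= 1)
    by (unfold eta; eapply Rle_trans; [apply Rmin_l | apply Rmin_l]).
  assert (Heta2 : eta <= 1 / (8 * be))
    by (unfold eta; eapply Rle_trans; [apply Rmin_l | apply Rmin_r]).
  assert (Heta3 : eta <= M / (4 * be))
    by (unfold eta; eapply Rle_trans; [apply Rmin_r | apply Rmin_l]).
  assert (Heta4 : eta <= eps / (8 * (C + 1) * be ^ 2))
    by (unfold eta; eapply Rle_trans; [apply Rmin_r | apply Rmin_r]).
  assert (Hbe2 : 0 < be ^ 2) by pos.
  apply (Rmult_le_compat_r (8 * be)) in Heta2; [|lra].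
  replace (1 / (8 * be) * (8 * be)) with 1 in Heta2 by (field; lra).
  apply (Rmult_le_compat_r (4 * be)) in Heta3; [|lra].
  replace (M / (4 * be) * (4 * be)) with M in Heta3 by (field; lra).
  apply (Rmult_le_compat_r (8 * (C + 1) * be ^ 2)) in Heta4; [|nra].
  replace (eps / (8 * (C + 1) * be ^ 2) * (8 * (C + 1) * be ^ 2)) with eps in Heta4 by (field; lra).
  set (K := 1 + 2 / eps).
  assert (H2e : 0 < 2 / eps) by pos.
  set (T1 := 1 / (4 * be * eta ^ 2)). set (T2 := 4 * G0 * (1 + 2 * a * be)).
  set (T3 := 2 * (1 + be * G0) / M).
  assert (HT1 : 0 < T1) by (unfold T1; apply Rdiv_lt_0_compat; [lra|];
    apply Rmult_lt_0_compat; [lra|apply pow_lt; lra]).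
  assert (Hab : 0 < a * be) by pos.
  assert (HT2 : 0 < T2) by pos.
  assert (HT3 : 0 < T3) by (unfold T3; apply Rdiv_lt_0_compat; nra).
  set (C3 := (m + m * (m + 1) / 2 + C) * (1 + 2 * a * be) + 2 ^ k).
  set (C4 := m + (m * (m + 1) / 2 + C) * M ^ 2 * (1 + G0)).
  set (M5 := 1 + m * (1 + 2 * be)). set (M6 := 1 + m + m * (m + 1) / 2 + C).
  set (C5 := C4 + (M5 + C3 + M6) / a).
  assert (HC3 : 0 <= C3).
  { unfold C3. assert (0 < 2 ^ k) by (apply pow_lt; lra).
    assert (0 <= (m + m * (m + 1) / 2 + C) * (1 + 2 * a * be)) by (apply Rmult_le_pos; nra). lra. }
  assert (HC4 : 0 <= C4).
  { unfold C4. assert (0 <= (m * (m + 1) / 2 + C) * M ^ 2 * (1 + G0)).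
    { apply Rmult_le_pos; [|lra]. apply Rmult_le_pos; [nra|apply pow2_ge_0]. } lra. }
  assert (HM5 : 0 <= M5) by (unfold M5; nra). assert (HM6 : 1 <= M6) by (unfold M6; nra).
  exists k, K, (1 + T1 + T2 + T3), C5. split; [exact Hkk|].
  split; [unfold K; lra|]. split; [lra|]. split.
  { unfold C5. assert (0 <= (M5 + C3 + M6) / a) by pos. lra. }
  intros tau g p y Hg Htau Hy Hp Hpa.
  assert (HyK : 1 <= y) by (unfold K in Hy; lra).
  set (x := tau + be * y ^ 2).
  assert (Hx : tau <= x) by (unfold x; pose proof (pow2_ge_0 y); nra).
  assert (Hx0 : 0 < x) by lra.
  assert (HZ : y / x <= eta) by (apply ratio_small; fold T1; lra).
  assert (HZ0 : 0 <= y / x) by pos.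
  set (w := (2 * be * y * a - be * a ^ 2) / x).
  assert (Hw0 : 0 <= w).
  { unfold w. apply Rdiv_ge_of_mul; [lra|].
    assert (0 <= be * a * (2 * y - a)) by pos. lra. }
  assert (Hw : w <= 1/4).
  { apply Rle_trans with (2 * be * a * (y / x)).
    - unfold w. apply Rdiv_le_of_mul; [lra|].
      replace (2 * be * a * (y / x) * x) with (2 * be * y * a) by (field; lra). nra.
    - apply Rle_trans with (2 * be * 1 * eta); [|lra]. apply Rmult_le_compat; try lra; clear - Ha Hbe; nra. }
  assert (HT2x : g * (1 + 2 * a * be) / x <= 1/4).
  { apply Rdiv_le_of_mul; [lra|].
    assert (g * (1 + 2 * a * be) <= G0 * (1 + 2 * a * be)) by mono.
    unfold T2 in *. lra. }
  assert (HMx : Rabs ((1 - 2 * be * y - be * g) / x) <= M).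
  { assert (Hbg : (1 + be * g) / x <= M / 2).
    { apply Rdiv_le_of_mul; [lra|].
      assert (T3 * M = 2 * (1 + be * G0)) by (unfold T3; field; lra).
      assert (T3 * M <= x * M) by mono. nra. }
        assert (0 < / x) by (apply Rinv_0_lt_compat; lra).
    assert (0 <= be * g / x) by pos.
    assert (be * (y / x) <= be * eta) by mono.
    assert (0 <= be * (y / x)) by pos.
    apply Rabs_le.
    replace ((1 - 2 * be * y - be * g) / x) with (/ x - 2 * (be * (y / x)) - be * g / x) by (field; lra).
    replace ((1 + be * g) / x) with (/ x + be * g / x) in * by (field; lra). lra. }
  pose proof (super_jump k C a be tau g y HC Hinv Ha Hbe HyK (proj1 Hg) ltac:(lra) Hw HT2x) as HJ.
  pose proof (super_drift k C be M G0 tau g y HC Hinv Hbe HyK Hg ltac:(lra) (Rlt_le _ _ HM) HMx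
    ltac:(apply Rle_trans with (2 := HMG); mono)) as HD.
  set (Bj := (1 - (a - g) / y) * (x / (tau - g + be * (y + g - a) ^ 2)) ^ k) in *.
  set (B1 := (1 + g / y) * (x / (tau - g + be * (y + g) ^ 2)) ^ k) in *.
  set (Q := (1 - a / y) * (1 + m * w + m * (m + 1) / 2 * w ^ 2 + C * w ^ 3)) in *.
  set (J1 := 1 / y + m * (1 - 2 * be * y) / x) in *.
  assert (HQ : 0 <= Q <= M6).
  { assert (0 <= 1 - a / y <= 1).
    { assert (a / y <= 1) by (apply Rdiv_le_of_mul; lra).
      assert (0 <= a / y) by pos. lra. }
    assert (0 <= w ^ 2 <= 1) by (clear - Hw0 Hw; split; [apply pow_le|]; nra).
    assert (0 <= w ^ 3 <= 1) by (clear - Hw0 Hw; split; [apply pow_le; lra|]; simpl; nra).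
    set (P := 1 + m * w + m * (m + 1) / 2 * w ^ 2 + C * w ^ 3) in *.
    assert (0 <= m * (m + 1) / 2) by pos.
    assert (m * (m + 1) / 2 * w ^ 2 <= m * (m + 1) / 2 * 1) by mono.
    assert (0 <= m * (m + 1) / 2 * w ^ 2) by pos.
    assert (0 <= m * w <= m * 1) by (split; [apply Rmult_le_pos | apply Rmult_le_compat_l]; lra).
    assert (0 <= C * w ^ 3 <= C * 1) by (split; [apply Rmult_le_pos | apply Rmult_le_compat_l]; lra).
    assert (0 <= P <= M6) by (unfold P, M6; lra). unfold Q.
    split; [pos|]. rewrite <- (Rmult_1_l M6). apply Rmult_le_compat; lra. }
  assert (HJ1 : Rabs J1 <= M5).
  { assert (0 < 1 / y <= 1).
    { split; [pos | apply Rdiv_le_of_mul; lra]. }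
    assert (0 < 1 / x <= 1).
    { split; [pos | apply Rdiv_le_of_mul; lra]. }
    replace J1 with (1 / y + m * (1 / x - 2 * be * (y / x))) by (unfold J1; field; lra).
    assert (0 <= be * (y / x) <= be * 1)
      by (split; [apply Rmult_le_pos | apply Rmult_le_compat_l]; lra).
    assert (m * (1 / x - 2 * be * (y / x)) <= m * (1 + 2 * be)) by mono.
    assert (m * - (1 + 2 * be) <= m * (1 / x - 2 * be * (y / x))) by mono.
    apply Rabs_le. unfold M5. lra. }
  pose proof (super_combine a g p Bj B1 Q J1 C3 C4 M5 M6 ltac:(lra) (proj1 Hg) Hp Hpa HC3 HC4 HJ HD HJ1 HQ HM6) as Hcomb.
  assert (Hrate : J1 + (Q - 1) / a <= (m - 3/2 + eps) / tau).
  { apply (super_rate k a eps C K eta tau y Ha (proj1 Heps) Hkk Hk2 HC); fold m; fold be; fold x;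
      try assumption; try lra; unfold K; try lra.
    assert (be ^ 2 * a ^ 2 * (C * eta) <= be ^ 2 * 1 * (C * eta)).
    { apply Rmult_le_compat_r; [pos|]. apply Rmult_le_compat_l; [lra|].
      clear - Ha. simpl. nra. }
    assert (be ^ 2 * (C * eta) <= be ^ 2 * ((C + 1) * eta)) by mono.
    lra. }
  fold C5 in Hcomb.
  assert (Htot : p * Bj + (1 - p) * B1 <= exp ((m - 3/2 + eps) * g / tau + C5 * g ^ 2)).
  { apply Rle_trans with (2 := exp_ineq1_le _). apply Rle_trans with (1 := Hcomb).
    replace ((m - 3/2 + eps) * g / tau) with (g * ((m - 3/2 + eps) / tau)) by (field; lra).
    assert (g * (J1 + (Q - 1) / a) <= g * ((m - 3/2 + eps) / tau))
      by mono. lra. }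
  unfold Fsup. fold m.
  replace (m - (3/2 - eps)) with (m - 3/2 + eps) by ring.
  set (al := m - 3/2 + eps) in *.
  assert (Hal : 0 <= al) by (unfold al; lra).
  pose proof (Rpower_sub_le al tau g Hal ltac:(lra)) as HR.
  assert (Ebe : forall z, z ^ 2 / (2 * m * a) = be * z ^ 2) by (intros; unfold be; field; lra).
  rewrite !Ebe. fold x.
  set (xj := tau - g + be * (y + g - a) ^ 2) in *.
  set (x1 := tau - g + be * (y + g) ^ 2) in *.
  assert (Hxj : 0 < xj) by (unfold xj; pose proof (Rmult_le_pos be _ (Rlt_le _ _ Hbe) (pow2_ge_0 (y + g - a))); lra).
  assert (Hx1 : 0 < x1) by (unfold x1; pose proof (Rmult_le_pos be _ (Rlt_le _ _ Hbe) (pow2_ge_0 (y + g))); lra).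
  set (T := Rpower tau al) in *. set (T' := Rpower (tau - g) al) in *.
   assert (HT'0 : 0 < T') by apply Rpower_pos.
  assert (Hxk : 0 < x ^ k) by (apply pow_lt; assumption).
  assert (Hxjk : 0 < xj ^ k) by (apply pow_lt; assumption).
  assert (Hx1k : 0 < x1 ^ k) by (apply pow_lt; assumption).
  assert (E1 : p * ((y + g - a) * T' / xj ^ k) + (1 - p) * ((y + g) * T' / x1 ^ k)
    = y / x ^ k * T' * (p * Bj + (1 - p) * B1)).
  { unfold Bj, B1, Rdiv. rewrite !Rpow_mult_distr, !pow_inv. field. lra. }
  rewrite E1.
  assert (Hyx : 0 < y / x ^ k) by pos.
  apply Rle_trans with (y / x ^ k * T' * exp (al * g / tau + C5 * g ^ 2)).
  { apply Rmult_le_compat_l; [pos | exact Htot]. }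
  apply Rle_trans with (y / x ^ k * (T * exp (- (al * g / tau))) * exp (al * g / tau + C5 * g ^ 2)).
  { apply Rmult_le_compat_r; [left; apply exp_pos|]. mono. }
  right. rewrite exp_plus, exp_Ropp. pose proof (exp_pos (al * g / tau)). field. lra.
Qed.

(** * A subsolution of the barrier problem *)

(** Convexity of [exp]: its tangent at e ln (1+s) lies below the graph at ln (1+s) and at 0; the two
    inequalities are added with weights [e] and [1 - e]. *)
Lemma Rpower_bernoulli s e : -1 < s -> 0 <= e <= 1 -> Rpower (1 + s) e <= 1 + e * s.
Proof.
  intros Hs He. unfold Rpower. set (L := ln (1 + s)). set (m := e * L).
  assert (H1 : exp m * (1 + (L - m)) <= exp L).
  { replace (exp L) with (exp m * exp (L - m)) by (rewrite <- exp_plus; f_equal; ring).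
    apply Rmult_le_compat_l; [left; apply exp_pos | apply exp_ineq1_le]. }
  assert (H2 : exp m * (1 + - m) <= 1).
  { replace 1 with (exp m * exp (- m)) at 2 by (rewrite <- exp_plus, Rplus_opp_r; apply exp_0).
    apply Rmult_le_compat_l; [left; apply exp_pos | apply exp_ineq1_le]. }
  replace (exp L) with (1 + s) in H1 by (unfold L; rewrite exp_ln; lra).
  assert (H3 : e * (exp m * (1 + (L - m))) + (1 - e) * (exp m * (1 + - m)) <= e * (1 + s) + (1 - e) * 1).
  { apply Rplus_le_compat; mono. }
  replace (e * (exp m * (1 + (L - m))) + (1 - e) * (exp m * (1 + - m))) with (exp m) in H3
    by (unfold m; ring). lra.
Qed.

Lemma Rpower_one_plus x e : 0 < x -> Rpower x (1 + e) = x * Rpower x e.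
Proof. intros H. rewrite Rpower_plus, Rpower_1; auto. Qed.

(** The quadratic term measures the strict convexity of the power 1 + e > 1. It is the gain from
    which the nonlinear term, and close to the barrier also the discretisation errors, will be
    paid. *)
Lemma Rpower_one_minus_ge t e : 0 <= t < 1 -> 0 <= e <= 1 ->
  1 - (1 + e) * t + e ^ 2 * t ^ 2 <= Rpower (1 - t) (1 + e).
Proof.
  intros Ht He. rewrite Rpower_one_plus by lra.
  assert (Hd : 0 < 1 - (1 - e) * t) by nra.
  assert (Hb : (1 - t) / (1 - (1 - e) * t) <= Rpower (1 - t) e).
  { pose proof (Rpower_bernoulli (t / (1 - t)) e) as H.
    assert (0 <= t / (1 - t)) by pos.
    specialize (H ltac:(lra) He).
    replace (1 + t / (1 - t)) with (/ (1 - t)) in H by (field; lra).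
    assert (E : Rpower (/ (1 - t)) e = / Rpower (1 - t) e).
    { unfold Rpower. rewrite ln_Rinv by lra. rewrite <- exp_Ropp. f_equal. ring. }
    rewrite E in H.
    replace (1 + e * (t / (1 - t))) with ((1 - (1 - e) * t) / (1 - t)) in H by (field; lra).
    pose proof (exp_pos (e * ln (1 - t))) as Hp. fold (Rpower (1 - t) e) in Hp.
    apply Rdiv_le_of_mul; [lra|].
    apply (Rmult_le_compat_l (Rpower (1 - t) e * (1 - t))) in H; [|nra].
    replace (Rpower (1 - t) e * (1 - t) * / Rpower (1 - t) e) with (1 - t) in H by (field; lra).
    replace (Rpower (1 - t) e * (1 - t) * ((1 - (1 - e) * t) / (1 - t))) with
      (Rpower (1 - t) e * (1 - (1 - e) * t)) in H by (field; lra). exact H. }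
  apply Rle_trans with ((1 - t) * ((1 - t) / (1 - (1 - e) * t))).
  - replace ((1 - t) * ((1 - t) / (1 - (1 - e) * t))) with ((1 - t) ^ 2 / (1 - (1 - e) * t))
      by (field; lra).
    apply Rdiv_ge_of_mul; [assumption|].
    assert (0 <= e ^ 2 * t ^ 2 * ((1 - e) * t)).
    { apply Rmult_le_pos; [apply Rmult_le_pos; apply pow2_ge_0|]. pos. }
    lra.
  - mono.
Qed.

Lemma Rpower_one_plus_ge x e : 0 <= x -> 0 <= e <= 1 -> 1 + (1 + e) * x <= Rpower (1 + x) (1 + e).
Proof.
  intros Hx He. rewrite Rpower_one_plus by lra.
  assert (Hd : 0 < 1 + (1 - e) * x) by nra.
  assert (Hb : (1 + x) / (1 + (1 - e) * x) <= Rpower (1 + x) e).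
  { pose proof (Rpower_bernoulli (- (x / (1 + x))) e) as H.
    assert (x / (1 + x) < 1).
    { apply (Rmult_lt_reg_r (1 + x)); [lra|]. unfold Rdiv. rewrite Rmult_assoc, Rinv_l; lra. }
    specialize (H ltac:(lra) He).
    replace (1 + - (x / (1 + x))) with (/ (1 + x)) in H by (field; lra).
    assert (E : Rpower (/ (1 + x)) e = / Rpower (1 + x) e).
    { unfold Rpower. rewrite ln_Rinv by lra. rewrite <- exp_Ropp. f_equal. ring. }
    rewrite E in H.
    replace (1 + e * - (x / (1 + x))) with ((1 + (1 - e) * x) / (1 + x)) in H by (field; lra).
    pose proof (exp_pos (e * ln (1 + x))) as Hp. fold (Rpower (1 + x) e) in Hp.
    apply Rdiv_le_of_mul; [lra|].
    apply (Rmult_le_compat_l (Rpower (1 + x) e * (1 + x))) in H; [|nra].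
    replace (Rpower (1 + x) e * (1 + x) * / Rpower (1 + x) e) with (1 + x) in H by (field; lra).
    replace (Rpower (1 + x) e * (1 + x) * ((1 + (1 - e) * x) / (1 + x))) with
      (Rpower (1 + x) e * (1 + (1 - e) * x)) in H by (field; lra). exact H. }
  apply Rle_trans with ((1 + x) * ((1 + x) / (1 + (1 - e) * x))).
  - replace ((1 + x) * ((1 + x) / (1 + (1 - e) * x))) with ((1 + x) ^ 2 / (1 + (1 - e) * x))
      by (field; lra).
    apply Rdiv_ge_of_mul; [assumption|].
    assert (0 <= e ^ 2 * x ^ 2) by (apply Rmult_le_pos; apply pow2_ge_0). lra.
  - mono.
Qed.

Lemma pow_one_plus_ge k d : 0 <= d ->
  1 + INR k * d + INR k * (INR k - 1) / 2 * d ^ 2 <= (1 + d) ^ k.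
Proof.
  intros Hd. induction k as [|k IH]; [simpl; lra|].
  rewrite <- tech_pow_Rmult, S_INR. set (m := INR k) in *.
  assert (Hmm : 0 <= m * (m - 1)).
  { unfold m. destruct k; [simpl; lra|]. rewrite S_INR. pose proof (pos_INR k). nra. }
  apply Rle_trans with ((1 + d) * (1 + m * d + m * (m - 1) / 2 * d ^ 2)).
  - assert (0 <= m * (m - 1) / 2 * d ^ 3) by (apply Rmult_le_pos; [lra|apply pow_le; lra]).
    replace ((1 + d) * (1 + m * d + m * (m - 1) / 2 * d ^ 2)) with
      (1 + (m + 1) * d + (m + 1) * (m + 1 - 1) / 2 * d ^ 2 + m * (m - 1) / 2 * d ^ 3) by field.
    lra.
  - apply Rmult_le_compat_l; [lra | exact IH].
Qed.

Lemma pow_bernoulli_neg k u : 0 <= u -> (1 <= k)%nat -> 1 - INR k * u <= Rmax 0 (1 - u) ^ k.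
Proof.
  intros Hu Hk. destruct (Rle_dec 1 u) as [H|H].
  - apply Rle_trans with 0; [|apply pow_le, Rmax_l].
    assert (1 <= INR k) by (change 1 with (INR 1); apply le_INR, Hk). nra.
  - rewrite Rmax_right by lra. clear Hk. induction k as [|k IH]; [simpl; lra|].
    rewrite <- tech_pow_Rmult, S_INR. pose proof (pos_INR k).
    apply Rle_trans with ((1 - u) * (1 - INR k * u)); [nra|]. mono.
Qed.

(** The truncation gives the profile the support 0 < y < sqrt (tau/be), so that at the final time it
    vanishes away from the barrier, as a terminal condition requires. The exponent [rho] will be 1 +
    eps; an exponent above 1 makes the power strictly convex. *)
Definition Gsub (k : nat) (be rho tau y : R) : R :=
  if Rlt_dec 0 y then Rpower y rho * Rmax 0 (1 - be * y ^ 2 / tau) ^ k else 0.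

Lemma Gsub_nonneg k be rho tau y : 0 <= Gsub k be rho tau y.
Proof.
  unfold Gsub. destruct (Rlt_dec 0 y); [|lra].
  apply Rmult_le_pos; [left; apply exp_pos | apply pow_le, Rmax_l].
Qed.

Lemma Gsub_le k be rho tau y : 0 <= be -> 0 < tau -> 0 < y -> Gsub k be rho tau y <= Rpower y rho.
Proof.
  intros Hbe Ht Hy. unfold Gsub. destruct (Rlt_dec 0 y); [|lra].
  rewrite <- (Rmult_1_r (Rpower y rho)) at 2. apply Rmult_le_compat_l; [left; apply exp_pos|].
  apply Rle_trans with (1 ^ k); [|rewrite pow1; lra].
  apply pow_incr. split; [apply Rmax_l|]. apply Rmax_lub; [lra|].
  assert (0 <= be * y ^ 2 / tau); [|lra]. apply Rdiv_ge_of_mul; [lra|].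
  pose proof (Rmult_le_pos be _ Hbe (pow2_ge_0 y)). lra.
Qed.

Lemma exp_mult_INR k x : exp (INR k * x) = exp x ^ k.
Proof.
  induction k; [simpl; rewrite Rmult_0_l; apply exp_0|].
  rewrite S_INR, Rmult_plus_distr_r, exp_plus, IHk, Rmult_1_l. simpl. ring.
Qed.

(** The new value is compared with the old one factor by factor: [y' / y] in the power, [L] as a
    lower bound for the ratio of the quadratics tau - be y^2, and (tau/(tau-g))^k >= exp (k g/tau)
    from the shrinking denominator. *)
Lemma Gsub_lower k be rho tau g y y' L :
  0 < g < tau -> 0 < y -> 0 < y' -> 0 < tau - be * y ^ 2 ->
  L * (tau - be * y ^ 2) <= tau - g - be * y' ^ 2 ->
  Gsub k be rho tau y * exp (INR k * g / tau) * (Rpower (y' / y) rho * Rmax 0 L ^ k)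
  <= Gsub k be rho (tau - g) y'.
Proof.
  intros Hg Hy Hy' Hx HL. unfold Gsub.
  destruct (Rlt_dec 0 y); [|lra]. destruct (Rlt_dec 0 y'); [|lra].
  set (x := tau - be * y ^ 2) in *.
  replace (1 - be * y ^ 2 / tau) with (x / tau) by (unfold x; field; lra).
  assert (Hxt : 0 < x / tau) by pos.
  rewrite (Rmax_right 0 (x / tau)) by lra.
  replace (INR k * g / tau) with (INR k * (g / tau)) by (field; lra). rewrite exp_mult_INR.
  assert (E : Rpower y' rho = Rpower y rho * Rpower (y' / y) rho).
  { rewrite Rpower_mult_distr; [f_equal; field; lra | lra | pos]. }
  rewrite E.
  replace (Rpower y rho * (x / tau) ^ k * exp (g / tau) ^ k * (Rpower (y' / y) rho * Rmax 0 L ^ k))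
    with (Rpower y rho * Rpower (y' / y) rho * ((x / tau * exp (g / tau) * Rmax 0 L) ^ k))
    by (rewrite !Rpow_mult_distr; ring).
  apply Rmult_le_compat_l.
  { apply Rmult_le_pos; left; apply exp_pos. }
  apply pow_incr. pose proof (exp_pos (g / tau)) as He. pose proof (Rmax_l 0 L) as HL0.
  split; [apply Rmult_le_pos; [apply Rmult_le_pos|]; lra|].
  assert (Hexp : exp (g / tau) <= tau / (tau - g)).
  { pose proof (exp_ineq1_le (- (g / tau))) as H. rewrite exp_Ropp in H.
    apply Rdiv_ge_of_mul; [lra|].
    apply (Rmult_le_compat_l (exp (g / tau) * tau)) in H; [|nra].
    replace (exp (g / tau) * tau * (1 + - (g / tau))) with (exp (g / tau) * (tau - g)) in H
      by (field; lra).
    replace (exp (g / tau) * tau * / exp (g / tau)) with tau in H by (field; lra). exact H. }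
  destruct (Rle_dec L 0) as [HL1|HL1].
  - rewrite Rmax_left by lra. rewrite Rmult_0_r. apply Rmax_l.
  - rewrite (Rmax_right 0 L) by lra. apply Rle_trans with (2 := Rmax_r _ _).
    apply Rle_trans with (x / tau * (tau / (tau - g)) * L).
    + apply Rmult_le_compat_r; [lra|]. mono.
    + replace (x / tau * (tau / (tau - g)) * L) with (L * x / (tau - g)) by (field; lra).
      replace (1 - be * y' ^ 2 / (tau - g)) with ((tau - g - be * y' ^ 2) / (tau - g)) by (field; lra).
      unfold Rdiv. apply Rmult_le_compat_r; [left; apply Rinv_0_lt_compat; lra | exact HL].
Qed.

Lemma exp_neg_Rpower_le y rho : 0 < y -> 0 <= rho <= 3/2 -> exp (- y) * Rpower y rho <= exp (- (y / 4)).
Proof.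
  intros Hy Hr. unfold Rpower. rewrite <- exp_plus.
  assert (Hl : ln y <= y / 2).
  { pose proof (ln_le_minus_one (y / 2) ltac:(lra)) as H. unfold Rdiv in H.
    rewrite ln_mult in H by lra. rewrite ln_Rinv in H by lra.
    pose proof (ln_le_minus_one 2 ltac:(lra)). lra. }
  assert (- y + rho * ln y <= - (y / 4)).
  { destruct (Rle_dec 0 (ln y)); nra. }
  destruct H as [H|H]; [left; apply exp_increasing, H | right; rewrite H; reflexivity].
Qed.

Lemma exp_quarter_decay y : 0 <= y -> exp (- ((y - 1) / 4)) * y ^ 2 <= 128.
Proof.
  intros Hy. pose proof (exp_ineq1_le (y / 8)) as H.
  assert (H2 : (y / 8) ^ 2 <= exp (y / 4)).
  { replace (exp (y / 4)) with (exp (y / 8) ^ 2) by (simpl; rewrite Rmult_1_r, <- exp_plus; f_equal; field).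
    apply pow_incr. lra. }
  replace (- ((y - 1) / 4)) with (1 / 4 + - (y / 4)) by field. rewrite exp_plus, exp_Ropp.
  assert (H3 : exp (1 / 4) <= 2).
  { pose proof (exp_ineq1_le (- (1/4))) as H3. rewrite exp_Ropp in H3.
    apply Rinv_le_contravar in H3; [|lra]. rewrite Rinv_inv in H3.
    replace (/ (1 + - (1 / 4))) with (4 / 3) in H3 by field. lra. }
  pose proof (exp_pos (y / 4)) as Hp.
  assert (H4 : / exp (y / 4) * y ^ 2 <= 64).
  { apply (Rmult_le_reg_l (exp (y / 4))); [assumption|].
    rewrite <- Rmult_assoc, Rinv_r, Rmult_1_l by lra. nra. }
  pose proof (exp_pos (1/4)).
  rewrite Rmult_assoc. nra.
Qed.

(** The factor exp (-yj) beats the growth of the power, so the nonlinear correction never exceeds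
    half of the convexity gain eps^2 (a/y)^2. The bound on [c] is dictated by this: 256 is twice the
    128 of [exp_quarter_decay]. *)
Lemma nonlinear_small k be eps a c tau y yj :
  0 <= be -> 0 < tau -> 0 < eps <= 1/2 -> 0 < a <= 1 -> 0 <= c <= eps ^ 2 * a ^ 2 / 256 ->
  0 < y -> y - a <= yj ->
  0 <= c * exp (- yj) * Gsub k be (1 + eps) tau yj <= 1/2 * eps ^ 2 * (a / y) ^ 2.
Proof.
  intros Hbe Ht He Ha Hc Hy Hyj.
  assert (Hce : 0 <= c * exp (- yj)) by (apply Rmult_le_pos; [lra | left; apply exp_pos]).
  split; [apply Rmult_le_pos; [lra | apply Gsub_nonneg]|].
  assert (Hrhs : 0 <= 1/2 * eps ^ 2 * (a / y) ^ 2)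
    by (apply Rmult_le_pos; [apply Rmult_le_pos; [lra|]|]; apply pow2_ge_0).
  destruct (Rlt_dec 0 yj) as [Hp|Hn];
    [|unfold Gsub; destruct (Rlt_dec 0 yj); [contradiction|lra]].
  assert (H1 : exp (- yj) * Gsub k be (1 + eps) tau yj <= exp (- ((y - 1) / 4))).
  { apply Rle_trans with (exp (- yj) * Rpower yj (1 + eps)).
    - apply Rmult_le_compat_l; [left; apply exp_pos | apply Gsub_le; lra].
    - apply Rle_trans with (exp (- (yj / 4))); [apply exp_neg_Rpower_le; lra|].
      destruct (Rle_lt_or_eq_dec (- (yj / 4)) (- ((y - 1) / 4))) as [H|H]; [lra| |].
      + left. apply exp_increasing, H.
      + rewrite H. lra. }
  pose proof (exp_quarter_decay y ltac:(lra)) as H2.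
  assert (Hy2 : 0 < y ^ 2) by pos.
  apply (Rmult_le_reg_r (y ^ 2)); [assumption|].
  replace (1/2 * eps ^ 2 * (a / y) ^ 2 * y ^ 2) with (eps ^ 2 * a ^ 2 / 256 * 128) by (field; lra).
  set (D := exp (- ((y - 1) / 4))) in *.
  assert (0 < D) by apply exp_pos.
  apply Rle_trans with (c * (D * y ^ 2)).
  - rewrite !Rmult_assoc. apply Rmult_le_compat_l; [lra|]. rewrite <- Rmult_assoc.
    mono.
  - apply Rmult_le_compat; try lra. pos.
Qed.

(** Near the barrier. Here [g'] is the drift [g - E] relative to the moving barrier and [kap] bounds
    E/g. Of the convexity gain p eps^2 (a/y)^2, one half goes to the nonlinear term, a quarter to
    the errors in [p] and [kap], and the last quarter is at least [p * eta]; for large tau this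
    exceeds the loss [z] caused by the passage of time. *)
Lemma sub_step_low k be eps a c K kap tau g g' p y :
  let rho := 1 + eps in
  let eta := eps ^ 2 * a ^ 2 / (4 * K ^ 2) in
  0 < be -> 0 < eps <= 1/2 -> 0 < a <= 1 -> 0 <= c <= eps ^ 2 * a ^ 2 / 256 -> (1 <= k)%nat ->
  1 <= K -> 0 < y <= K -> 0 < g <= 1/2 -> 0 <= g' <= g -> (1 - kap) * g <= g' -> 0 <= kap ->
  g / (2 * a) <= p <= g / a -> p + kap <= eps ^ 2 * a / (8 * K) ->
  2 * be * K ^ 2 <= tau -> 1 <= tau ->
  4 * a * (INR k * (2 * (1 + 2 * be * K + be))) <= eta * tau ->
  let yj := y + g' - a in
  let nu := c * exp (- yj) * Gsub k be rho (tau - g) yj in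
  Gsub k be rho tau y <=
    p * (1 - nu) * Gsub k be rho (tau - g) yj + (1 - p) * Gsub k be rho (tau - g) (y + g').
Proof.
  intros rho eta Hbe He Ha Hc Hk HK Hy Hg Hg' Hkap Hkap0 Hp Hpk Hb1 Ht Hb2 yj nu.
  set (x := tau - be * y ^ 2).
  assert (HK2 : 0 < K ^ 2) by pos.
  assert (Hx : tau / 2 <= x).
  { unfold x. assert (y ^ 2 <= K ^ 2) by (apply pow_incr; lra).
    assert (be * y ^ 2 <= be * K ^ 2) by mono. lra. }
  set (u := (g + 2 * be * y * g + be * g ^ 2) / x).
  set (m := INR k) in *. assert (Hm : 1 <= m) by (change 1 with (INR 1); apply le_INR, Hk).
  set (N := 2 * (1 + 2 * be * K + be)) in *.
  assert (HN : 0 < N) by (unfold N; clear - Hbe HK; nra).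
  set (z := m * N * g / tau).
  assert (Hu : 0 <= u /\ m * u <= z).
  { assert (Hnum : 0 <= g + 2 * be * y * g + be * g ^ 2 <= N / 2 * g).
    { unfold N.
      assert (0 <= be * g ^ 2) by (apply Rmult_le_pos; [lra|apply pow2_ge_0]).
       split; [nra|]. nra. }
    unfold u. split; [pos|]. unfold z.
    replace (m * N * g / tau) with (m * ((N / 2 * g) / (tau / 2))) by (field; lra).
    apply Rmult_le_compat_l; [lra|].
    apply Rle_trans with ((N / 2 * g) / x).
    - unfold Rdiv at 1 2. apply Rmult_le_compat_r; [left; apply Rinv_0_lt_compat|]; lra.
    - unfold Rdiv at 1 3. apply Rmult_le_compat_l; [lra|]. apply Rinv_le_contravar; lra. }
  clearbody N.
  assert (Heta0 : 0 < eta) by (unfold eta; apply Rdiv_lt_0_compat; [|lra];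
    apply Rmult_lt_0_compat; apply pow_lt; lra).
  assert (Heta : eta <= eps / 2).
  { unfold eta. apply Rdiv_le_of_mul; [lra|]. assert (1 <= K ^ 2) by (clear - HK; nra).
    assert (a ^ 2 <= 1) by (clear - Ha; nra).
    apply Rle_trans with (eps * eps * 1); [replace (eps ^ 2) with (eps * eps) by ring; apply Rmult_le_compat_l; [clear - He; nra|lra]|].
    apply Rle_trans with (eps / 2 * (4 * 1)); [clear - He; nra|].
    mono. }
  assert (Hz : 0 <= z <= p * eta / 2).
  { unfold z. split; [apply Rdiv_ge_of_mul; [lra|]; rewrite Rmult_0_l; repeat apply Rmult_le_pos; lra|].
    apply Rle_trans with (g / (2 * a) * eta / 2).
    - apply Rdiv_le_of_mul; [lra|].
      replace (g / (2 * a) * eta / 2 * tau) with (g / (4 * a) * (eta * tau)) by (field; lra).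
      replace (m * N * g) with (g / (4 * a) * (4 * a * (m * N))) by (field; lra).
      apply Rmult_le_compat_l; [apply Rdiv_ge_of_mul|]; lra.
    - assert (g / (2 * a) * eta <= p * eta) by mono. lra. }
  assert (Hp0 : 0 < g / (2 * a)) by pos.
  set (del := eps ^ 2 * a / (8 * K)) in *.
  assert (Hdel : del <= eps / 16).
  { unfold del. apply Rdiv_le_of_mul; [lra|].
    apply Rle_trans with (eps * (1/2) * 1).
    - replace (eps ^ 2) with (eps * eps) by ring. apply Rmult_le_compat; try lra; clear - He; nra.
    - replace (eps / 16 * (8 * K)) with (eps * (1/2) * K) by field. mono. }
  set (t := a / y). set (G := Gsub k be rho tau y).
  assert (HG : 0 <= G) by apply Gsub_nonneg.
  assert (Hex : 1 <= exp (m * g / tau)).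
  { apply Rle_trans with (2 := exp_ineq1_le _).
    assert (0 <= m * g / tau) by pos. lra. }
  assert (Hux : (1 - u) * x = x - g - 2 * be * y * g - be * g ^ 2) by (unfold u; field; lra).
  assert (Hpow : 1 - z <= Rmax 0 (1 - u) ^ k).
  { pose proof (pow_bernoulli_neg k u (proj1 Hu) Hk) as H. fold m in H. lra. }
  assert (Hp1 : p <= 1/2) by lra.
  assert (Hz1 : z <= 1/2).
  { assert (p * eta <= 1/2 * (1/4)) by (apply Rmult_le_compat; lra). lra. }
  assert (Hgy : (1 - kap) * p * t <= g' / y).
  { unfold t. apply Rdiv_ge_of_mul; [lra|].
    replace ((1 - kap) * p * (a / y) * y) with ((1 - kap) * (p * a)) by (field; lra).
    apply Rle_trans with (2 := Hkap). apply Rmult_le_compat_l; [lra|].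
    apply Rle_trans with (g / a * a); [mono | right; field; lra]. }
  assert (Hgy0 : 0 <= g' / y) by pos.
  assert (H1 : G * ((1 - z) * (1 + rho * (g' / y))) <= Gsub k be rho (tau - g) (y + g')).
  { pose proof (Gsub_lower k be rho tau g y (y + g') (1 - u) ltac:(lra) ltac:(lra) ltac:(lra)) as H.
    fold x in H. specialize (H ltac:(lra)). rewrite Hux in H.
    assert (Hc1 : x - g - 2 * be * y * g - be * g ^ 2 <= tau - g - be * (y + g') ^ 2).
    { unfold x. assert ((y + g') ^ 2 <= (y + g) ^ 2) by (apply pow_incr; lra).
      assert (be * (y + g') ^ 2 <= be * (y + g) ^ 2) by mono. lra. }
    specialize (H Hc1). apply Rle_trans with (2 := H).
    replace ((y + g') / y) with (1 + g' / y) by (field; lra).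
    pose proof (Rpower_one_plus_ge (g' / y) eps Hgy0 ltac:(lra)) as HB.
    rewrite Rmult_assoc. apply Rmult_le_compat_l; [exact HG|].
    rewrite <- (Rmult_1_l ((1 - z) * (1 + rho * (g' / y)))).
    apply Rmult_le_compat; [lra| |exact Hex|].
    - apply Rmult_le_pos; [lra|]. assert (0 <= rho * (g' / y)) by (apply Rmult_le_pos; unfold rho; lra). lra.
    - rewrite Rmult_comm. apply Rmult_le_compat; [|lra|exact HB|exact Hpow].
      assert (0 <= rho * (g' / y)) by (apply Rmult_le_pos; unfold rho; lra). lra. }
  assert (Ht0 : a / K <= t).
  { unfold t, Rdiv. apply Rmult_le_compat_l; [lra|]. apply Rinv_le_contravar; lra. }
  assert (HaK : 0 < a / K) by pos.
  assert (Hrd : (p + kap) * rho <= 1/4 * eps ^ 2 * (a / K)).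
  { apply Rle_trans with (del * (3/2)); [apply Rmult_le_compat; unfold rho; lra|].
    unfold del. replace (eps ^ 2 * a / (8 * K) * (3/2)) with (3/16 * (eps ^ 2 * (a / K))) by (field; lra).
    assert (0 <= eps ^ 2 * (a / K)) by (apply Rmult_le_pos; [apply pow2_ge_0|lra]). lra. }
  set (w := (1 - p) * (1 + rho * (g' / y))) in *.
  assert (Hw : 1 - p + p * (rho * t) - p * t * ((p + kap) * rho) <= w).
  { unfold w. assert (Hq : (1 - p) * (rho * ((1 - kap) * p * t)) <= (1 - p) * (rho * (g' / y))).
    { apply Rmult_le_compat_l; [lra|]. apply Rmult_le_compat_l; [unfold rho; lra|exact Hgy]. }
    assert (0 <= p * t * rho * (p * kap)).
    { apply Rmult_le_pos; [apply Rmult_le_pos; [apply Rmult_le_pos|]|apply Rmult_le_pos];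
        unfold rho; lra. }
    lra. }
  assert (Hpt : 0 <= p * t) by pos.
  assert (Hpt2 : p * t * ((p + kap) * rho) <= p * t * (1/4 * eps ^ 2 * t)).
  { apply Rmult_le_compat_l; [exact Hpt|]. apply Rle_trans with (1 := Hrd).
    apply Rmult_le_compat_l; [|exact Ht0]. pose proof (pow2_ge_0 eps); lra. }
  assert (Hfin : 1 <= (1 - z) * (1 + p * eta)).
  { assert (0 <= p * eta <= 1) by (split; [pos|]; clear - Hp1 Heta He Hp Hp0 Heta0; nra).
    clear - H Hz. nra. }
  assert (Heq : eta = 1/4 * eps ^ 2 * (a / K) ^ 2) by (unfold eta; field; lra).
  assert (Htw : (a / K) ^ 2 <= t ^ 2) by (apply pow_incr; lra).
  assert (He2 : 0 < eps ^ 2) by pos.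
  (* For [y <= a] the jump may cross the barrier, and its contribution is only taken to be
     non-negative. The drift branch then suffices, because [rho * t] is at least 1 + eps. *)
  destruct (Rlt_dec t 1) as [Ht1|Ht1].
  - assert (Hay : a < y).
    { apply (Rmult_lt_compat_r y) in Ht1; [|lra]. unfold t in Ht1.
      replace (a / y * y) with a in Ht1 by (field; lra). lra. }
    pose proof (nonlinear_small k be eps a c (tau - g) y yj ltac:(lra) ltac:(lra) He Ha Hc ltac:(lra)
      ltac:(unfold yj; lra)) as Hnu.
     change (0 <= nu <= 1/2 * eps ^ 2 * t ^ 2) in Hnu.
    assert (Hyj0 : 0 < yj) by (unfold yj; lra).
    set (P := Rpower (1 - t) rho).
    assert (HP : 1 - rho * t + eps ^ 2 * t ^ 2 <= P) by (apply Rpower_one_minus_ge; lra).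
    assert (HP0 : 0 < P) by apply exp_pos.
    assert (Hj : G * ((1 - z) * P) <= Gsub k be rho (tau - g) yj).
    { pose proof (Gsub_lower k be rho tau g y yj (1 - u) ltac:(lra) ltac:(lra) Hyj0) as H.
      fold x in H. specialize (H ltac:(lra)). rewrite Hux in H.
      assert (Hc1 : x - g - 2 * be * y * g - be * g ^ 2 <= tau - g - be * yj ^ 2).
      { unfold x. assert (yj ^ 2 <= (y + g) ^ 2) by (apply pow_incr; unfold yj in *; lra).
        assert (be * yj ^ 2 <= be * (y + g) ^ 2) by mono. lra. }
      specialize (H Hc1). apply Rle_trans with (2 := H).
      rewrite Rmult_assoc. apply Rmult_le_compat_l; [exact HG|].
      rewrite <- (Rmult_1_l ((1 - z) * P)).
      apply Rmult_le_compat; [lra| |exact Hex|].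
      - pos.
      - rewrite Rmult_comm. apply Rmult_le_compat; [lra|lra| |exact Hpow].
        unfold P. apply Rle_Rpower_l; [unfold rho; lra|]. split; [lra|].
        unfold t, yj. apply Rdiv_ge_of_mul; [lra|].
        replace ((1 - a / y) * y) with (y - a) by (field; lra). lra. }
    assert (HP1 : P <= 1).
    { unfold P. apply Rle_trans with (Rpower 1 rho);
        [|right; unfold Rpower; rewrite ln_1, Rmult_0_r; apply exp_0].
      apply Rle_Rpower_l; [unfold rho; lra|]. lra. }
    assert (Ht2 : t ^ 2 <= 1) by (clear - Ht1 Ht0 HaK; nra).
    assert (Hnu1 : nu <= 1).
    { assert (eps ^ 2 * t ^ 2 <= 1 * 1) by (apply Rmult_le_compat; try apply pow2_ge_0; try lra; clear - He; nra). lra. }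
    assert (Hbr : 1 + p * eta <= p * ((1 - nu) * P) + w).
    { assert (Hs : 1 - rho * t + 1/2 * eps ^ 2 * t ^ 2 <= (1 - nu) * P).
      { assert (nu * P <= nu * 1) by mono. lra. }
      assert (p * (1 - rho * t + 1/2 * eps ^ 2 * t ^ 2) <= p * ((1 - nu) * P))
        by mono.
      assert (p * eta <= p * (1/4 * eps ^ 2 * t ^ 2)).
      { apply Rmult_le_compat_l; [lra|]. rewrite Heq. mono. }
      replace (p * t * (1 / 4 * eps ^ 2 * t)) with (p * (1/4 * eps ^ 2 * t ^ 2)) in Hpt2 by ring.
      lra. }
    apply Rle_trans with (G * ((1 - z) * (p * ((1 - nu) * P) + w))).
    + rewrite <- (Rmult_1_r G) at 1. apply Rmult_le_compat_l; [exact HG|].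
      apply Rle_trans with (1 := Hfin). mono.
    + apply Rle_trans with (p * (1 - nu) * (G * ((1 - z) * P)) + (1 - p) * (G * ((1 - z) * (1 + rho * (g' / y))))).
      * right. unfold w. ring.
      * apply Rplus_le_compat; apply Rmult_le_compat_l; try lra; try assumption.
        pos.
  - assert (Hnu0 : nu <= 1).
    { unfold nu. destruct (Rlt_dec 0 yj) as [Hpos|Hneg].
      - apply Rle_trans with (c * 1); [|assert (eps ^ 2 * a ^ 2 <= 1 * 1) by
          (apply Rmult_le_compat; try apply pow2_ge_0; [clear - He|clear - Ha]; nra); lra].
        rewrite Rmult_assoc. apply Rmult_le_compat_l; [lra|].
        apply Rle_trans with (exp (- yj) * Rpower yj rho).
        + apply Rmult_le_compat_l; [left; apply exp_pos | apply Gsub_le; lra].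
        + apply Rle_trans with (exp (- (yj / 4))); [apply exp_neg_Rpower_le; unfold rho; lra|].
          rewrite <- exp_0. left. apply exp_increasing. lra.
      - unfold Gsub. destruct (Rlt_dec 0 yj); [contradiction|]. lra. }
    assert (Hj0 : 0 <= p * (1 - nu) * Gsub k be rho (tau - g) yj).
    { apply Rmult_le_pos; [pos | apply Gsub_nonneg]. }
    assert (Hbr : 1 + p * eta <= w).
    {
      assert (Hs : p * eta <= p * (eps / 2)) by mono.
      assert (Hpk2 : (p + kap) * rho <= 3/2 * del) by
        (rewrite Rmult_comm; apply Rmult_le_compat; unfold rho; lra).
      assert (Hr : eps / 2 + 1 <= rho * t - t * ((p + kap) * rho)).
      { replace (rho * t - t * ((p + kap) * rho)) with (t * (rho - (p + kap) * rho)) by ring.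
        apply Rle_trans with (1 * (rho - (p + kap) * rho)); [unfold rho in *; lra|].
        apply Rmult_le_compat_r; unfold rho in *; lra. }
      assert (p * (eps / 2 + 1) <= p * (rho * t - t * ((p + kap) * rho)))
        by mono. lra. }
    apply Rle_trans with (G * ((1 - z) * w)).
    + rewrite <- (Rmult_1_r G) at 1. apply Rmult_le_compat_l; [exact HG|].
      apply Rle_trans with (1 := Hfin). mono.
    + assert ((1 - p) * (G * ((1 - z) * (1 + rho * (g' / y)))) <= (1 - p) * Gsub k be rho (tau - g) (y + g'))
        by mono.
      replace (G * ((1 - z) * w)) with ((1 - p) * (G * ((1 - z) * (1 + rho * (g' / y)))))
        by (unfold w; ring). lra.
Qed.

(** With [D = tau - x] this follows from positivity of eps x^2 - 4 x D + la D^2, where 4 bounds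
    [ka - la]. The discriminant condition la eps >= 4 is ensured by the hypothesis on eps (m -
    1). *)
Lemma sub_main_ineq m eps tau x : 0 < eps <= 1/2 -> 8 <= eps * (m - 1) -> 0 < x <= tau ->
  - ((m + 1/2 + (1 + eps) + eps) / tau) <=
  - ((m + 1/2 + (1 + eps)) / x) + (m - 1) * (1 - 1 / m) * (tau - x) / x ^ 2.
Proof.
  intros He Hm Hx. assert (Hm1 : 17 <= m) by (clear - He Hm; nra).
  set (ka := m + 1/2 + (1 + eps)). set (la := (m - 1) * (1 - 1 / m)).
  assert (Hinv : 0 < 1 / m <= 1/17).
  { split; [pos | apply Rdiv_le_of_mul; lra]. }
  assert (Hla : (m - 1) * (16/17) <= la) by mono.
  assert (Hka : ka - la <= 4).
  { unfold ka, la. replace ((m - 1) * (1 - 1 / m)) with (m - 2 + 1 / m) by (field; lra). lra. }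
  apply (Rmult_le_reg_r (x ^ 2 * tau)); [apply Rmult_lt_0_compat; [apply pow_lt|]; lra|].
  replace (- ((ka + eps) / tau) * (x ^ 2 * tau)) with (- ((ka + eps) * x ^ 2)) by (field; lra).
  replace ((- (ka / x) + la * (tau - x) / x ^ 2) * (x ^ 2 * tau))
    with (- (ka * x * tau) + la * (tau - x) * tau) by (field; lra).
  set (D := tau - x). assert (HD : 0 <= D) by (unfold D; lra).
  replace tau with (x + D) by (unfold D; ring).
  assert (H4 : 0 <= (4 - (ka - la)) * (x * D)) by (apply Rmult_le_pos; [lra|pos]).
  assert (H5 : 0 <= (la * eps - 4) * D ^ 2).
  { apply Rmult_le_pos; [|apply pow2_ge_0]. nra. }
  assert (H6 : 0 <= (eps * x - 2 * D) ^ 2) by apply pow2_ge_0.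
  assert (H7 : 0 <= eps * x ^ 2 - 4 * (x * D) + la * D ^ 2).
  { apply (Rmult_le_reg_l eps); [lra|]. rewrite Rmult_0_r. lra. }
  lra.
Qed.

(** The rate for [K <= y], and the origin of s = 3/2 + 3 eps. The generator contributes m + 1/2 +
    rho, where rho = 1 + eps brings the first eps; [sub_main_ineq] costs the second; the third
    absorbs the motion [E] of the barrier and the second-order term of exp (-A), half of it each. *)
Lemma sub_rate m eps a be K C C8 tau g E p y :
  let rho := 1 + eps in let s := 3/2 + 3 * eps in
  let x := tau - be * y ^ 2 in
  0 < eps <= 1/2 -> 8 <= eps * (m - 1) -> 0 < a <= 1 -> 0 < be -> m * be * a = 1/2 ->
  1 <= K -> rho * s / K <= eps / 2 -> 2 * rho <= K -> K <= y -> 0 < x -> 0 < tau ->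
  0 < g <= 1/2 -> E = s * g / tau + C * g ^ 2 -> 0 <= g - E -> 0 <= C ->
  g / a * (1 - g) <= p <= g / a -> 0 <= p <= 1 ->
  (rho * a / K + g) + 2 * (a / (2 * K) + g * (1 / (2 * be * K) + 1) / a) <= 1 / (2 * m) ->
  C8 = m * (1 + 4 * be) / a + m * be + m * rho * (1 + 3 * be) ->
  C8 * g <= (m - 1) * be / (2 * m) -> 4 * (C8 + rho / a) <= C ->
  let A := (m + s) * g / tau + C * g ^ 2 in
  A <= 1/4 -> (m + s) * A <= eps / 2 ->
  let D := (2 * be * y * a - be * a ^ 2 - g * (1 + 2 * be * y)) / x in
  let u := (g + 2 * be * y * g + be * g ^ 2) / x in
  0 <= D /\
  exp (- A) <= p * ((1 - rho * (a / y)) * (1 + m * D + m * (m - 1) / 2 * D ^ 2))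
     + (1 - p) * ((1 + rho * ((g - E) / y)) * (1 - m * u)).
Proof.
  intros rho s x He Hm Ha Hbe Hmba HK HKs HKr Hy Hx Htau Hg HE HgE HC Hp Hp01 Hkap HC8 HC8g HCC A HA HAe D u.
  assert (Hm1 : 17 <= m) by (clear - He Hm; nra).
  assert (Hrho : 1 < rho <= 3/2) by (unfold rho; lra).
  assert (Hs : 3/2 < s <= 3) by (unfold s; lra).
  assert (Hxt : x <= tau) by (unfold x; pose proof (Rmult_le_pos be _ (Rlt_le _ _ Hbe) (pow2_ge_0 y)); lra).
  set (t := a / y).
  assert (HyK : 0 < / y <= / K) by (split; [apply Rinv_0_lt_compat | apply Rinv_le_contravar]; lra).
  assert (Ht : 0 < t <= a / K).
  { unfold t, Rdiv. split; [pos | mono]. }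
  assert (Hm2 : 0 < 1 / (2 * m) <= 1/34).
  { split; [pos | apply Rdiv_le_of_mul; lra]. }
  set (k1 := rho * a / K + g) in *. set (k2 := a / (2 * K) + g * (1 / (2 * be * K) + 1) / a) in *.
  assert (HbK : 0 < 1 / (2 * be * K)) by (apply Rdiv_lt_0_compat; [|apply Rmult_lt_0_compat]; lra).
  assert (Hk2 : 0 <= k2).
  { unfold k2. assert (0 <= a / (2 * K)) by pos.
    assert (0 <= g * (1 / (2 * be * K) + 1) / a) by pos. lra. }
  assert (Hrt : 0 <= rho * t <= rho * a / K).
  { split; [pos|]. replace (rho * a / K) with (rho * (a / K)) by (field; lra).
    mono. }
  assert (Hk1 : 0 <= k1) by (unfold k1; lra).
  assert (Hby : 0 < be * y) by pos.
  set (Mv := 2 * be * y * a - be * a ^ 2) in *.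
  set (ev := g * (1 + 2 * be * y)) in *.
  assert (Hbya : 0 < 2 * be * y * a) by pos.
  assert (HMe : 2 * be * y * a * (1 - k2) <= Mv - ev).
  { unfold Mv, ev.
    assert (H1 : be * a ^ 2 <= 2 * be * y * a * (a / (2 * K))).
    { replace (2 * be * y * a * (a / (2 * K))) with (be * a ^ 2 * (y / K)) by (field; lra).
      rewrite <- (Rmult_1_r (be * a ^ 2)) at 1. apply Rmult_le_compat_l.
      - apply Rmult_le_pos; [lra|apply pow2_ge_0].
      - pos. }
    assert (H2 : g * (1 + 2 * be * y) <= 2 * be * y * a * (g * (1 / (2 * be * K) + 1) / a)).
    { replace (2 * be * y * a * (g * (1 / (2 * be * K) + 1) / a)) with (g * (y / K + 2 * be * y))
        by (field; lra).
      apply Rmult_le_compat_l; [lra|]. assert (1 <= y / K) by pos. lra. }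
    unfold k2. lra. }
  assert (Hev : 0 < ev) by pos.
  assert (Hba : 0 <= be * a ^ 2) by (apply Rmult_le_pos; [lra|apply pow2_ge_0]).
  assert (HMe0 : 0 <= Mv - ev).
  { apply Rle_trans with (2 := HMe). pos. }
  assert (HD : 0 <= D) by pos.
  split; [exact HD|].
  set (Z := y / x).
  assert (HZx : / x <= Z).
  { unfold Z, Rdiv. rewrite <- (Rmult_1_l (/ x)) at 1. apply Rmult_le_compat_r; [left; apply Rinv_0_lt_compat|]; lra. }
  assert (Hix : 0 < / x) by (apply Rinv_0_lt_compat; lra).
  set (mu := g / a * ((1 - g) * (1 - rho * t))).
  assert (Hmu : mu <= p * (1 - rho * t)).
  { unfold mu. rewrite <- Rmult_assoc. apply Rmult_le_compat_r; [unfold k1 in *; lra|lra]. }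
  assert (Hlin : g * m * (2 * be * y - be * a * (1 + 2 * rho)) / x - g ^ 2 * (m * (1 + 4 * be) / a) * Z
      <= mu * (m * D)).
  { assert (H1 : Mv - 2 * rho * be * a ^ 2 - g * (1 + 4 * be) * y <= (1 - g) * (1 - rho * t) * (Mv - ev)).
    { assert (Hr1 : rho * t * Mv <= 2 * rho * be * a ^ 2).
      { apply Rle_trans with (rho * t * (2 * be * y * a)).
        - apply Rmult_le_compat_l; [lra|]. unfold Mv. lra.
        - right. unfold t. field. lra. }
      assert (Hr2 : g * Mv + ev <= g * (1 + 4 * be) * y).
      { unfold ev, Mv. assert (2 * be * y * a <= 2 * be * y * 1) by mono.
        assert (g * (2 * be * y * a - be * a ^ 2 + (1 + 2 * be * y)) <= g * (2 * be * y + (y + 2 * be * y)))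
          by mono. lra. }
      assert (Hr3 : 0 <= g * (rho * t) * (Mv - ev)) by (repeat apply Rmult_le_pos; lra).
      assert (Hr4 : 0 <= rho * t * ev) by pos.
      assert (Hr5 : 0 <= g * ev) by pos. lra. }
    apply Rle_trans with (g / a * m * ((Mv - 2 * rho * be * a ^ 2 - g * (1 + 4 * be) * y) / x)).
    - right. unfold Mv, Z. field. lra.
    - unfold mu, D.
      replace (g / a * ((1 - g) * (1 - rho * t)) * (m * ((Mv - ev) / x))) with
        (g / a * m * ((1 - g) * (1 - rho * t) * (Mv - ev) / x)) by (unfold Rdiv; ring).
      apply Rmult_le_compat_l; [pos|].
      unfold Rdiv. mono. }
  assert (Hquad : (m - 1) * be * (1 - 1 / (2 * m)) * g * Z ^ 2 <= mu * (m * (m - 1) / 2 * D ^ 2)).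
  { assert (H1 : (1 - 1 / (2 * m)) <= (1 - g) * (1 - rho * t) * (1 - k2) ^ 2).
    { assert (1 - k1 <= (1 - g) * (1 - rho * t)).
      { assert (0 <= g * (rho * t)) by pos. unfold k1. lra. }
      assert (1 - 2 * k2 <= (1 - k2) ^ 2) by (pose proof (pow2_ge_0 k2); lra).
      apply Rle_trans with ((1 - k1) * (1 - 2 * k2)).
      - assert (0 <= k1 * (2 * k2)) by pos. lra.
      - apply Rmult_le_compat; lra. }
    assert (HDl : 2 * be * a * (1 - k2) * Z <= D).
    { unfold D. apply Rdiv_ge_of_mul; [lra|]. apply Rle_trans with (2 := HMe). right. unfold Z. field. lra. }
    assert (HD2 : (2 * be * a * (1 - k2) * Z) ^ 2 <= D ^ 2).
    { apply pow_incr. split; [|exact HDl].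
      apply Rmult_le_pos; [apply Rmult_le_pos; [|lra]|lra]. pos. }
    assert (Hmm : 0 <= m * (m - 1) / 2) by pos.
    assert (Hmu0 : 0 <= mu).
    { unfold mu. apply Rmult_le_pos; [lra|]. apply Rmult_le_pos; [lra|]. unfold k1 in *; lra. }
    apply Rle_trans with (mu * (m * (m - 1) / 2 * (2 * be * a * (1 - k2) * Z) ^ 2)).
    - unfold mu.
      replace (g / a * ((1 - g) * (1 - rho * t)) * (m * (m - 1) / 2 * (2 * be * a * (1 - k2) * Z) ^ 2))
        with ((m - 1) * be * (2 * (m * be * a)) * g * Z ^ 2 * ((1 - g) * (1 - rho * t) * (1 - k2) ^ 2))
        by (field; lra).
      rewrite Hmba.
      replace ((m - 1) * be * (1 - 1 / (2 * m)) * g * Z ^ 2) with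
        ((m - 1) * be * (2 * (1/2)) * g * Z ^ 2 * (1 - 1 / (2 * m))) by (field; lra).
      apply Rmult_le_compat_l; [|exact H1].
      apply Rmult_le_pos; [|apply pow2_ge_0].
      apply Rmult_le_pos; [apply Rmult_le_pos; [apply Rmult_le_pos|]|]; lra.
    - apply Rmult_le_compat_l; [exact Hmu0|]. apply Rmult_le_compat_l; [exact Hmm|exact HD2]. }
  assert (Hjump : p * (1 - rho * t) + mu * (m * D) + mu * (m * (m - 1) / 2 * D ^ 2) <=
     p * ((1 - rho * t) * (1 + m * D + m * (m - 1) / 2 * D ^ 2))).
  { rewrite <- Rmult_assoc.
    assert (0 <= (p * (1 - rho * t) - mu) * (m * D + m * (m - 1) / 2 * D ^ 2)).
    { apply Rmult_le_pos; [lra|]. assert (0 <= m * D) by pos.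
      assert (0 <= m * (m - 1) / 2) by pos.
      assert (0 <= m * (m - 1) / 2 * D ^ 2) by (apply Rmult_le_pos; [lra|apply pow2_ge_0]). lra. }
    lra. }
  assert (Hu0 : 0 <= u).
  { unfold u. apply Rdiv_ge_of_mul; [lra|]. assert (0 <= be * y * g) by pos.
    assert (0 <= be * g ^ 2) by (apply Rmult_le_pos; [lra|apply pow2_ge_0]). lra. }
  set (h := rho * ((g - E) / y)).
  assert (Hgy : 0 <= g / y <= g).
  { split; [pos | apply Rdiv_le_of_mul; [lra|]].
    rewrite <- (Rmult_1_r g) at 1. mono. }
  assert (HE0 : 0 <= E).
  { rewrite HE. assert (0 <= s * g / tau) by pos.
    assert (0 <= C * g ^ 2) by (apply Rmult_le_pos; [lra|apply pow2_ge_0]). lra. }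
  assert (HEy : 0 <= E / y <= E / K).
  { unfold Rdiv. split; [pos | mono]. }
  assert (Hh : 0 <= h <= rho * (g / y)).
  { unfold h. split; [apply Rmult_le_pos; [lra|pos]|].
    apply Rmult_le_compat_l; [lra|]. unfold Rdiv. mono. }
  assert (Hdrift : 1 - p + rho * t * (g / a) - rho * (E / K) - rho / a * g ^ 2 - m * u - rho * (g / y) * (m * u)
     <= (1 - p) * ((1 + h) * (1 - m * u))).
  { assert (Hmu' : 0 <= m * u) by pos.
    assert (Eh : h = rho * t * (g / a) - rho * (E / y)) by (unfold h, t; field; lra).
    assert (H1 : rho * (E / y) <= rho * (E / K)) by mono.
    assert (H2 : p * h <= rho / a * g ^ 2).
    { apply Rle_trans with (g / a * (rho * g)).
      - apply Rmult_le_compat; try lra. apply Rle_trans with (1 := proj2 Hh). mono.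
      - right. field. lra. }
    assert (H3 : h * (m * u) <= rho * (g / y) * (m * u)) by mono.
    assert (H4 : 0 <= p * (1 + h) * (m * u)) by (apply Rmult_le_pos; [pos|exact Hmu']).
    lra. }
  assert (Hu : m * u + rho * (g / y) * (m * u) <= m * g / x + 2 * m * be * y * g / x
      + (m * be + m * rho * (1 + 3 * be)) * g ^ 2 * Z).
  { assert (H1 : m * u <= m * g / x + 2 * m * be * y * g / x + m * be * g ^ 2 * Z).
    { replace (m * u) with (m * g / x + 2 * m * be * y * g / x + m * be * g ^ 2 * / x)
        by (unfold u; field; lra).
      assert (0 <= m * be * g ^ 2) by (apply Rmult_le_pos; [pos|apply pow2_ge_0]).
      assert (m * be * g ^ 2 * / x <= m * be * g ^ 2 * Z) by mono. lra. }
    assert (H2 : rho * (g / y) * (m * u) <= m * rho * (1 + 3 * be) * g ^ 2 * Z).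
    { replace (rho * (g / y) * (m * u)) with (m * rho * g ^ 2 * ((1 + 2 * be * y + be * g) / y * / x))
        by (unfold u; field; lra).
      replace (m * rho * (1 + 3 * be) * g ^ 2 * Z) with (m * rho * g ^ 2 * ((1 + 3 * be) * Z)) by ring.
      apply Rmult_le_compat_l; [apply Rmult_le_pos; [pos|apply pow2_ge_0]|].
      apply Rmult_le_compat; try lra.
      - apply Rdiv_ge_of_mul; [lra|]. assert (0 <= be * g) by pos. lra.
      - apply Rdiv_le_of_mul; [lra|]. assert (be * g <= be * y) by mono. lra. }
    lra. }
  pose proof (sub_main_ineq m eps tau x He Hm ltac:(lra)) as Hmain. fold rho in Hmain.
  assert (HZ2 : be * Z ^ 2 = (tau - x) / x ^ 2) by (unfold Z, x; field; unfold x in Hx; lra).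
  assert (HZsq : Z <= 1 + Z ^ 2) by (pose proof (pow2_ge_0 (Z - 1/2)); lra).
  assert (Hg2 : 0 < g ^ 2) by pos.
  assert (HC80 : 0 <= C8).
  { rewrite HC8. assert (0 <= m * (1 + 4 * be) / a) by pos.
    assert (0 <= m * be) by pos.
    assert (0 <= m * rho * (1 + 3 * be)) by (apply Rmult_le_pos; [apply Rmult_le_pos|]; lra). lra. }
  assert (HZ2p : 0 <= g * Z ^ 2) by (apply Rmult_le_pos; [lra|apply pow2_ge_0]).
  (* Errors of order g^2 y/x are split by Z <= 1 + Z^2. The first part goes into C g^2, the second
     into the reserve 1/(2m) between the factor 1 - 1/(2m) obtained in [Hquad] and the 1 - 1/m that
     [sub_main_ineq] requires. *)
  assert (Herr : C8 * g ^ 2 * Z <= C8 * g ^ 2 + (m - 1) * be / (2 * m) * (g * Z ^ 2)).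
  { apply Rle_trans with (C8 * g ^ 2 * (1 + Z ^ 2)).
    - apply Rmult_le_compat_l; [pos|exact HZsq].
    - assert (C8 * g * (g * Z ^ 2) <= (m - 1) * be / (2 * m) * (g * Z ^ 2))
        by mono. lra. }
  assert (HEK : rho * (E / K) <= eps / 2 * (g / tau) + C / 2 * g ^ 2).
  { rewrite HE. replace (rho * ((s * g / tau + C * g ^ 2) / K)) with
      (rho * s / K * (g / tau) + rho / K * (C * g ^ 2)) by (field; lra).
    assert (Hgt : 0 <= g / tau) by pos.
    assert (rho * s / K * (g / tau) <= eps / 2 * (g / tau)) by mono.
    assert (rho / K * (C * g ^ 2) <= 1/2 * (C * g ^ 2)).
    { apply Rmult_le_compat_r; [pos|]. apply Rdiv_le_of_mul; lra. }
    lra. }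
  assert (HA0 : 0 <= A).
  { unfold A. assert (0 <= (m + s) * g / tau) by pos.
    assert (0 <= C * g ^ 2) by pos. lra. }
  assert (HA2 : A ^ 2 <= eps / 2 * (g / tau) + 1/4 * (C * g ^ 2)).
  { replace (A ^ 2) with ((m + s) * A * (g / tau) + A * (C * g ^ 2)) by (unfold A; field; lra).
    apply Rplus_le_compat; apply Rmult_le_compat_r; try lra.
    - pos.
    - pos. }
  apply Rle_trans with (1 := exp_neg_quadratic A HA0).
  assert (Hlinsum : g * m * (2 * be * y - be * a * (1 + 2 * rho)) / x - (m * g / x + 2 * m * be * y * g / x)
     = g * - ((m + 1/2 + rho) / x)).
  { replace (g * m * (2 * be * y - be * a * (1 + 2 * rho)) / x) with
      (2 * m * be * y * g / x - g * (m * be * a * (1 + 2 * rho)) / x) by (field; lra).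
    rewrite Hmba. field. lra. }
  assert (Hmain2 : g * - ((m + 1/2 + rho + eps) / tau) <=
     g * - ((m + 1/2 + rho) / x) + (m - 1) * be * (1 - 1 / (2 * m)) * g * Z ^ 2
       - (m - 1) * be / (2 * m) * (g * Z ^ 2)).
  { replace (g * - ((m + 1/2 + rho) / x) + (m - 1) * be * (1 - 1 / (2 * m)) * g * Z ^ 2
       - (m - 1) * be / (2 * m) * (g * Z ^ 2)) with
      (g * (- ((m + 1/2 + rho) / x) + (m - 1) * (1 - 1 / m) * (be * Z ^ 2))) by (field; lra).
    rewrite HZ2. apply Rmult_le_compat_l; [lra|]. apply Rle_trans with (1 := Hmain). right. field. lra. }
  assert (Hmain3 : g * - ((m + 1/2 + rho + eps) / tau) = - ((m + s) * g / tau) + eps * (g / tau)).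
  { unfold rho, s. field. lra. }
  assert (HCg : (C8 + rho / a) * g ^ 2 <= 1/4 * (C * g ^ 2)).
  { assert ((C8 + rho / a) * g ^ 2 <= C / 4 * g ^ 2) by mono. lra. }
  assert (HptA : p * (rho * t) <= rho * t * (g / a)).
  { rewrite Rmult_comm. mono. }
  assert (HC8Z : C8 * g ^ 2 * Z = g ^ 2 * (m * (1 + 4 * be) / a) * Z
     + (m * be + m * rho * (1 + 3 * be)) * g ^ 2 * Z) by (rewrite HC8; ring).
  unfold A in HA2 |- *. lra.
Qed.

Lemma exists_small (l : list R) : (forall x, In x l -> 0 < x) ->
  exists g, 0 < g /\ forall x, In x l -> g <= x.
Proof.
  induction l as [|x l IH]; intros H; [exists 1; split; [lra|intros ? []]|].
  destruct IH as (g & Hg & Hl); [intros; apply H; right; assumption|].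
  exists (Rmin x g). split; [apply Rmin_glb_lt; [apply H; left; reflexivity|assumption]|].
  intros z [<-|Hz]; [apply Rmin_l|]. apply Rle_trans with (1 := Rmin_r _ _). auto.
Qed.

Lemma exists_large (l : list R) : exists T, forall x, In x l -> x <= T.
Proof.
  induction l as [|x l (T & HT)]; [exists 0; intros ? []|].
  exists (Rmax x T). intros z [<-|Hz]; [apply Rmax_l|]. apply Rle_trans with (2 := Rmax_r _ _). auto.
Qed.

(** In the bulk of the support, [Gsub_lower] is applied with the ratios [1 + D] after a jump and
    [1 - u] otherwise, which reduces the claim to [sub_rate]. The factor exp (m g/tau) of that lemma
    and the factor exp E of the moving barrier combine into exp A. *)
Lemma sub_step_high k eps a K C C8 c tau g E p y :
  let rho := 1 + eps in let s := 3/2 + 3 * eps in let m := INR k in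
  let be := 1 / (2 * m * a) in
  0 < eps <= 1/2 -> 8 <= eps * (m - 1) -> 0 < a <= 1 ->
  1 <= K -> rho * s / K <= eps / 2 -> 2 * rho <= K -> K <= y -> 0 < tau - be * y ^ 2 -> 1 <= tau ->
  0 < g <= 1/2 -> E = s * g / tau + C * g ^ 2 -> 0 <= g - E -> 0 <= C ->
  g / a * (1 - g) <= p <= g / a -> 0 <= p <= 1 ->
  (rho * a / K + g) + 2 * (a / (2 * K) + g * (1 / (2 * be * K) + 1) / a) <= 1 / (2 * m) ->
  C8 = m * (1 + 4 * be) / a + m * be + m * rho * (1 + 3 * be) ->
  C8 * g <= (m - 1) * be / (2 * m) -> 4 * (C8 + rho / a) <= C ->
  (m + s) * g / tau + C * g ^ 2 <= 1/4 ->
  (m + s) * ((m + s) * g / tau + C * g ^ 2) <= eps / 2 ->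
  0 <= c <= eps ^ 2 * a ^ 2 / 256 ->
  let yj := y + (g - E) - a in
  let nu := c * exp (- yj) * Gsub k be rho (tau - g) yj in
  Gsub k be rho tau y <=
    exp E * (p * (1 - nu) * Gsub k be rho (tau - g) yj
             + (1 - p) * Gsub k be rho (tau - g) (y + (g - E))).
Proof.
  intros rho s m be He Hm Ha HK HKs HKr Hy Hx Htau Hg HE HgE HC Hp Hp01 Hkap HC8 HC8g HCC HA HAe Hc yj nu.
  assert (Hm1 : 17 <= m) by (clear - He Hm; nra).
  assert (Hbe : 0 < be) by (unfold be; apply Rdiv_lt_0_compat; [lra|pos]).
  assert (Hmba : m * be * a = 1/2) by (unfold be; field; lra).
  assert (Hk : (1 <= k)%nat).
  { destruct k; [unfold m in Hm1; simpl in Hm1; lra|lia]. }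
  destruct (sub_rate m eps a be K C C8 tau g E p y He Hm Ha Hbe Hmba HK HKs HKr Hy Hx ltac:(lra) Hg HE HgE HC
    Hp Hp01 Hkap HC8 HC8g HCC HA HAe) as [HD Hrate].
   set (A := (m + s) * g / tau + C * g ^ 2) in *.
  set (x := tau - be * y ^ 2) in *.
  set (D := (2 * be * y * a - be * a ^ 2 - g * (1 + 2 * be * y)) / x) in *.
  set (u := (g + 2 * be * y * g + be * g ^ 2) / x) in *.
  set (G := Gsub k be rho tau y). assert (HG : 0 <= G) by apply Gsub_nonneg.
  assert (HE0 : 0 <= E).
  { rewrite HE. assert (0 <= s * g / tau) by (apply Rdiv_ge_of_mul; [lra|]; rewrite Rmult_0_l; apply Rmult_le_pos; unfold s; lra).
    assert (0 <= C * g ^ 2) by (apply Rmult_le_pos; [lra|apply pow2_ge_0]). lra. }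
  assert (Hrho : 1 < rho <= 3/2) by (unfold rho; lra).
  assert (Hu0 : 0 <= u).
  { unfold u. apply Rdiv_ge_of_mul; [lra|]. assert (0 <= be * y * g) by (apply Rmult_le_pos; [apply Rmult_le_pos|]; lra).
    assert (0 <= be * g ^ 2) by (apply Rmult_le_pos; [lra|apply pow2_ge_0]). lra. }
  set (ex := exp (m * g / tau)).
  assert (Hex : 0 < ex) by apply exp_pos.
  set (h := rho * ((g - E) / y)) in *.
  assert (Hgy0 : 0 <= (g - E) / y) by pos.
  assert (H1 : G * ex * ((1 + h) * (1 - m * u)) <= Gsub k be rho (tau - g) (y + (g - E))).
  { pose proof (Gsub_lower k be rho tau g y (y + (g - E)) (1 - u) ltac:(lra) ltac:(lra) ltac:(lra)) as H.
    fold x in H. specialize (H ltac:(lra)).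
    assert (Hc1 : (1 - u) * x <= tau - g - be * (y + (g - E)) ^ 2).
    { replace ((1 - u) * x) with (x - g - 2 * be * y * g - be * g ^ 2) by (unfold u; field; lra).
      unfold x. assert ((y + (g - E)) ^ 2 <= (y + g) ^ 2) by (apply pow_incr; lra).
      assert (be * (y + (g - E)) ^ 2 <= be * (y + g) ^ 2) by mono. lra. }
    specialize (H Hc1). apply Rle_trans with (2 := H). fold G m ex.
    apply Rmult_le_compat_l; [pos|].
    replace ((y + (g - E)) / y) with (1 + (g - E) / y) by (field; lra).
    pose proof (Rpower_one_plus_ge ((g - E) / y) eps Hgy0 ltac:(lra)) as HB.
    pose proof (pow_bernoulli_neg k u Hu0 Hk) as HB2. fold m in HB2.
    assert (Hh : 0 <= h) by pos.
    apply Rle_trans with ((1 + h) * Rmax 0 (1 - u) ^ k).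
    - mono.
    - apply Rmult_le_compat_r; [apply pow_le, Rmax_l | exact HB]. }
  assert (Hyj : y - a <= yj) by (unfold yj; lra).
  pose proof (nonlinear_small k be eps a c (tau - g) y yj ltac:(lra) ltac:(lra) He Ha Hc ltac:(lra) Hyj) as Hnu.
   change (0 <= nu <= 1/2 * eps ^ 2 * (a / y) ^ 2) in Hnu.
  set (t := a / y) in *.
  assert (Ht : 0 <= t < 1).
  { unfold t. split; [pos|].
    apply (Rmult_lt_reg_r y); [lra|]. unfold Rdiv. rewrite Rmult_assoc, Rinv_l by lra. lra. }
  set (Q := 1 + m * D + m * (m - 1) / 2 * D ^ 2) in *.
  assert (HQ0 : 0 <= Q).
  { unfold Q. assert (0 <= m * D) by pos.
    assert (0 <= m * (m - 1) / 2) by pos.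
    assert (0 <= m * (m - 1) / 2 * D ^ 2) by (apply Rmult_le_pos; [lra|apply pow2_ge_0]). lra. }
  assert (H2 : G * ex * ((1 - rho * t) * Q) <= (1 - nu) * Gsub k be rho (tau - g) yj).
  { pose proof (Gsub_lower k be rho tau g y yj (1 + D) ltac:(lra) ltac:(lra) ltac:(lra)) as H.
    fold x in H. specialize (H ltac:(lra)).
    assert (Hc1 : (1 + D) * x <= tau - g - be * yj ^ 2).
    { replace ((1 + D) * x) with (x + (2 * be * y * a - be * a ^ 2 - g * (1 + 2 * be * y)))
        by (unfold D; field; lra).
      unfold x. assert (yj ^ 2 <= (y - a + g) ^ 2) by (apply pow_incr; unfold yj; lra).
      assert (be * yj ^ 2 <= be * (y - a + g) ^ 2) by mono.
      assert (0 <= be * (g * (2 * a - g))).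
      { apply Rmult_le_pos; [lra|]. apply Rmult_le_pos; [lra|].
        assert (Hga : g * (1 - g) <= a).
        { replace (g * (1 - g)) with (g / a * (1 - g) * a) by (field; lra).
          apply Rle_trans with (1 * a); [apply Rmult_le_compat_r|]; lra. }
        clear - Hga Hg. nra. }
      lra. }
    specialize (H Hc1). fold G m ex in H.
    set (P := Rpower (yj / y) rho) in *.
    assert (HP : 1 - rho * t + eps ^ 2 * t ^ 2 <= P).
    { apply Rle_trans with (Rpower (1 - t) rho); [apply Rpower_one_minus_ge; lra|].
      unfold P. apply Rle_Rpower_l; [lra|]. split; [lra|].
      apply Rdiv_ge_of_mul; [lra|]. unfold t. replace ((1 - a / y) * y) with (y - a) by (field; lra). lra. }
    assert (HP0 : 0 < P) by apply exp_pos.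
    assert (Het : eps ^ 2 * t ^ 2 <= 1).
    { assert (eps ^ 2 * t ^ 2 <= 1 * 1) by
        (apply Rmult_le_compat; try apply pow2_ge_0; [clear - He|clear - Ht]; nra). lra. }
    assert (HtQ : 1 - rho * t <= (1 - nu) * (1 - rho * t + eps ^ 2 * t ^ 2)).
    { assert (nu * (1 - rho * t + eps ^ 2 * t ^ 2) <= nu * (1 + 1)).
      { apply Rmult_le_compat_l; [lra|]. assert (0 <= rho * t) by pos. lra. }
      lra. }
    rewrite (Rmax_right 0 (1 + D)) in H by lra.
    pose proof (pow_one_plus_ge k D HD) as HB.
    apply Rle_trans with ((1 - nu) * (G * ex * (P * (1 + D) ^ k))); [|mono].
    replace ((1 - nu) * (G * ex * (P * (1 + D) ^ k))) with (G * ex * ((1 - nu) * P * (1 + D) ^ k)) by ring.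
    apply Rmult_le_compat_l; [pos|].
    apply Rle_trans with ((1 - nu) * P * Q).
    - apply Rmult_le_compat_r; [lra|]. apply Rle_trans with (1 := HtQ). mono.
    - apply Rmult_le_compat_l; [pos|exact HB]. }
  apply Rle_trans with (exp E * (p * (G * ex * ((1 - rho * t) * Q)) + (1 - p) * (G * ex * ((1 + h) * (1 - m * u))))).
  2: { apply Rmult_le_compat_l; [left; apply exp_pos|].
       rewrite (Rmult_assoc p (1 - nu)). apply Rplus_le_compat; mono. }
  replace (exp E * (p * (G * ex * ((1 - rho * t) * Q)) + (1 - p) * (G * ex * ((1 + h) * (1 - m * u)))))
    with (G * (exp E * ex * (p * ((1 - rho * t) * Q) + (1 - p) * ((1 + h) * (1 - m * u))))) by ring.
  rewrite <- (Rmult_1_r G) at 1. apply Rmult_le_compat_l; [exact HG|].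
  assert (EA : exp E * ex = exp A).
  { unfold ex. rewrite <- exp_plus. f_equal. rewrite HE. unfold A. field. lra. }
  rewrite EA. apply Rle_trans with (exp A * exp (- A)).
  - rewrite <- exp_plus, Rplus_opp_r, exp_0. lra.
  - apply Rmult_le_compat_l; [left; apply exp_pos|exact Hrate].
Qed.

(** The barrier rises by [E] during the step, so the weight exp (-y) measured from it gains the
    factor exp E. Close to the barrier [sub_step_low] applies, further out [sub_step_high]; off the
    support of the profile the left side is 0. *)
Theorem sub_step a eps : 0 < a <= 1 -> 0 < eps <= 1/2 ->
  exists (k : nat) (be c C tau0 g0 : R),
  (1 <= k)%nat /\ 0 < be /\ 0 < c <= 1/2 /\ 0 <= C /\ 1 <= tau0 /\ 0 < g0 <= 1/2 /\
  forall tau g p y,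
  let rho := 1 + eps in let s := 3/2 + 3 * eps in
  let E := s * g / tau + C * g ^ 2 in
  let yj := y + (g - E) - a in
  let nu := c * exp (- yj) * Gsub k be rho (tau - g) yj in
  0 < g <= g0 -> tau0 <= tau - g -> g / a - g ^ 2 / a <= p <= g / a ->
  0 <= E <= g /\
  Gsub k be rho tau y <=
    exp E * (p * (1 - nu) * Gsub k be rho (tau - g) yj
             + (1 - p) * Gsub k be rho (tau - g) (y + (g - E))).
Proof.
  intros Ha He. set (rho := 1 + eps). set (s := 3/2 + 3 * eps).
  destruct (INR_unbounded (1 + 8 / eps)) as [k Hk].
  set (m := INR k) in *.
  assert (Hm : 8 <= eps * (m - 1)).
  { replace 8 with (eps * (8 / eps)) at 1 by (field; lra). mono. }
  assert (Hm1 : 17 <= m) by (clear - He Hm; nra).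
  assert (Hk1 : (1 <= k)%nat) by (destruct k; [unfold m in Hm1; simpl in Hm1; lra|lia]).
  set (be := 1 / (2 * m * a)).
  assert (Hma : 0 < 2 * m * a) by pos.
  assert (Hbe : 0 < be) by pos.
  destruct (exists_large [1; 2 * rho * s / eps; 2 * rho; 4 * m * (rho + 1) * a]) as (K & HKl).
  assert (HK1 : 1 <= K) by (apply HKl; simpl; auto).
  assert (HK2 : 2 * rho * s / eps <= K) by (apply HKl; simpl; auto).
  assert (HK3 : 2 * rho <= K) by (apply HKl; simpl; auto).
  assert (HK4 : 4 * m * (rho + 1) * a <= K) by (apply HKl; simpl; auto).
  set (C8 := m * (1 + 4 * be) / a + m * be + m * rho * (1 + 3 * be)).
  set (C := 4 * (C8 + rho / a)).
  assert (Hrho : 1 < rho <= 3/2) by (unfold rho; lra).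
  assert (Hs : 3/2 < s <= 3) by (unfold s; lra).
  assert (HC8 : 0 < C8).
  { unfold C8. assert (0 < m * (1 + 4 * be) / a) by (apply Rdiv_lt_0_compat; [apply Rmult_lt_0_compat|]; lra).
    assert (0 < m * be) by pos.
    assert (0 < m * rho * (1 + 3 * be)) by (repeat apply Rmult_lt_0_compat; lra). lra. }
  assert (HC : 0 < C).
  { unfold C. assert (0 < rho / a) by pos. lra. }
  assert (Ebe : be = 1 / (2 * m * a)) by reflexivity.
  assert (HK2' : 0 < K ^ 2) by pos.
  assert (He2 : 0 < eps ^ 2) by pos. assert (Ha2 : 0 < a ^ 2) by pos.
  set (c := eps ^ 2 * a ^ 2 / 256).
  assert (Hc : 0 < c <= 1/2).
  { unfold c. assert (0 < eps ^ 2 * a ^ 2) by pos.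
    assert (eps ^ 2 * a ^ 2 <= 1 * 1) by (apply Rmult_le_compat; try lra; [clear - He|clear - Ha]; nra). lra. }
  set (del := eps ^ 2 * a / (8 * K)). set (eta := eps ^ 2 * a ^ 2 / (4 * K ^ 2)).
  assert (Hdel : 0 < del) by (unfold del; apply Rdiv_lt_0_compat; [apply Rmult_lt_0_compat|]; lra).
  assert (Heta : 0 < eta) by (unfold eta; apply Rdiv_lt_0_compat; [apply Rmult_lt_0_compat|]; lra).
  set (N := m * (2 * (1 + 2 * be * K + be))).
  set (B := Rmin (1/4) (eps / (2 * (m + s)))).
  assert (HB : 0 < B) by (unfold B; apply Rmin_glb_lt; [lra|pos]).
  assert (HB1 : B <= 1/4) by apply Rmin_l.
  assert (HB2 : (m + s) * B <= eps / 2).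
  { assert (B <= eps / (2 * (m + s))) by apply Rmin_r.
    replace (eps / 2) with ((m + s) * (eps / (2 * (m + s)))) by (field; lra).
    mono. }
  set (W := 1 + 2 * ((1 / (2 * be * K) + 1) / a)).
  assert (HW : 1 <= W).
  { unfold W. assert (0 < 1 / (2 * be * K)) by (apply Rdiv_lt_0_compat; [|apply Rmult_lt_0_compat]; lra).
    assert (0 < (1 / (2 * be * K) + 1) / a) by pos. lra. }
  destruct (exists_small [1/2; 1 / (4 * m * W); (m - 1) * be / (2 * m) / C8; del / 4 / C; a * del / 4; B / 2 / C])
    as (g0 & Hg0 & Hgl).
  { intros x Hx. simpl in Hx. destruct Hx as [<-|[<-|[<-|[<-|[<-|[<-|[]]]]]]].
    - lra.
    - apply Rdiv_lt_0_compat; [|apply Rmult_lt_0_compat]; lra.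
    - apply Rdiv_lt_0_compat; [apply Rdiv_lt_0_compat; [apply Rmult_lt_0_compat|]|]; lra.
    - pos.
    - assert (0 < a * del) by pos. lra.
    - pos. }
  assert (G1 : g0 <= 1/2) by (apply Hgl; simpl; auto).
  assert (G2 : g0 <= 1 / (4 * m * W)) by (apply Hgl; simpl; auto).
  assert (G3 : g0 <= (m - 1) * be / (2 * m) / C8) by (apply Hgl; simpl; auto).
  assert (G4 : g0 <= del / 4 / C) by (apply Hgl; simpl; auto).
  assert (G5 : g0 <= a * del / 4) by (apply Hgl; simpl; auto 10).
  assert (G6 : g0 <= B / 2 / C) by (apply Hgl; simpl; auto 10).
  destruct (exists_large [1; 2 * be * K ^ 2; 4 * a * N / eta; 2 * s / del; 2 * (m + s) / B]) as (T & HTl).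
  assert (T1 : 1 <= T) by (apply HTl; simpl; auto).
  assert (T2 : 2 * be * K ^ 2 <= T) by (apply HTl; simpl; auto).
  assert (T3 : 4 * a * N / eta <= T) by (apply HTl; simpl; auto).
  assert (T4 : 2 * s / del <= T) by (apply HTl; simpl; auto).
  assert (T5 : 2 * (m + s) / B <= T) by (apply HTl; simpl; auto 10).
  exists k, be, c, C, T, g0. repeat (split; [assumption || lra|]).
  assert (Hmul : forall x z, 0 < z -> g0 <= x / z -> g0 * z <= x).
  { intros x z Hz H. apply (Rmult_le_compat_r z) in H; [|lra].
    replace (x / z * z) with x in H by (field; lra). exact H. }
  assert (HTmul : forall x z, 0 < z -> x / z <= T -> x <= T * z).
  { intros x z Hz H. apply (Rmult_le_compat_r z) in H; [|lra].
    replace (x / z * z) with x in H by (field; lra). exact H. }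
  apply Hmul in G2; [|pos]. apply Hmul in G3; [|lra].
  apply Hmul in G4; [|lra]. apply Hmul in G6; [|lra].
  apply HTmul in T3; [|lra]. apply HTmul in T4; [|lra]. apply HTmul in T5; [|lra].
  intros tau g p y. cbv zeta.
  set (E := s * g / tau + C * g ^ 2). intros Hg Htau Hp.
  assert (Hgt : 0 < g / tau) by pos.
  assert (Hgg : C * g ^ 2 <= C * g0 * g).
  { replace (C * g ^ 2) with (C * g * g) by ring. apply Rmult_le_compat_r; [lra|]. mono. }
  assert (Hg2 : 0 <= C * g ^ 2) by (apply Rmult_le_pos; [lra|apply pow2_ge_0]).
  (* The ratio E/g is at most [kap], which is small because tau is large and [g0] is small. *)
  set (kap := s / tau + C * g0).
  assert (Hst : s / tau <= del / 2).
  { apply Rdiv_le_of_mul; [lra|]. assert (T * del <= tau * del) by mono. lra. }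
  assert (Hst0 : 0 < s / tau) by pos.
  assert (HCg0 : 0 < C * g0) by pos.
  assert (Hkap : 0 <= kap <= 3/4 * del) by (unfold kap; lra).
  assert (HEk : E <= kap * g).
  { unfold E, kap. replace ((s / tau + C * g0) * g) with (s * g / tau + C * g0 * g) by (field; lra). lra. }
  assert (HE0 : 0 <= E).
  { unfold E. replace (s * g / tau) with (s * (g / tau)) by (field; lra).
    assert (0 <= s * (g / tau)) by pos. lra. }
  assert (Hdel1 : del <= 1/16).
  { unfold del. apply Rdiv_le_of_mul; [lra|].
    assert (eps ^ 2 * a <= 1/4 * 1) by (apply Rmult_le_compat; try lra; clear - He; nra). lra. }
  assert (HEg : E <= g).
  { apply Rle_trans with (1 := HEk). rewrite <- (Rmult_1_l g) at 2. mono. }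
  split; [lra|].
  assert (Hga : 0 < g / a) by pos.
  assert (Hga1 : g / a <= del / 4) by (apply Rdiv_le_of_mul; lra).
  assert (Hp1 : g / a * (1 - g) <= p) by lra.
  assert (Hp2 : g / (2 * a) <= p).
  { apply Rle_trans with (2 := Hp1). replace (g / (2 * a)) with (g / a * (1/2)) by (field; lra).
    mono. }
  assert (Hp0 : 0 <= p <= 1).
  { assert (0 < g / (2 * a)) by pos. lra. }
  assert (Hrhs : 0 <= exp E *
     (p * (1 - c * exp (- (y + (g - E) - a)) * Gsub k be rho (tau - g) (y + (g - E) - a))
        * Gsub k be rho (tau - g) (y + (g - E) - a)
      + (1 - p) * Gsub k be rho (tau - g) (y + (g - E)))).
  { apply Rmult_le_pos; [left; apply exp_pos|]. apply Rplus_le_le_0_compat; apply Rmult_le_pos;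
      try apply Gsub_nonneg; try lra. apply Rmult_le_pos; [lra|].
    pose proof (nonlinear_small k be eps a c (tau - g) a (y + (g - E) - a)) as H.
    assert (c * exp (- (y + (g - E) - a)) * Gsub k be rho (tau - g) (y + (g - E) - a) <= 1); [|lra].
    destruct (Rlt_dec 0 (y + (g - E) - a)) as [Hpos|Hneg].
    - specialize (H ltac:(lra) ltac:(lra) He Ha ltac:(unfold c in *; lra) ltac:(lra) ltac:(lra)).
      fold rho in H. replace (a / a) with 1 in H by (field; lra).
      assert (eps ^ 2 <= 1) by (clear - He; nra). lra.
    - unfold Gsub. destruct (Rlt_dec 0 (y + (g - E) - a)); [contradiction|lra]. }
  destruct (Rlt_dec 0 y) as [Hy|Hy];
    [|unfold Gsub at 1; destruct (Rlt_dec 0 y); [contradiction|exact Hrhs]].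
  assert (HAB : (m + s) * g / tau + C * g ^ 2 <= B).
  { assert ((m + s) * g / tau <= B / 2).
    { apply Rdiv_le_of_mul; [lra|]. assert (T * B <= tau * B) by mono.
      assert ((m + s) * g <= (m + s) * 1) by mono. lra. }
    assert (C * g0 * g <= C * g0 * 1) by mono. lra. }
  destruct (Rle_dec y K) as [HyK|HyK].
  - pose proof (sub_step_low k be eps a c K kap tau g (g - E) p y Hbe He Ha ltac:(unfold c in *; lra) Hk1 HK1
      ltac:(lra) ltac:(lra) ltac:(lra) ltac:(lra) ltac:(lra) ltac:(lra) ltac:(fold del; lra) ltac:(lra) ltac:(lra)) as H.
    fold m N eta rho in H.
    specialize (H ltac:(assert (T * eta <= tau * eta) by mono; lra)).
    apply Rle_trans with (1 := H).
    set (Z := p * _ * _ + _) in *.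
    assert (HZ : 0 <= Z) by (apply Rle_trans with (2 := H); apply Gsub_nonneg).
    rewrite <- (Rmult_1_l Z) at 1. apply Rmult_le_compat_r; [exact HZ|].
    rewrite <- exp_0. destruct (Rle_lt_or_eq_dec 0 E HE0) as [Hlt|Heq];
      [left; apply exp_increasing, Hlt | rewrite <- Heq; lra].
  - destruct (Rlt_dec 0 (tau - be * y ^ 2)) as [Hx|Hx].
    + pose proof (sub_step_high k eps a K C C8 c tau g E p y) as H. cbv zeta in H.
      fold m rho s in H. rewrite <- Ebe in H. apply H; clear H; try assumption; try lra; try reflexivity.
      * apply Rdiv_le_of_mul; [lra|].
        replace (rho * s) with (eps / 2 * (2 * rho * s / eps)) by (field; lra). mono.
      * replace (rho * a / K + g + 2 * (a / (2 * K) + g * (1 / (2 * be * K) + 1) / a)) with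
          ((rho + 1) * a / K + g * W) by (unfold W; field; lra).
        assert ((rho + 1) * a / K <= 1 / (4 * m)).
        { apply Rdiv_le_of_mul; [lra|]. replace (1 / (4 * m) * K) with (K / (4 * m)) by (field; lra).
          pos. }
        assert (g * W <= 1 / (4 * m)).
        { apply Rdiv_ge_of_mul; [lra|]. assert (g * (4 * m * W) <= g0 * (4 * m * W)).
          { apply Rmult_le_compat_r; [|lra]. left. pos. } lra. }
        replace (1 / (2 * m)) with (1 / (4 * m) + 1 / (4 * m)) by (field; lra). lra.
      * apply Rle_trans with (2 := G3). rewrite (Rmult_comm g0). mono.
      * apply Rle_trans with (2 := HB2). mono.
      * unfold c in *; lra.
    + assert (HG0 : Gsub k be rho tau y = 0).
      { unfold Gsub. destruct (Rlt_dec 0 y); [|reflexivity].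
        rewrite Rmax_left; [rewrite pow_ne_zero; [ring|lia]|].
        assert (1 <= be * y ^ 2 / tau) by pos. lra. }
      rewrite HG0. exact Hrhs.
Qed.

(** * A subsolution for hitting a line within a time window *)

(** Any positive multiple of t^2 serves the purpose; 1/4 instead of the optimal 1/2 follows from exp
    (-t) >= (1 - t/2)^2. *)
Lemma ln_one_minus_le t : 0 <= t < 1 -> ln (1 - t) <= - t - t ^ 2 / 4.
Proof.
  intros Ht.
  assert (He : (1 - t / 2) ^ 2 <= exp (- t)).
  { replace (exp (- t)) with (exp (- (t / 2)) ^ 2)
      by (simpl; rewrite Rmult_1_r, <- exp_plus; f_equal; field).
    apply pow_incr. split; [lra|]. pose proof (exp_ineq1_le (- (t / 2))). lra. }
  pose proof (exp_pos (- t)) as Hp.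
  assert (Hz : (1 - t) * exp t <= 1 - t ^ 2 / 4).
  { replace (exp t) with (/ exp (- t)) by (rewrite exp_Ropp, Rinv_inv; reflexivity).
    apply Rdiv_le_of_mul; [assumption|].
    assert (t ^ 2 <= t) by (clear - Ht; nra). pose proof (pow2_ge_0 t).
    apply Rle_trans with ((1 - t ^ 2 / 4) * (1 - t / 2) ^ 2).
    - assert (0 <= t ^ 2 / 4 * (t - t ^ 2 / 4)) by pos. lra.
    - mono. }
  assert (Hz0 : 0 < (1 - t) * exp t) by (apply Rmult_lt_0_compat; [lra|apply exp_pos]).
  pose proof (ln_le_minus_one _ Hz0) as H. rewrite ln_mult, ln_exp in H by (try apply exp_pos; lra). lra.
Qed.

(** The convexity of -ln y gains an amount of order 1/y^2, against a loss 1/(2 tau) from the passage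
    of time. Where the function is positive, y^2 < exp (-2 k0) tau, so a large [k0] makes the gain
    win. *)
Definition Uwin (k0 tau y : R) : R := Rmax 0 (ln tau / 2 - ln y - k0).

Lemma Uwin_nonneg k0 tau y : 0 <= Uwin k0 tau y.
Proof. apply Rmax_l. Qed.

Lemma ln_nonneg x : 1 <= x -> 0 <= ln x.
Proof.
  intros H. rewrite <- ln_1. destruct H as [H|H]; [left; apply ln_increasing; lra | rewrite <- H; lra].
Qed.

Lemma ln_le_compat x y : 0 < x -> x <= y -> ln x <= ln y.
Proof. intros Hx [H|H]; [left; apply ln_increasing; lra | rewrite H; lra]. Qed.

Lemma ln2_bounds : 1/2 <= ln 2 <= 1.
Proof.
  split.
  - rewrite <- (ln_exp (1/2)). apply ln_le_compat; [apply exp_pos|].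
    pose proof (exp_ineq1_le (- (1/2))) as H3. rewrite exp_Ropp in H3.
    apply Rinv_le_contravar in H3; [|lra]. rewrite Rinv_inv in H3.
    replace (/ (1 + - (1 / 2))) with 2 in H3 by field. lra.
  - pose proof (ln_le_minus_one 2). lra.
Qed.

Lemma Uwin_le k0 tau y : 0 <= k0 -> 1 <= tau -> 1 <= y -> Uwin k0 tau y <= ln tau / 2.
Proof.
  intros Hk Ht Hy. pose proof (ln_nonneg tau Ht). pose proof (ln_nonneg y Hy).
  apply Rmax_lub; lra.
Qed.

(** All terms are compared with [W], that is g/(128 y^2). The strict convexity of -ln y, felt
    through the jump, yields at least 4 a W, while the passage of time, the imperfect centring of
    the step and the nonlinear term cost at most a W each. *)
Lemma window_step a k0 c tau g p y :
  0 < a <= 1 -> 0 <= k0 -> 128 / a <= exp (2 * k0) -> 0 <= c -> 2 <= y -> 2 <= tau - g ->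
  0 < g <= a / 2 -> g * y <= a / (128 * (1 + 1 / a)) -> c * ln tau ^ 2 <= a ^ 2 / 4096 ->
  g / a - g ^ 2 / a <= p <= g / a -> 0 <= p <= 1 ->
  let nu := c * exp (- (y + g - a)) * Uwin k0 (tau - g) (y + g - a) in
  Uwin k0 tau y <=
    p * (1 - nu) * Uwin k0 (tau - g) (y + g - a) + (1 - p) * Uwin k0 (tau - g) (y + g).
Proof.
  intros Ha Hk0 Hk1 Hc Hy Ht Hg Hgy Hct Hp Hp01 nu.
  set (yj := y + g - a) in *. assert (Hyj : 1 <= yj) by (unfold yj; lra).
  set (Uj := Uwin k0 (tau - g) yj) in *. set (U1 := Uwin k0 (tau - g) (y + g)).
  assert (HUj0 : 0 <= Uj) by apply Uwin_nonneg. assert (HU10 : 0 <= U1) by apply Uwin_nonneg.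
  assert (HUj : Uj <= ln tau / 2).
  { apply Rle_trans with (ln (tau - g) / 2); [apply Uwin_le; lra|].
    pose proof (ln_le_compat (tau - g) tau). lra. }
  assert (Hdec : exp (- yj) * y ^ 2 <= 128).
  { apply Rle_trans with (2 := exp_quarter_decay y ltac:(lra)).
    apply Rmult_le_compat_r; [apply pow2_ge_0|]. left. apply exp_increasing. unfold yj; lra. }
  assert (Hej : 0 < exp (- yj) <= 1).
  { split; [apply exp_pos|]. rewrite <- exp_0. left. apply exp_increasing. lra. }
  assert (Hy2 : 0 < y ^ 2) by pos.
  assert (Hnu : 0 <= nu * Uj <= a ^ 2 / (128 * y ^ 2)).
  { unfold nu. split; [repeat apply Rmult_le_pos; lra|].
    apply Rdiv_ge_of_mul; [lra|].
    replace (c * exp (- yj) * Uj * Uj * (128 * y ^ 2)) with (128 * (c * Uj ^ 2) * (exp (- yj) * y ^ 2)) by ring.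
    assert (H1 : c * Uj ^ 2 <= c * (ln tau / 2) ^ 2) by (apply Rmult_le_compat_l; [lra|apply pow_incr; lra]).
    assert (H0 : 0 <= c * Uj ^ 2) by (apply Rmult_le_pos; [lra|apply pow2_ge_0]).
    apply Rle_trans with (128 * (a ^ 2 / 16384) * 128); [|lra].
    apply Rmult_le_compat; try lra. pos. }
  assert (Ha2 : 0 < a ^ 2 <= 1) by (split; [apply pow_lt; lra | clear - Ha; nra]).
  assert (Hnu1 : nu <= 1).
  { unfold nu. assert (HcU : c * Uj ^ 2 <= 1).
    { apply Rle_trans with (c * (ln tau / 2) ^ 2); [apply Rmult_le_compat_l; [lra|apply pow_incr; lra]|]. lra. }
    destruct (Rle_dec Uj 1) as [H1|H1].
    - destruct (Rle_dec c 1) as [H2|H2].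
      + rewrite <- (Rmult_1_r 1), <- (Rmult_1_r 1) at 1. apply Rmult_le_compat; try lra.
        * pos.
        * rewrite <- (Rmult_1_r 1). apply Rmult_le_compat; lra.
      + assert (Hl2 : 1/2 <= ln tau).
        { apply Rle_trans with (ln 2); [|apply ln_le_compat; lra].
          pose proof ln2_bounds. lra. }
        assert (1/4 <= ln tau ^ 2) by (clear - Hl2; nra).
        assert (1 * (1/4) <= c * ln tau ^ 2) by (apply Rmult_le_compat; lra). lra.
    - apply Rle_trans with (c * Uj ^ 2); [|exact HcU].
      replace (c * Uj ^ 2) with (c * Uj * Uj) by ring.
      replace (c * exp (- yj) * Uj) with (c * Uj * exp (- yj)) by ring.
      apply Rmult_le_compat_l; [pos|lra]. }
  assert (HR0 : 0 <= p * (1 - nu) * Uj + (1 - p) * U1).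
  { apply Rplus_le_le_0_compat; repeat apply Rmult_le_pos; lra. }
  unfold Uwin at 1. apply Rmax_lub; [exact HR0|].
  set (u := ln tau / 2 - ln y - k0).
  destruct (Rle_dec u 0) as [Hu|Hu]; [lra|].
  assert (Hyt : y ^ 2 * (128 / a) <= tau).
  { assert (Hl : ln (y ^ 2 * exp (2 * k0)) <= ln tau).
    { rewrite ln_mult by (try apply exp_pos; lra). rewrite ln_exp.
      replace (y ^ 2) with (y * y) by ring. rewrite ln_mult by lra. unfold u in Hu. lra. }
    apply Rle_trans with (y ^ 2 * exp (2 * k0)); [mono|].
    apply Rnot_lt_le. intros Hlt2. apply ln_increasing in Hlt2; lra. }
  assert (Hj : ln (tau - g) / 2 - ln yj - k0 <= Uj) by apply Rmax_r.
  assert (H1 : ln (tau - g) / 2 - ln (y + g) - k0 <= U1) by apply Rmax_r.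
  set (t := (a - g) / y).
  assert (Ht1 : a / 2 / y <= t).
  { unfold t, Rdiv at 1 3. apply Rmult_le_compat_r; [left; apply Rinv_0_lt_compat|]; lra. }
  assert (Hay : 0 < a / 2 / y) by pos.
  assert (Ht2 : t < 1).
  { unfold t. apply (Rmult_lt_reg_r y); [lra|]. unfold Rdiv. rewrite Rmult_assoc, Rinv_l by lra. lra. }
  assert (Eyj : ln yj = ln y + ln (1 - t)).
  { rewrite <- ln_mult by lra. f_equal. unfold t, yj. field. lra. }
  pose proof (ln_one_minus_le t ltac:(lra)) as Hln.
  assert (Ey1 : ln (y + g) <= ln y + g / y).
  { assert (0 < g / y) by pos.
    replace (y + g) with (y * (1 + g / y)) by (field; lra). rewrite ln_mult by lra.
    pose proof (ln_le_minus_one (1 + g / y)). lra. }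
  assert (Etau : ln tau <= ln (tau - g) + g / (tau - g)).
  { assert (0 < g / (tau - g)) by pos.
    replace tau with ((tau - g) * (1 + g / (tau - g))) at 1 by (field; lra). rewrite ln_mult by lra.
    pose proof (ln_le_minus_one (1 + g / (tau - g))). lra. }
  set (W := g / (128 * y ^ 2)).
  assert (HW : 0 < W) by pos.
  assert (E1 : g / (tau - g) / 2 <= a * W).
  { apply Rle_trans with (g / tau).
    - replace (g / (tau - g) / 2) with (g / (2 * (tau - g))) by (field; lra).
      unfold Rdiv. apply Rmult_le_compat_l; [lra|]. apply Rinv_le_contravar; lra.
    - apply Rdiv_le_of_mul; [lra|]. apply Rle_trans with (a * W * (y ^ 2 * (128 / a))).
      + right. unfold W. field. lra.
      + apply Rmult_le_compat_l; [pos|exact Hyt]. }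
  assert (Hp2 : g / (2 * a) <= p).
  { apply Rle_trans with (2 := proj1 Hp).
    replace (g / a - g ^ 2 / a) with (g / (2 * a) * (2 * (1 - g))) by (field; lra).
    rewrite <- (Rmult_1_r (g / (2 * a))) at 1. apply Rmult_le_compat_l; [apply Rdiv_ge_of_mul|]; lra. }
  assert (E2 : - (a * W) <= p * t - (1 - p) * (g / y)).
  { assert (Hpt : (g / a - g ^ 2 / a) * t <= p * t) by mono.
    assert (0 <= p * (g / y)) by (apply Rmult_le_pos; [lra|pos]).
    assert (Eq : (g / a - g ^ 2 / a) * t = g / y - g ^ 2 * (1 + 1 / a) / y + g ^ 3 / a / y)
      by (unfold t; field; lra).
    assert (0 <= g ^ 3 / a / y).
    { apply Rdiv_ge_of_mul; [lra|]. rewrite Rmult_0_l. apply Rdiv_ge_of_mul; [lra|].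
      rewrite Rmult_0_l. apply pow_le; lra. }
    assert (Hia : 0 < 1 / a) by pos.
    assert (g ^ 2 * (1 + 1 / a) / y <= a * W).
    { replace (g ^ 2 * (1 + 1 / a) / y) with (128 * (1 + 1 / a) * (g * y) * W) by (unfold W; field; lra).
      apply Rmult_le_compat_r; [lra|].
      apply Rle_trans with (128 * (1 + 1 / a) * (a / (128 * (1 + 1 / a)))).
      - mono.
      - right. field. lra. }
    lra. }
  assert (E3 : 4 * (a * W) <= p * (t ^ 2 / 4)).
  { assert ((a / 2 / y) ^ 2 <= t ^ 2) by (apply pow_incr; lra).
    apply Rle_trans with (g / (2 * a) * ((a / 2 / y) ^ 2 / 4)).
    - right. unfold W. field. lra.
    - apply Rmult_le_compat; try lra.
      + pos.
      + pose proof (pow2_ge_0 (a / 2 / y)). lra. }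
  assert (E4 : p * (nu * Uj) <= a * W).
  { apply Rle_trans with (g / a * (a ^ 2 / (128 * y ^ 2))).
    - apply Rmult_le_compat; lra.
    - right. unfold W. field. lra. }
  assert (E5 : p * (ln (tau - g) / 2 - ln yj - k0) <= p * Uj) by mono.
  assert (E6 : (1 - p) * (ln (tau - g) / 2 - ln (y + g) - k0) <= (1 - p) * U1) by mono.
  assert (E7 : p * (t + t ^ 2 / 4) <= p * (ln y - ln yj)) by mono.
  assert (E8 : (1 - p) * (- (g / y)) <= (1 - p) * (ln y - ln (y + g))) by mono.
  assert (0 < a * W) by pos.
  unfold u. lra.
Qed.

(** * The tilted walk *)

(** By 1 + b = 2 exp a, the mean of the sum of exp (a |u|) grows by the factor 1 + b/n at step [n].
    The relation b = a (1 + b) is criticality: the mean displacement a (1 + b)/n of the tilted walk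
    balances the increase b/n of log M_n to first order. *)
Definition params (a b : R) := 0 < a < 1 /\ 0 < b /\ 1 + b = 2 * exp a /\ b = a * (1 + b).

Lemma params_intro a b : 0 < a -> 2 * (a - 1) * exp a + 1 = 0 -> b = 2 * a * exp a -> params a b.
Proof.
  intros Ha Hae Hb. pose proof (exp_pos a).
  assert (a < 1) by (apply Rnot_le_lt; intros H1; assert (0 <= (a - 1) * exp a) by pos; lra).
  assert (E : 1 + b = 2 * exp a) by lra.
  repeat split; try lra.
  - rewrite Hb. pos.
  - rewrite E. lra.
Qed.

(* [logM b n] is the logarithm of the mean of [sum_u exp (a |u|)] over the leaves of T_n, so that
   [sum_u exp (- (logM b n - a |u|))] is a martingale. *)
Definition incr (b : R) (n : nat) : R := ln (1 + b / INR n).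
Definition logM (b : R) (n : nat) : R := rsum (incr b) (seq 1 (n - 1)).

Lemma INR_ge_1 n : (1 <= n)%nat -> 1 <= INR n.
Proof. intros H. change 1 with (INR 1). apply le_INR, H. Qed.

Lemma logM_1 b : logM b 1 = 0.
Proof. reflexivity. Qed.

Lemma logM_S b n : (1 <= n)%nat -> logM b (S n) = logM b n + incr b n.
Proof.
  intros H. unfold logM. replace (S n - 1)%nat with (S (n - 1)) by lia.
  rewrite seq_S, rsum_app. replace (1 + (n - 1))%nat with n by lia.
  cbn [rsum fold_right]. lra.
Qed.

Lemma incr_pos b n : 0 < b -> (1 <= n)%nat -> 0 < incr b n.
Proof.
  intros Hb Hn. pose proof (INR_ge_1 n Hn). unfold incr. rewrite <- ln_1. apply ln_increasing; [lra|].
  assert (0 < b / INR n) by pos. lra.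
Qed.

Lemma incr_le b n : 0 < b -> (1 <= n)%nat -> incr b n <= b / INR n.
Proof.
  intros Hb Hn. pose proof (INR_ge_1 n Hn). unfold incr.
  assert (0 < b / INR n) by pos.
  pose proof (ln_le_minus_one (1 + b / INR n)). lra.
Qed.

Lemma exp_neg_incr b n : 0 < b -> (1 <= n)%nat -> exp (- incr b n) = INR n / (INR n + b).
Proof.
  intros Hb Hn. pose proof (INR_ge_1 n Hn). unfold incr.
  assert (0 < b / INR n) by pos.
  rewrite exp_Ropp, exp_ln by lra. field. lra.
Qed.

Lemma incr_ge b n : 0 < b -> (1 <= n)%nat -> b / (INR n + b) <= incr b n.
Proof.
  intros Hb Hn. pose proof (INR_ge_1 n Hn). pose proof (exp_ineq1_le (- incr b n)) as H1.
  rewrite exp_neg_incr in H1 by assumption.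
  replace (b / (INR n + b)) with (1 - INR n / (INR n + b)) by (field; lra). lra.
Qed.

Lemma logM_le_mono b n n' : 0 < b -> (1 <= n <= n')%nat -> logM b n <= logM b n'.
Proof.
  intros Hb [Hn Hle]. induction Hle as [|n' Hle IH]; [lra|].
  rewrite logM_S by lia. pose proof (incr_pos b n' Hb ltac:(lia)). lra.
Qed.

Lemma logM_nonneg b n : 0 < b -> (1 <= n)%nat -> 0 <= logM b n.
Proof. intros Hb Hn. rewrite <- (logM_1 b). apply logM_le_mono; [assumption|lia]. Qed.

Lemma logM_upper b n : 0 < b -> (1 <= n)%nat -> logM b n <= b * ln (INR n) + b.
Proof.
  intros Hb Hn. enough (logM b n <= b * ln (INR n) + b - b / INR n).
  { pose proof (INR_ge_1 n Hn). assert (0 < b / INR n) by pos. lra. }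
  induction Hn as [|n Hn IH].
  - rewrite logM_1. simpl. rewrite ln_1. lra.
  - rewrite logM_S by assumption. pose proof (INR_ge_1 n Hn) as H1.
    assert (Hl : ln (INR n) + 1 / (INR n + 1) <= ln (INR (S n))).
    { rewrite S_INR. pose proof (ln_le_minus_one (INR n / (INR n + 1))) as H.
      assert (0 < INR n / (INR n + 1)) by pos.
      specialize (H H0). unfold Rdiv in H at 1. rewrite ln_mult, ln_Rinv in H;
        [|lra|lra|apply Rinv_0_lt_compat; lra].
      replace (INR n / (INR n + 1)) with (1 - 1 / (INR n + 1)) in H by (field; lra). lra. }
    pose proof (incr_le b n Hb Hn) as Hg. rewrite S_INR in *.
    assert (b * (ln (INR n) + 1 / (INR n + 1)) <= b * ln (INR n + 1)) by mono.
    replace (b / (INR n + 1)) with (b * (1 / (INR n + 1))) by (field; lra). lra.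
Qed.

Lemma inv_sq_le_telescope n : (1 <= n)%nat -> 1 / INR n ^ 2 <= 2 * (1 / INR n - 1 / (INR n + 1)).
Proof.
  intros Hn. pose proof (INR_ge_1 n Hn).
  replace (2 * (1 / INR n - 1 / (INR n + 1))) with (2 / (INR n * (INR n + 1))) by (field; lra).
  apply Rdiv_le_of_mul; [apply pow_lt; lra|].
  replace (2 / (INR n * (INR n + 1)) * INR n ^ 2) with (2 * INR n / (INR n + 1)) by (field; lra).
  pos.
Qed.

Lemma logM_lower b n : 0 < b -> (1 <= n)%nat -> b * ln (INR n) - 2 * b ^ 2 <= logM b n.
Proof.
  intros Hb Hn. assert (Hb2 : 0 < b ^ 2) by pos.
  enough (b * ln (INR n) - 2 * b ^ 2 + 2 * b ^ 2 / INR n <= logM b n).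
  { pose proof (INR_ge_1 n Hn). assert (0 < 2 * b ^ 2 / INR n) by pos. lra. }
  induction Hn as [|n Hn IH].
  - rewrite logM_1. simpl. rewrite ln_1. lra.
  - rewrite logM_S by assumption. pose proof (INR_ge_1 n Hn) as H1.
    assert (Hl : ln (INR (S n)) <= ln (INR n) + 1 / INR n).
    { rewrite S_INR. assert (0 < 1 / INR n) by pos.
      replace (INR n + 1) with (INR n * (1 + 1 / INR n)) by (field; lra).
      rewrite ln_mult by lra. pose proof (ln_le_minus_one (1 + 1 / INR n)). lra. }
    pose proof (incr_ge b n Hb Hn) as Hg. rewrite S_INR in *.
    assert (Hq : b / INR n - b ^ 2 * (1 / INR n ^ 2) <= b / (INR n + b)).
    { apply Rdiv_ge_of_mul; [lra|].
      replace ((b / INR n - b ^ 2 * (1 / INR n ^ 2)) * (INR n + b)) with (b - b ^ 3 / INR n ^ 2) by (field; lra).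
      assert (0 < b ^ 3 / INR n ^ 2) by (apply Rdiv_lt_0_compat; apply pow_lt; lra). lra. }
    pose proof (inv_sq_le_telescope n Hn) as Ht.
    assert (b ^ 2 * (1 / INR n ^ 2) <= b ^ 2 * (2 * (1 / INR n - 1 / (INR n + 1)))) by mono.
    assert (b * ln (INR n + 1) <= b * (ln (INR n) + 1 / INR n)) by mono.
    replace (2 * b ^ 2 / (INR n + 1)) with (b ^ 2 * (2 * (1 / (INR n + 1)))) by (field; lra).
    replace (2 * b ^ 2 / INR n) with (b ^ 2 * (2 * (1 / INR n))) in IH by (field; lra).
    replace (b * (ln (INR n) + 1 / INR n)) with (b * ln (INR n) + b / INR n) in * by (field; lra). lra.
Qed.

(** The bound is uniform in [m] and [l]: discretisation errors of the form C incr^2 contribute a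
    bounded total over any range of times. *)
Lemma incr_sq_sum b m l : 0 < b -> (1 <= m)%nat -> rsum (fun j => incr b j ^ 2) (seq m l) <= 2 * b ^ 2.
Proof.
  intros Hb Hm. assert (Hb2 : 0 < b ^ 2) by pos.
  enough (rsum (fun j => incr b j ^ 2) (seq m l) <= b ^ 2 * (2 * (1 / INR m - 1 / INR (m + l)))).
  { pose proof (INR_ge_1 m Hm). pose proof (INR_ge_1 (m + l) ltac:(lia)).
    assert (0 < 1 / INR (m + l)) by pos.
    assert (1 / INR m <= 1) by (apply Rdiv_le_of_mul; lra).
    assert (b ^ 2 * (2 * (1 / INR m - 1 / INR (m + l))) <= b ^ 2 * 2) by mono. lra. }
  induction l as [|l IH].
  - rewrite Nat.add_0_r. simpl. lra.
  - rewrite seq_S, rsum_app. cbn [rsum fold_right]. rewrite Nat.add_succ_r, S_INR.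
    pose proof (inv_sq_le_telescope (m + l) ltac:(lia)) as Ht.
    pose proof (incr_pos b (m + l) Hb ltac:(lia)) as G1. pose proof (incr_le b (m + l) Hb ltac:(lia)) as G2.
    pose proof (INR_ge_1 (m + l) ltac:(lia)) as H1.
    assert (incr b (m + l) ^ 2 <= b ^ 2 * (1 / INR (m + l) ^ 2)).
    { replace (b ^ 2 * (1 / INR (m + l) ^ 2)) with ((b / INR (m + l)) ^ 2) by (field; lra).
      apply pow_incr. lra. }
    assert (b ^ 2 * (1 / INR (m + l) ^ 2) <= b ^ 2 * (2 * (1 / INR (m + l) - 1 / (INR (m + l) + 1))))
      by mono. lra.
Qed.

(* Under the measure tilted by this martingale, the depth of the spine increases at step [n] with
   probability [jump_prob b n]; criticality makes [logM b n - a |u|] centred up to [O(1/n^2)]. *)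
Definition jump_prob (b : R) (n : nat) : R := (1 + b) / (INR n + b).

(** Criticality gives the exact formula (1 - exp (-g)) / a for the jump probability. *)
Lemma jump_prob_bounds a b n : params a b -> (1 <= n)%nat ->
  0 <= jump_prob b n <= 1 /\ incr b n / a - incr b n ^ 2 / a <= jump_prob b n <= incr b n / a.
Proof.
  intros (Ha & Hb & _ & Hab) Hn. pose proof (INR_ge_1 n Hn) as H1.
  set (g := incr b n). assert (Hg : 0 < g) by (apply incr_pos; assumption).
  assert (E : jump_prob b n = (1 - exp (- g)) / a).
  { unfold g, jump_prob. rewrite exp_neg_incr by assumption.
    replace (1 - INR n / (INR n + b)) with (b / (INR n + b)) by (field; lra).
    rewrite Hab at 3. field. lra. }
  split.
  - unfold jump_prob. split; [pos | apply Rdiv_le_of_mul; lra].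
  - rewrite E. pose proof (exp_ineq1_le (- g)). pose proof (exp_neg_quadratic g (Rlt_le _ _ Hg)).
    replace (g / a - g ^ 2 / a) with ((g - g ^ 2) / a) by (field; lra).
    unfold Rdiv. split; apply Rmult_le_compat_r; try lra; left; apply Rinv_0_lt_compat; lra.
Qed.

(** The many-to-one formula for one step: conjugation by exp (-V) turns the operator on sums over
    leaves into the transition of a walk. [X] and [Y] stand for the values of a test function after
    a jump and without one. *)
Lemma tilt_identity a b n V X Y : params a b -> (1 <= n)%nat ->
  (INR n - 1) * (exp (- (V + incr b n)) * Y) + 2 * (exp (- (V + incr b n - a)) * X)
  = INR n * (exp (- V) * (jump_prob b n * X + (1 - jump_prob b n) * Y)).
Proof.
  intros (Ha & Hb & Hab & _) Hn. pose proof (INR_ge_1 n Hn) as H1.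
  replace (- (V + incr b n - a)) with (- V + - incr b n + a) by ring.
  replace (- (V + incr b n)) with (- V + - incr b n) by ring.
  rewrite !exp_plus, exp_neg_incr by assumption.
  replace (exp a) with ((1 + b) / 2) by lra. unfold jump_prob. field. lra.
Qed.

(** * Tail bounds for the minimal displacement *)

(* The time left until [N], shifted by [te], on the clock [logM b]. *)
Definition time_left (b : R) (N : nat) (te : R) (n : nat) : R := te + (logM b N - logM b (Nat.min n N)).

(* Bramson's logarithmically curved barrier [s log (tau_m / tau_n)]; the [C incr^2] terms absorb
   the discretisation errors. *)
Definition barrier (b s C : R) (m N : nat) (te : R) (n : nat) : R :=
  logM b m - 1 + rsum (fun j => s * incr b j / time_left b N te j + C * incr b j ^ 2) (seq m (Nat.min n N - m)).

Definition gap (a b s C : R) (m N : nat) (te : R) (n h : nat) : R :=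
  logM b (Nat.min n N) - a * INR h - barrier b s C m N te n.

Definition barrier_sub (k : nat) (be c a b rho s C : R) (m N : nat) (te : R) (n h : nat) : R :=
  c * exp (- gap a b s C m N te n h) * Gsub k be rho (time_left b N te n) (gap a b s C m N te n h).

Lemma time_left_ge b N te n : 0 < b -> (1 <= n)%nat -> (1 <= N)%nat -> te <= time_left b N te n.
Proof.
  intros Hb Hn HN. unfold time_left. pose proof (logM_le_mono b (Nat.min n N) N Hb ltac:(lia)). lra.
Qed.

Lemma time_left_S b N te n : (1 <= n < N)%nat -> time_left b N te (S n) = time_left b N te n - incr b n.
Proof.
  intros H. unfold time_left. rewrite !Nat.min_l by lia. rewrite logM_S by lia. ring.
Qed.

Lemma barrier_S b s C m N te n : (m <= n < N)%nat ->
  barrier b s C m N te (S n) = barrier b s C m N te n + (s * incr b n / time_left b N te n + C * incr b n ^ 2).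
Proof.
  intros H. unfold barrier. rewrite !Nat.min_l by lia. replace (S n - m)%nat with (S (n - m)) by lia.
  rewrite seq_S, rsum_app. replace (m + (n - m))%nat with n by lia. cbn [rsum fold_right]. ring.
Qed.

(** From g/t <= ln t - ln (t - g) the sum of the s g/tau telescopes into a logarithm. *)
Lemma barrier_le b s C m N te n : 0 < b -> (1 <= m <= n)%nat -> (n <= N)%nat -> 0 <= s -> 0 <= C -> 0 < te ->
  barrier b s C m N te n <= logM b m - 1 + s * (ln (time_left b N te m) - ln (time_left b N te n)) + C * (2 * b ^ 2).
Proof.
  intros Hb [Hm Hmn] HnN Hs HC Hte.
  enough (barrier b s C m N te n <= logM b m - 1 + s * (ln (time_left b N te m) - ln (time_left b N te n))
      + C * rsum (fun j => incr b j ^ 2) (seq m (n - m))).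
  { pose proof (incr_sq_sum b m (n - m) Hb Hm).
    assert (C * rsum (fun j => incr b j ^ 2) (seq m (n - m)) <= C * (2 * b ^ 2)) by mono. lra. }
  induction Hmn as [|n Hmn IH].
  - unfold barrier. rewrite Nat.min_l by lia. rewrite Nat.sub_diag. simpl. lra.
  - specialize (IH ltac:(lia)). rewrite barrier_S by lia.
    replace (S n - m)%nat with (S (n - m)) by lia. rewrite seq_S, rsum_app.
    replace (m + (n - m))%nat with n by lia. cbn [rsum fold_right].
    rewrite (time_left_S b N te n) by lia.
    pose proof (time_left_ge b N te n Hb ltac:(lia) ltac:(lia)) as H1.
    pose proof (time_left_ge b N te (S n) Hb ltac:(lia) ltac:(lia)) as H2. rewrite time_left_S in H2 by lia.
    set (t := time_left b N te n) in *. set (g := incr b n) in *.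
    assert (Hl : ln (t - g) <= ln t - g / t).
    { replace (t - g) with (t * (1 - g / t)) by (field; lra).
      assert (0 < 1 - g / t).
      { replace (1 - g / t) with ((t - g) / t) by (field; lra). pos. }
      rewrite ln_mult by lra. pose proof (ln_le_minus_one (1 - g / t) H). lra. }
    assert (s * (g / t) <= s * (ln t - ln (t - g))) by mono.
    replace (s * g / t) with (s * (g / t)) by (field; lra). lra.
Qed.

(** * Survival above the curved barrier *)

Section Phase1.
Variables (a b eps : R) (k : nat) (be c C tau0 g0 : R).
Let rho := 1 + eps.
Let s := 3/2 + 3 * eps.
Hypothesis Hab : params a b.
Hypothesis Heps : 0 < eps <= 1/2.
Hypothesis Hk : (1 <= k)%nat.
Hypothesis Hbe : 0 < be.
Hypothesis Hc : 0 < c <= 1/2.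
Hypothesis HC : 0 <= C.
Hypothesis Htau0 : 1 <= tau0.
Hypothesis Hstep : forall tau g p y,
  let E := s * g / tau + C * g ^ 2 in
  let yj := y + (g - E) - a in
  let nu := c * exp (- yj) * Gsub k be rho (tau - g) yj in
  0 < g <= g0 -> tau0 <= tau - g -> g / a - g ^ 2 / a <= p <= g / a ->
  0 <= E <= g /\
  Gsub k be rho tau y <=
    exp E * (p * (1 - nu) * Gsub k be rho (tau - g) yj
             + (1 - p) * Gsub k be rho (tau - g) (y + (g - E))).

Lemma weighted_Gsub_le_half tau y : 0 < tau -> 0 <= c * exp (- y) * Gsub k be rho tau y <= 1/2.
Proof.
  intros Ht. assert (Hce : 0 < c * exp (- y)) by (apply Rmult_lt_0_compat; [lra|apply exp_pos]).
  split; [apply Rmult_le_pos; [lra|apply Gsub_nonneg]|].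
  destruct (Rlt_dec 0 y) as [Hy|Hy]; [|unfold Gsub; destruct (Rlt_dec 0 y); [contradiction|lra]].
  apply Rle_trans with (c * 1); [|lra]. rewrite Rmult_assoc. apply Rmult_le_compat_l; [lra|].
  apply Rle_trans with (exp (- y) * Rpower y rho).
  - apply Rmult_le_compat_l; [left; apply exp_pos | apply Gsub_le; lra].
  - apply Rle_trans with (exp (- (y / 4))); [apply exp_neg_Rpower_le; unfold rho; lra|].
    rewrite <- exp_0. left. apply exp_increasing. lra.
Qed.

Variables (m N : nat) (te : R).
Hypothesis Hm : (1 <= m)%nat.
Hypothesis HmN : (m <= N)%nat.
Hypothesis Hte : tau0 <= te.
Hypothesis Hgm : b / INR m <= g0.

Let phi := barrier_sub k be c a b rho s C m N te.

Lemma barrier_sub_bounds n h : 0 <= phi n h <= 1/2.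
Proof.
  destruct Hab as (Ha & Hb & _). apply weighted_Gsub_le_half.
  destruct n as [|n].
  - unfold time_left. rewrite Nat.min_0_l. pose proof (logM_nonneg b N Hb ltac:(lia)).
    unfold logM at 2; simpl; lra.
  - pose proof (time_left_ge b N te (S n) Hb ltac:(lia) ltac:(lia)). lra.
Qed.

(** The gap changes by [g - E] or by [g - E - a], where [E] is the increment of the barrier. Applied
    at [y - E], [tilt_identity] reduces the KPP inequality to [sub_step], whose factor exp E is the
    effect of this shift. *)
Lemma barrier_sub_step n h : (m <= n < N)%nat -> phi n h <= kpp n (phi (S n) (S h)) (phi (S n) h).
Proof.
  intros Hn. pose proof Hab as (Ha & Hb & _ & _).
  set (g := incr b n). set (t := time_left b N te n). set (y := gap a b s C m N te n h).
  set (E := s * g / t + C * g ^ 2).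
  assert (Hg : 0 < g <= g0).
  { split; [apply incr_pos; [assumption|lia]|]. apply Rle_trans with (b / INR n); [apply incr_le; [assumption|lia]|].
    apply Rle_trans with (2 := Hgm). unfold Rdiv. apply Rmult_le_compat_l; [lra|].
    pose proof (INR_ge_1 m Hm). apply Rinv_le_contravar; [lra|]. apply le_INR; lia. }
  assert (Ht : time_left b N te (S n) = t - g) by (apply time_left_S; lia).
  assert (Ht0 : tau0 <= t - g).
  { rewrite <- Ht. apply Rle_trans with (1 := Hte). apply time_left_ge; [assumption|lia|lia]. }
  destruct (jump_prob_bounds a b n Hab ltac:(lia)) as [Hp0 Hp].
  destruct (Hstep t g (jump_prob b n) y Hg Ht0 Hp) as [HE HS]. fold E in HE, HS.
  assert (Ey : gap a b s C m N te (S n) h = y + (g - E)).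
  { unfold y, gap. rewrite barrier_S by lia. rewrite !Nat.min_l by lia. rewrite logM_S by lia.
    fold g t E. ring. }
  assert (Eyj : gap a b s C m N te (S n) (S h) = y + (g - E) - a).
  { rewrite <- Ey. unfold gap. rewrite S_INR. ring. }
  unfold phi at 2 3, barrier_sub. rewrite Ey, Eyj, Ht.
  set (yj := y + (g - E) - a) in *. set (Gj := Gsub k be rho (t - g) yj) in *.
  set (G1 := Gsub k be rho (t - g) (y + (g - E))) in *.
  set (nu := c * exp (- yj) * Gj) in *.
  pose proof (INR_ge_1 n ltac:(lia)) as Hn1.
  pose proof (tilt_identity a b n (y - E) ((1 - nu) * Gj) G1 Hab ltac:(lia)) as Hid. fold g in Hid.
  replace (y - E + g) with (y + (g - E)) in Hid by ring. fold yj in Hid.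
  unfold phi, barrier_sub.
  assert (Ek : kpp n nu (c * exp (- (y + (g - E))) * G1) =
     c * (exp (- (y - E)) * (jump_prob b n * ((1 - nu) * Gj) + (1 - jump_prob b n) * G1))).
  { apply (Rmult_eq_reg_l (INR n)); [|lra].
    transitivity (c * (INR n * (exp (- (y - E)) * (jump_prob b n * ((1 - nu) * Gj) + (1 - jump_prob b n) * G1)))); [|ring].
    rewrite <- Hid. unfold kpp. unfold nu at 2 3. field_simplify; [|lra]. unfold nu. ring. }
  rewrite Ek. rewrite Rmult_assoc. apply Rmult_le_compat_l; [lra|].
  replace (- (y - E)) with (- y + E) by ring. rewrite exp_plus, Rmult_assoc.
  apply Rmult_le_compat_l; [left; apply exp_pos|]. apply Rle_trans with (1 := HS).
  rewrite (Rmult_assoc (jump_prob b n)). lra.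
Qed.

(** The barrier starts one unit below a leaf of depth 0, so the gap is 1 there. Depth 0 is enough,
    since the running maximum in [kpp_lower_bound] passes this value on to deeper leaves. *)
Lemma barrier_sub_start : 2 * be <= te -> c * exp (-1) * (1/2) ^ k <= phi m O.
Proof.
  intros Hbt. destruct Hab as (Ha & Hb & _).
  assert (Ey : gap a b s C m N te m 0 = 1).
  { unfold gap, barrier. rewrite Nat.min_l by lia. rewrite Nat.sub_diag. simpl. ring. }
  unfold phi, barrier_sub. rewrite Ey. replace (-(1)) with (-1) by ring.
  apply Rmult_le_compat_l; [apply Rmult_le_pos; [lra|left; apply exp_pos]|].
  unfold Gsub. destruct (Rlt_dec 0 1); [|lra].
  assert (E1 : Rpower 1 rho = 1) by (unfold Rpower; rewrite ln_1, Rmult_0_r; apply exp_0).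
  rewrite E1, Rmult_1_l. apply pow_incr. split; [lra|]. apply Rle_trans with (2 := Rmax_r _ _).
  pose proof (time_left_ge b N te m Hb Hm ltac:(lia)) as Ht.
  assert (be * 1 ^ 2 / time_left b N te m <= 1/2); [|lra].
  apply Rdiv_le_of_mul; lra.
Qed.
End Phase1.

Lemma nat_ge_div b x : 0 < b -> 0 < x -> exists m0, (8 <= m0)%nat /\ forall m, (m0 <= m)%nat -> b / INR m <= x.
Proof.
  intros Hb Hx. destruct (INR_unbounded (b / x)) as [m1 Hm1]. exists (m1 + 8)%nat. split; [lia|].
  intros m Hm. pose proof (INR_ge_1 m ltac:(lia)).
  assert (INR m1 <= INR m) by (apply le_INR; lia).
  apply Rdiv_le_of_mul; [lra|]. apply (Rmult_lt_compat_r x) in Hm1; [|lra].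
  replace (b / x * x) with b in Hm1 by (field; lra).
  assert (INR m1 * x <= INR m * x) by mono. lra.
Qed.

(* Every leaf of T_m starts a fresh attempt whose success probability is bounded below,
   hence the exponential bound in [m]. *)
Theorem min_upper_tail a b eps : params a b -> 0 < eps <= 1/2 ->
  exists (c' C' : R) (m0 : nat), 0 < c' /\ (8 <= m0)%nat /\
  forall m N r, (m0 <= m <= N)%nat -> exp (- INR m * c') < r ->
  outer_le (fun w => forall u, In u (bst_leaves N w) ->
    logM b m + (3/2 + 3 * eps) * ln (1 + logM b N) + C' < logM b N - a * INR (length u)) r.
Proof.
  intros Hab Heps. pose proof Hab as (Ha & Hb & _ & _).
  destruct (sub_step a eps ltac:(lra) Heps) as (k & be & c & C & tau0 & g0 & Hk & Hbe & Hc & HC & Htau0 & Hg0 & Hstep).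
  set (rho := 1 + eps) in *. set (s := 3/2 + 3 * eps) in *.
  destruct (nat_ge_div b g0 Hb ltac:(lra)) as (m0 & Hm08 & Hm0).
  set (te := tau0 + 2 * be).
  (* At time [N] the time left is [te], and the profile vanishes beyond distance [R0], because be
     R0^2 >= te. This supplies the terminal condition. *)
  set (R0 := 1 + te / be).
  assert (Hte0 : 0 < te / be) by (apply Rdiv_lt_0_compat; unfold te; lra).
  exists (c * exp (-1) * (1/2) ^ k), (C * (2 * b ^ 2) + R0), m0.
  assert (Hc' : 0 < c * exp (-1) * (1/2) ^ k).
  { apply Rmult_lt_0_compat; [apply Rmult_lt_0_compat; [lra|apply exp_pos]|apply pow_lt; lra]. }
  split; [exact Hc'|]. split; [exact Hm08|].
  intros m N r HmN Hr.
  set (phi := barrier_sub k be c a b rho s C m N te).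
  set (thr := logM b m + s * ln (1 + logM b N) + (C * (2 * b ^ 2) + R0)).
  set (D := fun n h : nat => n = N /\ logM b N - a * INR h <= thr).
  apply outer_mono with (fun w => forall n u, (m <= n <= N)%nat -> In u (bst_leaves n w) -> ~ D n (length u)) r;
    [|lra|].
  - intros w _ H n u Hn Hu [-> Hd]. specialize (H u Hu). lra.
  - apply kpp_lower_bound with phi.
    + lia.
    + intros n h. apply barrier_sub_bounds with (tau0 := tau0); auto; try lia; unfold te; lra.
    + intros n h h' _ Hh [-> Hd]. split; [reflexivity|]. apply le_INR in Hh.
      assert (a * INR h <= a * INR h') by mono. lra.
    + intros n h Hn _. apply (barrier_sub_step a b eps k be c C tau0 g0); auto; try lia; unfold te; try lra.
      apply Hm0; lia.
    + intros h Hd. assert (Hd' : thr < logM b N - a * INR h) by (apply Rnot_le_lt; intros Hle; apply Hd; split; auto).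
      unfold phi, barrier_sub. set (y := gap a b s C m N te N h).
      assert (Hs0 : 0 <= s) by (unfold s; lra). assert (Hte : 0 < te) by (unfold te; lra).
      assert (Et : time_left b N te N = te) by (unfold time_left; rewrite Nat.min_id; ring).
      assert (Hy : R0 <= y).
      { unfold y, gap. rewrite Nat.min_id.
        pose proof (barrier_le b s C m N te N Hb ltac:(lia) ltac:(lia) Hs0 HC Hte) as HB.
        rewrite Et in HB.
        assert (Hl : ln (time_left b N te m) - ln te <= ln (1 + logM b N)).
        { pose proof (logM_nonneg b m Hb ltac:(lia)). pose proof (logM_nonneg b N Hb ltac:(lia)).
          assert (ln (time_left b N te m) <= ln (te * (1 + logM b N))).
          { apply ln_le_compat.
            - pose proof (time_left_ge b N te m Hb ltac:(lia) ltac:(lia)). lra.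
            - unfold time_left. rewrite Nat.min_l by lia.
              assert (1 * logM b N <= te * logM b N) by (apply Rmult_le_compat_r; unfold te; lra). lra. }
          rewrite ln_mult in H1 by lra. lra. }
        assert (s * (ln (time_left b N te m) - ln te) <= s * ln (1 + logM b N)) by mono.
        unfold thr in Hd'. lra. }
      unfold Gsub. rewrite Et. destruct (Rlt_dec 0 y); [|lra].
      rewrite Rmax_left; [rewrite pow_ne_zero by lia; ring|].
      assert (1 <= be * y ^ 2 / te); [|lra]. apply Rdiv_ge_of_mul; [lra|].
      assert (R0 * 1 <= y * y) by (apply Rmult_le_compat; unfold R0 in *; lra).
      assert (be * R0 <= be * y ^ 2) by mono.
      assert (be * R0 = be + te) by (unfold R0; field; lra). lra.
    + apply Rle_lt_trans with (2 := Hr).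
      assert (Hst : c * exp (-1) * (1/2) ^ k <= phi m O)
        by (apply barrier_sub_start with (tau0 := tau0); auto; try lia; unfold te; lra).
      pose proof (pos_INR m).
      assert (- INR m * phi m O <= - INR m * (c * exp (-1) * (1/2) ^ k)) by nra.
      destruct H0 as [H0|H0]; [left; apply exp_increasing, H0 | rewrite H0; lra].
Qed.

Lemma exp_beats_square K A del : 0 <= K -> 0 <= A -> 0 < del ->
  exists x0, 0 <= x0 /\ forall x, x0 <= x -> K * (x + A) ^ 2 <= exp (del * x).
Proof.
  intros HK HA Hd. exists (A + 108 * K / del ^ 3).
  assert (Hd3 : 0 < del ^ 3) by (apply pow_lt; lra).
  assert (H0 : 0 <= 108 * K / del ^ 3) by pos.
  split; [lra|]. intros x Hx.
  assert (He : (del * x / 3) ^ 3 <= exp (del * x)).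
  { replace (exp (del * x)) with (exp (del * x / 3) ^ 3)
      by (simpl; rewrite Rmult_1_r, <- !exp_plus; f_equal; field).
    apply pow_incr. assert (0 <= del * x) by pos.
    pose proof (exp_ineq1_le (del * x / 3)). lra. }
  apply Rle_trans with (2 := He).
  assert (H1 : (x + A) ^ 2 <= (2 * x) ^ 2) by (apply pow_incr; lra).
  assert (H2 : 108 * K <= x * del ^ 3).
  { apply Rle_trans with (108 * K / del ^ 3 * del ^ 3); [right; field; lra|].
    mono. }
  apply Rle_trans with (K * (2 * x) ^ 2); [mono|].
  replace ((del * x / 3) ^ 3) with (x * del ^ 3 * (x ^ 2 / 27)) by field.
  apply Rle_trans with (108 * K * (x ^ 2 / 27)); [right; field|].
  apply Rmult_le_compat_r; [|exact H2]. pose proof (pow2_ge_0 x). lra.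
Qed.

Lemma logM_unbounded b X : 0 < b -> exists n0, (1 <= n0)%nat /\ forall n, (n0 <= n)%nat -> X <= logM b n.
Proof.
  intros Hb. destruct (INR_unbounded (exp ((X + 2 * b ^ 2) / b))) as [n0 Hn0].
  exists (n0 + 1)%nat. split; [lia|]. intros n Hn.
  pose proof (logM_lower b n Hb ltac:(lia)) as H.
  assert (Hl : (X + 2 * b ^ 2) / b <= ln (INR n)).
  { rewrite <- (ln_exp ((X + 2 * b ^ 2) / b)). apply ln_le_compat; [apply exp_pos|].
    assert (INR n0 <= INR n) by (apply le_INR; lia). lra. }
  apply (Rmult_le_compat_l b) in Hl; [|lra].
  replace (b * ((X + 2 * b ^ 2) / b)) with (X + 2 * b ^ 2) in Hl by (field; lra). lra.
Qed.

Lemma kpp_weighted a b n c y X Y : params a b -> (1 <= n)%nat ->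
  kpp n (c * exp (- (y + incr b n - a)) * X) (c * exp (- (y + incr b n)) * Y) =
  c * exp (- y) * (jump_prob b n * (1 - c * exp (- (y + incr b n - a)) * X) * X + (1 - jump_prob b n) * Y).
Proof.
  intros Hab Hn. set (nu := c * exp (- (y + incr b n - a)) * X).
  pose proof (INR_ge_1 n Hn) as Hn1.
  pose proof (tilt_identity a b n y ((1 - nu) * X) Y Hab Hn) as Hid.
  apply (Rmult_eq_reg_l (INR n)); [|lra].
  transitivity (c * (INR n * (exp (- y) * (jump_prob b n * ((1 - nu) * X) + (1 - jump_prob b n) * Y)))); [|ring].
  rewrite <- Hid. unfold kpp. field_simplify; [|lra]. unfold nu. ring.
Qed.

(** * Following a leaf through a time window *)

Section Window.
Variables (a b k0 c2 B : R) (n1 N : nat).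
Hypothesis Hab : params a b.
Hypothesis Hk0 : 0 <= k0.
Hypothesis Hk1 : 128 / a <= exp (2 * k0).
Hypothesis Hn1 : (8 <= n1 <= N)%nat.
Hypothesis Hc2 : 0 <= c2.
Hypothesis Hc2l : c2 * ln (2 + logM b N) ^ 2 <= a ^ 2 / 4096.
Hypothesis Hga : b / INR n1 <= a / 2.
Hypothesis Hgy : b * (2 + logM b N) / INR n1 <= a / (128 * (1 + 1 / a)).

(** On the target the value is 1/2, the largest for which [kpp_mono] holds. It also dominates the
    other formula at every distance at least 1, so a step that lands in the target can only improve
    the inequality. *)
Definition window_sub (n h : nat) : R :=
  let V := logM b (Nat.min n N) - a * INR h in
  if decide (V <= B + 2) then 1/2
  else c2 * exp (- (V - B)) * Uwin k0 (2 + (logM b N - logM b (Nat.min n N))) (V - B).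

Lemma weighted_Uwin_le_half t y : 2 <= t <= 2 + logM b N -> 1 <= y ->
  0 <= c2 * exp (- y) * Uwin k0 t y <= 1/2.
Proof.
  intros Ht Hy. destruct Hab as (Ha & Hb & _).
  pose proof (Uwin_nonneg k0 t y) as HU0. pose proof (Uwin_le k0 t y Hk0 ltac:(lra) Hy) as HU.
  assert (He : 0 < exp (- y) <= 1).
  { split; [apply exp_pos|]. rewrite <- exp_0. left. apply exp_increasing. lra. }
  set (l := ln (2 + logM b N)) in *.
  assert (Hl : ln t <= l) by (apply ln_le_compat; lra).
  assert (Hl2 : 1/2 <= l).
  { apply Rle_trans with (ln 2); [|apply ln_le_compat; lra].
    pose proof ln2_bounds. lra. }
  assert (Ha2 : a ^ 2 <= 1) by (clear - Ha; nra).
  assert (Hcl : c2 * l <= 2 * (c2 * l ^ 2)).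
  { assert (0 <= c2 * l * (2 * l - 1)) by (apply Rmult_le_pos; [apply Rmult_le_pos|]; lra). lra. }
  split; [apply Rmult_le_pos; [apply Rmult_le_pos|]; lra|].
  apply Rle_trans with (c2 * 1 * (l / 2)); [|lra].
  apply Rmult_le_compat; try lra; [pos|]. mono.
Qed.

Lemma window_sub_bounds n h : (1 <= n)%nat -> 0 <= window_sub n h <= 1/2.
Proof.
  intros Hn. destruct Hab as (Ha & Hb & _). unfold window_sub. cbv zeta.
  destruct (decide _) eqn:Ed; [lra|]. apply (proj1 (decide_false _)) in Ed.
  pose proof (logM_le_mono b (Nat.min n N) N Hb ltac:(lia)).
  pose proof (logM_nonneg b (Nat.min n N) Hb ltac:(lia)).
  apply weighted_Uwin_le_half; lra.
Qed.

Lemma window_sub_ge n h : (1 <= n <= N)%nat -> B + 1 <= logM b n - a * INR h ->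
  c2 * exp (- (logM b n - a * INR h - B)) * Uwin k0 (2 + (logM b N - logM b n)) (logM b n - a * INR h - B) <= window_sub n h.
Proof.
  intros Hn HV. destruct Hab as (Ha & Hb & _).
  unfold window_sub. cbv zeta. rewrite Nat.min_l by lia. destruct (decide _); [|lra].
  pose proof (logM_le_mono b n N Hb ltac:(lia)).
  pose proof (logM_nonneg b n Hb ltac:(lia)).
  apply weighted_Uwin_le_half; lra.
Qed.

(** Where [Uwin] vanishes the claim is mere non-negativity. Elsewhere [y] is at most the time left,
    and since [n1] is large compared with log M_N, the product of [incr b n] and [y] is as small as
    [window_step] demands. *)
Lemma window_sub_step n h : (n1 <= n < N)%nat -> ~ logM b n - a * INR h <= B + 2 ->
  window_sub n h <= kpp n (window_sub (S n) (S h)) (window_sub (S n) h).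
Proof.
  intros Hn Hd. pose proof Hab as (Ha & Hb & _ & _).
  set (g := incr b n). set (V := logM b n - a * INR h) in *. set (y := V - B).
  assert (HLL : logM b (S n) = logM b n + g) by (apply logM_S; lia).
  assert (Hg0 : 0 < g) by (apply incr_pos; [assumption|lia]).
  assert (Hgb : g <= b / INR n1).
  { apply Rle_trans with (1 := incr_le b n Hb ltac:(lia)). unfold Rdiv.
    pose proof (INR_ge_1 n1 ltac:(lia)).
    apply Rmult_le_compat_l; [lra|]. apply Rinv_le_contravar; [lra|]. apply le_INR; lia. }
  set (t := 2 + (logM b N - logM b n)).
  pose proof (logM_le_mono b (S n) N Hb ltac:(lia)) as HmS. pose proof (logM_nonneg b n Hb ltac:(lia)) as Hnn.
  assert (Ht : 2 <= t - g <= 2 + logM b N) by (unfold t; lra).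
  assert (Hkpp0 : 0 <= kpp n (window_sub (S n) (S h)) (window_sub (S n) h)).
  { pose proof (window_sub_bounds (S n) (S h) ltac:(lia)). pose proof (window_sub_bounds (S n) h ltac:(lia)).
    apply Rle_trans with (kpp n 0 0); [unfold kpp; lra|]. apply kpp_mono; try lra; lia. }
  assert (E0 : window_sub n h = c2 * exp (- y) * Uwin k0 t y).
  { unfold window_sub. cbv zeta. rewrite Nat.min_l by lia. rewrite (proj2 (decide_false _)) by exact Hd.
    reflexivity. }
  destruct (Req_dec (Uwin k0 t y) 0) as [HU|HU]; [rewrite E0, HU, Rmult_0_r; exact Hkpp0|].
  assert (Hyt : y <= t).
  { assert (Hpos : 0 < ln t / 2 - ln y - k0).
    { apply Rnot_le_lt. intros Hle. apply HU. unfold Uwin. apply Rmax_left. exact Hle. }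
    assert (ln (y * y) < ln t) by (rewrite ln_mult by (unfold y; lra); lra).
    apply Rnot_lt_le. intros Hlt. assert (t <= y * y).
    { assert (1 * y <= y * y) by mono. lra. }
    pose proof (ln_le_compat t (y * y) ltac:(lra) H0). lra. }
  destruct (jump_prob_bounds a b n Hab ltac:(lia)) as [Hp0 Hp].
  assert (Hgy' : g * y <= a / (128 * (1 + 1 / a))).
  { apply Rle_trans with (2 := Hgy). unfold Rdiv at 1. rewrite (Rmult_assoc b), (Rmult_comm _ (/ INR n1)), <- Rmult_assoc.
    apply Rmult_le_compat; try lra. unfold y; lra. unfold t in *; lra. }
  assert (Hlt : c2 * ln t ^ 2 <= a ^ 2 / 4096).
  { apply Rle_trans with (2 := Hc2l). apply Rmult_le_compat_l; [lra|]. apply pow_incr.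
    split; [apply ln_nonneg; lra|]. apply ln_le_compat; unfold t in *; lra. }
  pose proof (window_step a k0 c2 t g (jump_prob b n) y ltac:(lra) Hk0 Hk1 Hc2 ltac:(unfold y; lra) ltac:(lra)
     ltac:(lra) Hgy' Hlt Hp Hp0) as HS. cbv zeta in HS.
  pose proof (window_sub_ge (S n) (S h) ltac:(lia)) as Hj. pose proof (window_sub_ge (S n) h ltac:(lia)) as H1.
  rewrite S_INR in Hj at 1. rewrite HLL in Hj, H1.
  replace (logM b n + g - a * INR (S h) - B) with (y + g - a) in Hj by (unfold y, V; rewrite S_INR; ring).
  replace (logM b n + g - a * INR h - B) with (y + g) in H1 by (unfold y, V; ring).
  replace (2 + (logM b N - (logM b n + g))) with (t - g) in Hj, H1 by (unfold t; ring).
  unfold V in Hd. specialize (Hj ltac:(lra)). specialize (H1 ltac:(lra)).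
  rewrite E0.
  apply Rle_trans with (kpp n (c2 * exp (- (y + g - a)) * Uwin k0 (t - g) (y + g - a))
     (c2 * exp (- (y + g)) * Uwin k0 (t - g) (y + g))).
  - unfold g. rewrite kpp_weighted by (auto; lia). apply Rmult_le_compat_l; [|exact HS].
    apply Rmult_le_pos; [lra|left; apply exp_pos].
  - apply kpp_mono; [lia|exact Hj|apply window_sub_bounds; lia|exact H1].
Qed.

Lemma window_sub_end h : ~ logM b N - a * INR h <= B + 2 -> window_sub N h = 0.
Proof.
  intros Hd. unfold window_sub. cbv zeta. rewrite Nat.min_id. rewrite (proj2 (decide_false _)) by exact Hd.
  unfold Uwin. rewrite Rmax_left; [ring|].
  replace (2 + (logM b N - logM b N)) with 2 by ring.
  pose proof (ln_le_compat 2 (logM b N - a * INR h - B)). pose proof (ln_nonneg 2). lra.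
Qed.
End Window.

(** With N a fixed power of [n1], the window is a fixed multiple of log M at its start; [A] is
    chosen before [n1], so ln A is a constant for the later matching. Taking n1 = p^2 makes the
    smallness of (log n1)/n1 elementary, as ln n1 <= 2 p. *)
Lemma window_times b M kap : 0 < b -> 0 <= M -> 0 < kap ->
  exists A, 1 <= A /\ forall X nmin, exists n1 N : nat, (nmin <= n1 <= N)%nat /\ X <= logM b n1 /\
   1 <= logM b n1 /\ M * logM b n1 <= 2 + (logM b N - logM b n1) /\ 2 + logM b N <= A * logM b n1 /\
   b * (2 + logM b N) / INR n1 <= kap /\ b / INR n1 <= kap.
Proof.
  intros Hb HM Hkap.
  destruct (INR_unbounded (M + 2)) as [M' HM'].
  set (m := INR M') in *.
  assert (Hb2 : 0 < b ^ 2) by pos.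
  exists (2 + b + m * (1 + 2 * b ^ 2)).
  assert (HA : 0 < m * (1 + 2 * b ^ 2)) by pos.
  split; [lra|]. intros X nmin.
  set (A := 2 + b + m * (1 + 2 * b ^ 2)) in *.
  assert (HA1 : 1 <= A) by (unfold A; lra).
  destruct (logM_unbounded b (Rmax X (1 + m * b + 2 * b ^ 2)) Hb) as (n0 & Hn0 & HX).
  destruct (INR_unbounded (3 * A * b * (b + 1) / kap + b / kap)) as [p0 Hp0].
  set (p := (p0 + n0 + nmin + 1)%nat). set (n1 := (p * p)%nat).
  assert (Hn1p : (p <= n1)%nat) by (unfold n1; nia).
  exists n1, (n1 ^ M')%nat.
  assert (HM'1 : (1 <= M')%nat) by (destruct M'; [unfold m in HM'; simpl in HM'; lra|lia]).
  assert (HN : (n1 <= n1 ^ M')%nat).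
  { rewrite <- (Nat.pow_1_r n1) at 1. apply Nat.pow_le_mono_r; lia. }
  assert (HTX : X <= logM b n1 /\ 1 + m * b + 2 * b ^ 2 <= logM b n1).
  { pose proof (HX n1 ltac:(lia)). pose proof (Rmax_l X (1 + m * b + 2 * b ^ 2)).
    pose proof (Rmax_r X (1 + m * b + 2 * b ^ 2)). lra. }
  set (T := logM b n1) in *.
  assert (Hmb : 0 < m * b) by pos.
  assert (Hn1 : 1 <= INR n1) by (apply INR_ge_1; lia).
  pose proof (logM_upper b n1 Hb ltac:(lia)) as HTu. pose proof (logM_lower b n1 Hb ltac:(lia)) as HTl. fold T in HTu, HTl.
  pose proof (logM_upper b (n1 ^ M') Hb ltac:(lia)) as HNu. pose proof (logM_lower b (n1 ^ M') Hb ltac:(lia)) as HNl.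
  rewrite pow_INR, ln_pow in HNu, HNl by lra. fold m in HNu, HNl.
  set (LN := logM b (n1 ^ M')) in *.
  set (l := ln (INR n1)) in *.
  assert (Hlo : M * T <= 2 + (LN - T)).
  { assert (H1 : m * (T - b) <= m * (b * l)) by mono.
    assert ((M + 2) * T <= m * T) by mono. lra. }
  assert (Hup : 2 + LN <= A * T).
  { assert (H1 : m * (b * l) <= m * (T + 2 * b ^ 2)) by mono.
    assert (H2 : (2 + b) * 1 <= (2 + b) * T) by mono.
    assert (H3 : m * (T + 2 * b ^ 2) <= m * (1 + 2 * b ^ 2) * T).
    { rewrite Rmult_assoc. apply Rmult_le_compat_l; [lra|].
      assert (2 * b ^ 2 * 1 <= 2 * b ^ 2 * T) by mono. lra. }
    unfold A. lra. }
  assert (Hpr : 1 <= INR p) by (apply INR_ge_1; lia).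
  assert (Hp0p : 3 * A * b * (b + 1) / kap + b / kap <= INR p).
  { assert (INR p0 <= INR p) by (apply le_INR; unfold p; lia). lra. }
  assert (HbA : 0 < A * b) by pos.
  assert (HbA2 : 0 < 3 * A * b * (b + 1)) by pos.
  assert (Hq1 : 0 < 3 * A * b * (b + 1) / kap) by pos.
  assert (Hq2 : 0 < b / kap) by pos.
  assert (Hn1r : INR n1 = INR p * INR p) by (unfold n1; apply mult_INR).
  split; [split; [unfold n1, p in *; nia|exact HN]|]. split; [lra|]. split; [lra|]. split; [exact Hlo|].
  split; [exact Hup|]. split.
  - apply Rdiv_le_of_mul; [lra|].
    assert (Hl : l <= 2 * INR p).
    { unfold l. rewrite Hn1r, ln_mult by lra. pose proof (ln_le_minus_one (INR p)). lra. }
    assert (H1 : b * (2 + LN) <= b * (A * (b * (2 * INR p) + b))).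
    { apply Rmult_le_compat_l; [lra|]. apply Rle_trans with (1 := Hup). apply Rmult_le_compat_l; [lra|].
      assert (b * l <= b * (2 * INR p)) by mono. lra. }
    assert (H2 : b * (A * (b * (2 * INR p) + b)) <= 3 * A * b * (b + 1) * INR p).
    { assert (b * (2 * INR p) + b <= 3 * (b + 1) * INR p).
      { assert (b * 1 <= b * INR p) by mono.
        lra. }
      assert (A * b * (b * (2 * INR p) + b) <= A * b * (3 * (b + 1) * INR p)) by mono.
      lra. }
    assert (H3 : 3 * A * b * (b + 1) <= kap * INR p).
    { apply Rle_trans with (kap * (3 * A * b * (b + 1) / kap)); [right; field; lra|].
      mono. }
    rewrite Hn1r, <- Rmult_assoc.
    apply Rle_trans with (3 * A * b * (b + 1) * INR p); [lra|]. mono.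
  - apply Rdiv_le_of_mul; [lra|].
    apply Rle_trans with (kap * (b / kap)); [right; field; lra|]. apply Rmult_le_compat_l; [lra|].
    rewrite Hn1r. assert (1 * INR p <= INR p * INR p) by mono. lra.
Qed.

Lemma Rpower_le_of_sq_lt y Z rho : 0 < y -> 0 < rho -> y ^ 2 <= Z -> Rpower y rho <= Rpower Z (rho / 2).
Proof.
  intros Hy Hr H. assert (Hy2 : 0 < y ^ 2) by (apply pow_lt; lra).
  pose proof (ln_le_compat (y ^ 2) Z Hy2 H) as Hl. replace (y ^ 2) with (y * y) in Hl by ring.
  rewrite ln_mult in Hl by lra. unfold Rpower.
  assert (Hle : rho * ln y <= rho / 2 * ln Z) by nra.
  destruct Hle as [Hlt|Heq]; [left; apply exp_increasing, Hlt | rewrite Heq; lra].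
Qed.

(** The first phase ends at [n1] with the time shift [T] equal to log M at [n1]. The time left then
    changes at most by the factor 2, and the barrier stays below the constant [B1]. At [n1] the
    first function is at most of order exp (-V) T^(rho/2), since y^2 <= T/be on its support, and the
    window function is at least of order exp (-V) exp B / (log T)^2 outside the target. Hence B =
    (1/2 + e/2) log T suffices. *)
Theorem window_hit a b e d nmin : params a b -> 0 < e -> 0 < d ->
  outer_le (fun w => forall n u, (nmin <= n)%nat -> In u (bst_leaves n w) ->
    (1/2 + e) * ln (logM b n) < logM b n - a * INR (length u)) d.
Proof.
  intros Hab He Hd. pose proof Hab as (Ha & Hb & _ & _).
  set (eps := Rmin (1/2) (e / 4)).
  assert (Heps : 0 < eps <= 1/2) by (unfold eps; split; [apply Rmin_glb_lt; lra|apply Rmin_l]).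
  assert (Hepse : eps <= e / 4) by apply Rmin_r.
  destruct (sub_step a eps ltac:(lra) Heps) as (k & be & c & C & tau0 & g0 & Hk & Hbe & Hc & HC & Htau0 & Hg0 & Hstep).
  set (rho := 1 + eps) in *. set (s := 3/2 + 3 * eps) in *.
  destruct (nat_ge_div b g0 Hb ltac:(lra)) as (m0 & Hm08 & Hm0).
  set (c' := c * exp (-1) * (1/2) ^ k).
  assert (Hc' : 0 < c').
  { unfold c'. apply Rmult_lt_0_compat; [apply Rmult_lt_0_compat; [lra|apply exp_pos]|apply pow_lt; lra]. }
  destruct (INR_unbounded (1 / d / c')) as [m1 Hm1].
  set (m := (m0 + m1)%nat).
  assert (Hmd : exp (- INR m * c') < d).
  { assert (INR m1 <= INR m) by (apply le_INR; unfold m; lia).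
    assert (Hlt : 1 / d < INR m * c').
    { apply Rlt_le_trans with (INR m1 * c').
      - apply (Rmult_lt_compat_r c') in Hm1; [|lra].
        replace (1 / d / c' * c') with (1 / d) in Hm1 by (field; lra). exact Hm1.
      - mono. }
    replace (- INR m * c') with (- (INR m * c')) by ring. rewrite exp_Ropp.
    pose proof (exp_ineq1_le (INR m * c')). pose proof (exp_pos (INR m * c')).
    rewrite <- (Rinv_inv d). apply Rinv_lt_contravar.
    - apply Rmult_lt_0_compat; [apply Rinv_0_lt_compat|]; lra.
    - unfold Rdiv in Hlt. lra. }
  destruct (exists_large [0; ln (128 / a) / 2]) as (k0 & Hk0l).
  assert (Hk0 : 0 <= k0) by (apply Hk0l; simpl; auto).
  assert (Hk1 : 128 / a <= exp (2 * k0)).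
  { assert (H : ln (128 / a) / 2 <= k0) by (apply Hk0l; simpl; auto).
    assert (0 < 128 / a) by pos.
    rewrite <- (exp_ln (128 / a)) by lra. apply exp_le_compat. lra. }
  assert (Hia : 0 < 1 / a) by pos.
  set (kap := a / (128 * (1 + 1 / a))).
  assert (Hkap : 0 < kap) by pos.
  assert (Hkapa : kap <= a / 2) by (unfold kap; apply Rdiv_le_of_mul; [lra|];
    assert (0 < a * (1 / a)) by pos; lra).
  (* A window [M] times as long as [T] makes [Uwin] at least 1 on the whole support of the first
     function at time [n1]. *)
  set (M := exp (2 * k0 + 2) / be).
  assert (HM : 0 < M) by (unfold M; apply Rdiv_lt_0_compat; [apply exp_pos|lra]).
  destruct (window_times b M kap Hb (Rlt_le _ _ HM) Hkap) as (A & HA & Hwin).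
  set (B1 := logM b m + s * ln 2 + C * (2 * b ^ 2)).
  assert (HB10 : 0 <= B1).
  { unfold B1. pose proof (logM_nonneg b m Hb ltac:(lia)). pose proof (ln_nonneg 2 ltac:(lra)).
    assert (0 <= s * ln 2) by (apply Rmult_le_pos; unfold s; lra).
    assert (0 <= C * (2 * b ^ 2)) by (apply Rmult_le_pos; [lra|]; pose proof (pow2_ge_0 b); lra). lra. }
  (* [Kc (x + ln A)^2 <= exp (e x / 4)] makes the two phases match at time [n1]. *)
  set (Kc := c * exp B1 * Rpower (/ be) (rho / 2) * 4096 / a ^ 2).
  assert (Ha2 : 0 < a ^ 2) by pos.
  assert (HKc : 0 <= Kc).
  { unfold Kc. apply Rdiv_ge_of_mul; [lra|]. rewrite Rmult_0_l.
    apply Rmult_le_pos; [|lra]. repeat apply Rmult_le_pos; try lra; left; apply exp_pos. }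
  assert (HlA : 0 <= ln A) by (apply ln_nonneg; lra).
  destruct (exp_beats_square Kc (ln A) (e / 4) HKc HlA ltac:(lra)) as (x0 & Hx0 & Hx).
  destruct (exists_large [x0; B1 / (1/2); 2 / (e / 2); ln (tau0 + 2 * be)]) as (xm & Hxm).
  assert (Hxm1 : x0 <= xm) by (apply Hxm; simpl; auto).
  assert (Hxm2 : B1 / (1/2) <= xm) by (apply Hxm; simpl; auto).
  assert (Hxm3 : 2 / (e / 2) <= xm) by (apply Hxm; simpl; auto).
  assert (Hxm4 : ln (tau0 + 2 * be) <= xm) by (apply Hxm; simpl; auto).
  destruct (Hwin (exp xm) (m + 1 + nmin)%nat) as (n1 & N & Hn1 & HXT & HT1 & HMT & HNA & Hg1 & Hg2).
  set (T := logM b n1) in *. set (x := ln T).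
  assert (Hxx : xm <= x).
  { unfold x. rewrite <- (ln_exp xm). apply ln_le_compat; [apply exp_pos|exact HXT]. }
  assert (HTx : T = exp x) by (unfold x; rewrite exp_ln; lra).
  specialize (Hx x ltac:(lra)).
  set (B := (1/2 + e / 2) * x).
  assert (HBB1 : B1 <= B).
  { unfold B. assert (0 <= e / 2 * x) by pos. lra. }
  assert (HBe : B + 2 <= (1/2 + e) * x).
  { unfold B. assert (2 <= x * (e / 2)).
    { apply Rle_trans with (2 / (e / 2) * (e / 2)); [right; field; lra|]. mono. } lra. }
  assert (HTt : tau0 + 2 * be <= T).
  { rewrite HTx. rewrite <- (exp_ln (tau0 + 2 * be)) by lra. apply exp_le_compat. lra. }
  set (l := ln (2 + logM b N)).
  pose proof (logM_le_mono b n1 N Hb ltac:(lia)) as HTN. fold T in HTN.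
  assert (Hl0 : 0 < l) by (unfold l; rewrite <- ln_1; apply ln_increasing; lra).
  assert (Hl : l <= x + ln A).
  { unfold l, x. rewrite <- ln_mult by lra. apply ln_le_compat; lra. }
  (* The largest constant that the window estimates allow. It costs the factor l^2, of order (log
     T)^2, which the choice of [x0] has provided for. *)
  set (c2 := a ^ 2 / 4096 / l ^ 2).
  assert (Hl2 : 0 < l ^ 2) by pos.
  assert (Hc2 : 0 < c2) by pos.
  assert (Hc2l : c2 * l ^ 2 <= a ^ 2 / 4096) by (unfold c2; right; field; lra).
  set (ph1 := barrier_sub k be c a b rho s C m n1 T).
  set (ph2 := window_sub a b k0 c2 B N).
  set (phi := fun n h => if (n <? n1)%nat then ph1 n h else ph2 n h).
  set (D := fun n h : nat => (n1 <= n)%nat /\ logM b n - a * INR h <= B + 2).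
  assert (Hb1 : forall n h, 0 <= ph1 n h <= 1/2).
  { intros n h. apply barrier_sub_bounds with (tau0 := tau0); auto; try lia; lra. }
  assert (Hb2 : forall n h, (1 <= n)%nat -> 0 <= ph2 n h <= 1/2).
  { intros n h Hn. apply window_sub_bounds with (n1 := n1); auto; try lia; lra. }
  assert (Hmatch : forall h, ph1 n1 h <= ph2 n1 h).
  { intros h. unfold ph2, window_sub. cbv zeta. rewrite Nat.min_l by lia. fold T.
    destruct (decide (T - a * INR h <= B + 2)) eqn:Ed; [apply Hb1|].
    apply (proj1 (decide_false _)) in Ed.
    unfold ph1, barrier_sub. set (y := gap a b s C m n1 T n1 h).
    assert (Et : time_left b n1 T n1 = T) by (unfold time_left; rewrite Nat.min_id; ring).
    rewrite Et.
    set (y2 := T - a * INR h - B) in *.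
    assert (Hbar : barrier b s C m n1 T n1 <= B1).
    { apply Rle_trans with (1 := barrier_le b s C m n1 T n1 Hb ltac:(lia) ltac:(lia) ltac:(unfold s; lra) HC ltac:(lra)).
      rewrite Et.
      assert (ln (time_left b n1 T m) <= ln (T * 2)).
      { apply ln_le_compat; [pose proof (time_left_ge b n1 T m Hb ltac:(lia) ltac:(lia)); lra|].
        unfold time_left. rewrite Nat.min_l by lia. pose proof (logM_nonneg b m Hb ltac:(lia)). fold T. lra. }
      rewrite ln_mult in H by lra.
      assert (s * (ln (time_left b n1 T m) - ln T) <= s * ln 2) by (apply Rmult_le_compat_l; [unfold s|]; lra).
      unfold B1. lra. }
    assert (Hyy : y = T - a * INR h - barrier b s C m n1 T n1) by (unfold y, gap; rewrite Nat.min_id; reflexivity).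
    assert (Hrhs : 0 <= c2 * exp (- y2) * Uwin k0 (2 + (logM b N - T)) y2).
    { apply Rmult_le_pos; [apply Rmult_le_pos; [lra|left; apply exp_pos]|apply Uwin_nonneg]. }
    destruct (Rlt_dec (be * y ^ 2) T) as [Hin|Hout].
    2: { replace (Gsub k be rho T y) with 0; [rewrite Rmult_0_r; exact Hrhs|].
      unfold Gsub. destruct (Rlt_dec 0 y); [|reflexivity].
      rewrite Rmax_left; [rewrite pow_ne_zero by lia; ring|].
      assert (1 <= be * y ^ 2 / T) by pos. lra. }
    assert (HyZ : y ^ 2 <= T / be) by pos.
    assert (HG : Gsub k be rho T y <= Rpower (T / be) (rho / 2)).
    { apply Rle_trans with (Rpower y rho); [apply Gsub_le; lra|].
      apply Rpower_le_of_sq_lt; try lra. unfold rho; lra. }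
    assert (HU : 1 <= Uwin k0 (2 + (logM b N - T)) y2).
    { apply Rle_trans with (2 := Rmax_r _ _).
      assert (Hly : ln y2 <= ln y) by (apply ln_le_compat; unfold y2 in *; lra).
      assert (Hly2 : 2 * ln y <= ln (T / be)).
      { pose proof (ln_le_compat (y ^ 2) (T / be) ltac:(apply pow_lt; lra) HyZ) as H.
        replace (y ^ 2) with (y * y) in H by ring. rewrite ln_mult in H by lra. lra. }
      assert (Hlt : ln (T / be) + (2 * k0 + 2) <= ln (2 + (logM b N - T))).
      { rewrite <- (ln_exp (2 * k0 + 2)), <- ln_mult; [|pos|apply exp_pos].
        apply ln_le_compat; [apply Rmult_lt_0_compat; [pos|apply exp_pos]|].
        apply Rle_trans with (2 := HMT). right. unfold M. field. lra. }
      lra. }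
    apply Rle_trans with (c2 * exp (- y2) * 1).
    2: { apply Rmult_le_compat_l; [apply Rmult_le_pos; [lra|left; apply exp_pos]|exact HU]. }
    apply Rle_trans with (c * exp (- y) * Rpower (T / be) (rho / 2)).
    { apply Rmult_le_compat_l; [apply Rmult_le_pos; [lra|left; apply exp_pos]|exact HG]. }
    set (v := T - a * INR h) in *.
    assert (Hey : exp (- y) <= exp (- v) * exp B1) by (rewrite <- exp_plus; apply exp_le_compat; lra).
    assert (Hey2 : exp (- y2) = exp (- v) * exp B) by (rewrite <- exp_plus; f_equal; unfold y2; ring).
    assert (HRp : Rpower (T / be) (rho / 2) = exp (rho / 2 * x) * Rpower (/ be) (rho / 2)).
    { unfold Rdiv at 1. rewrite <- Rpower_mult_distr by (try apply Rinv_0_lt_compat; lra). reflexivity. }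
    rewrite HRp, Hey2.
    pose proof (exp_pos (- v)) as Hev. pose proof (exp_pos (rho / 2 * x)) as Hex.
    pose proof (exp_pos (rho / 2 * ln (/ be))) as Hrb. fold (Rpower (/ be) (rho / 2)) in Hrb.
    apply Rle_trans with (c * (exp (- v) * exp B1) * (exp (rho / 2 * x) * Rpower (/ be) (rho / 2))).
    { apply Rmult_le_compat_r; [pos|]. mono. }
    replace (c * (exp (- v) * exp B1) * (exp (rho / 2 * x) * Rpower (/ be) (rho / 2)))
      with (exp (- v) * (a ^ 2 / 4096) * (Kc * exp (rho / 2 * x))) by (unfold Kc; field; lra).
    replace (c2 * (exp (- v) * exp B) * 1) with (exp (- v) * (a ^ 2 / 4096) * (exp B / l ^ 2))
      by (unfold c2; field; lra).
    apply Rmult_le_compat_l; [pos|].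
    apply Rdiv_ge_of_mul; [lra|].
    assert (HKl : Kc * l ^ 2 <= exp (e / 4 * x)).
    { apply Rle_trans with (2 := Hx). apply Rmult_le_compat_l; [lra|]. apply pow_incr; lra. }
    replace (Kc * exp (rho / 2 * x) * l ^ 2) with (Kc * l ^ 2 * exp (rho / 2 * x)) by ring.
    apply Rle_trans with (exp (e / 4 * x) * exp (rho / 2 * x)); [mono|].
    rewrite <- exp_plus. apply exp_le_compat. unfold B, rho.
    assert (0 <= x * (e / 4 - eps / 2)) by pos. lra. }
  apply outer_mono with (fun w => forall n u, (m <= n <= N)%nat -> In u (bst_leaves n w) -> ~ D n (length u)) d;
    [|lra|].
  - intros w _ H n u Hn Hu [Hn1n Hdd]. specialize (H n u ltac:(lia) Hu).
    assert (x <= ln (logM b n)).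
    { unfold x. apply ln_le_compat; [lra|]. apply logM_le_mono; [lra|lia]. }
    assert ((1/2 + e) * x <= (1/2 + e) * ln (logM b n)) by mono. lra.
  - apply kpp_lower_bound with (fun n h => if (n <=? 0)%nat then 0 else phi n h).
    + lia.
    + intros n h. destruct (Nat.leb_spec n 0); [lra|]. unfold phi.
      destruct (n <? n1)%nat; [apply Hb1 | apply Hb2; lia].
    + intros n h h' _ Hh [Hn Hdd]. split; [exact Hn|]. apply le_INR in Hh.
      assert (a * INR h <= a * INR h') by mono. lra.
    + intros n h Hn Hdd. destruct (Nat.leb_spec n 0); [lia|]. destruct (Nat.leb_spec (S n) 0); [lia|].
      unfold phi. destruct (Nat.ltb_spec n n1) as [Hlt|Hge].
      * assert (Hs1 : ph1 n h <= kpp n (ph1 (S n) (S h)) (ph1 (S n) h)).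
        { apply (barrier_sub_step a b eps k be c C tau0 g0); auto; try lia; try lra. apply Hm0; unfold m; lia. }
        destruct (Nat.ltb_spec (S n) n1) as [Hlt2|Hge2]; [exact Hs1|].
        assert (En : S n = n1) by lia. apply Rle_trans with (1 := Hs1).
        apply kpp_mono; [lia|rewrite En; apply Hmatch|apply Hb2; lia|rewrite En; apply Hmatch].
      * destruct (Nat.ltb_spec (S n) n1); [lia|].
        apply window_sub_step with (n1 := n1); auto; try lia; try lra.
        intros Hle. apply Hdd. split; [lia|exact Hle].
    + intros h Hdd. destruct (Nat.leb_spec N 0); [lia|]. unfold phi.
      destruct (Nat.ltb_spec N n1); [lia|]. apply window_sub_end; [exact Hk0|].
      intros Hle. apply Hdd. split; [lia|exact Hle].
    + apply Rle_lt_trans with (2 := Hmd). destruct (Nat.leb_spec m 0); [lia|]. unfold phi.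
      destruct (Nat.ltb_spec m n1); [|lia].
      assert (Hst : c' <= ph1 m O) by (apply barrier_sub_start with (tau0 := tau0); auto; try lia; lra).
      pose proof (pos_INR m). apply exp_le_compat. nra.
Qed.

(** The maximal inequality for the additive martingale exp (-V) scaled by exp (-A), which is also
    its initial value. *)
Lemma never_below a b A r : params a b -> exp (- A) < r ->
  outer_le (fun w => exists n u, (1 <= n)%nat /\ In u (bst_leaves n w) /\
     logM b n - a * INR (length u) <= - A) r.
Proof.
  intros Hab Hr.
  set (f := fun n h => exp (- A) * exp (- (logM b n - a * INR h))).
  apply outer_mono with (fun w => exists n u, (1 <= n)%nat /\ In u (bst_leaves n w) /\ 1 <= f n (length u)) r;
    [|lra|].
  - intros w _ (n & u & Hn & Hu & H). exists n, u. split; [exact Hn|]. split; [exact Hu|].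
    unfold f. rewrite <- exp_plus, <- exp_0. apply exp_le_compat. lra.
  - apply maximal_inequality.
    + intros n h. apply Rmult_le_pos; left; apply exp_pos.
    + intros n h Hn. unfold f. right.
      pose proof (tilt_identity a b n (logM b n - a * INR h) 1 1 Hab Hn) as H.
      rewrite logM_S by exact Hn. rewrite S_INR.
      replace (logM b n + incr b n - a * INR h) with (logM b n - a * INR h + incr b n) by ring.
      replace (logM b n + incr b n - a * (INR h + 1)) with (logM b n - a * INR h + incr b n - a) by ring.
      rewrite !Rmult_1_r in H. replace (jump_prob b n + (1 - jump_prob b n)) with 1 in H by ring.
      rewrite Rmult_1_r in H.
      transitivity (exp (- A) * ((INR n - 1) * exp (- (logM b n - a * INR h + incr b n)) +
        2 * exp (- (logM b n - a * INR h + incr b n - a)))); [ring|]. rewrite H. ring.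
    + unfold f. rewrite logM_1. simpl. rewrite Rmult_0_r, Rminus_0_r, Ropp_0, exp_0. lra.
Qed.

Lemma Fsup_pos k a s tau y : (1 <= k)%nat -> 0 < a -> 0 < tau -> 0 <= y -> 0 <= Fsup k a s tau y.
Proof.
  intros Hk Ha Ht Hy. pose proof (INR_ge_1 k Hk). unfold Fsup. apply Rdiv_ge_of_mul.
  - apply pow_lt. assert (0 <= y ^ 2 / (2 * INR k * a)); [|lra].
    apply Rdiv_ge_of_mul; [pos|]. pose proof (pow2_ge_0 y). lra.
  - rewrite Rmult_0_l. apply Rmult_le_pos; [lra|left; apply exp_pos].
Qed.

Lemma Fsup_upper k a s tau y : (1 <= k)%nat -> 0 < a -> 0 < tau -> 0 <= y ->
  Fsup k a s tau y <= y * Rpower tau (- s).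
Proof.
  intros Hk Ha Ht Hy. pose proof (INR_ge_1 k Hk). unfold Fsup.
  assert (Hz : 0 <= y ^ 2 / (2 * INR k * a)).
  { apply Rdiv_ge_of_mul; [pos|]. pose proof (pow2_ge_0 y). lra. }
  assert (E : Rpower tau (INR k - s) = tau ^ k * Rpower tau (- s)).
  { rewrite <- Rpower_pow by lra. rewrite <- Rpower_plus. reflexivity. }
  rewrite E. apply Rdiv_le_of_mul; [apply pow_lt; lra|].
  replace (y * (tau ^ k * Rpower tau (- s))) with (y * Rpower tau (- s) * tau ^ k) by ring.
  apply Rmult_le_compat_l; [apply Rmult_le_pos; [lra|left; apply exp_pos]|].
  apply pow_incr. lra.
Qed.

(* Away from the event that some path falls below [- A], the first moment gives the correct
   order [(log N)^(z/log log N - 3/2)]. *)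
Theorem min_lower_tail a b eps : params a b -> 0 < eps <= 1/2 ->
  exists k : nat, forall A, 0 <= A -> exists Q, 0 < Q /\
  forall N z r, (1 <= N)%nat -> 0 <= z ->
  Q * exp z * ((1 + z) ^ 2) ^ k * Rpower (1 + logM b N) (- (3/2 - eps)) < r ->
  outer_le (fun w =>
    (forall n u, (1 <= n <= N)%nat -> In u (bst_leaves n w) -> ~ logM b n - a * INR (length u) <= - A) /\
    exists u, In u (bst_leaves N w) /\ logM b N - a * INR (length u) <= z) r.
Proof.
  intros Hab Heps. pose proof Hab as (Ha & Hb & _ & _).
  destruct (super_step a eps b ltac:(lra) Heps Hb) as (k & K & tau0 & C & Hk & HK & Htau0 & HC & Hstep).
  set (s := 3/2 - eps) in *.
  exists k. intros A HA.
  assert (Hk2 : 2 <= INR k) by (change 2 with (INR 2); apply le_INR; exact Hk).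
  set (be := 1 / (2 * INR k * a)).
  assert (Hka : 0 < 2 * INR k * a) by pos.
  assert (Hbe : 0 < be) by pos.
  set (Q2 := tau0 + be * (1 + A + K) ^ 2).
  assert (HQ2 : 0 < Q2) by (unfold Q2; pose proof (Rmult_le_pos be _ (Rlt_le _ _ Hbe) (pow2_ge_0 (1 + A + K))); lra).
  exists (exp (C * (2 * b ^ 2)) * (A + K) * Q2 ^ k).
  assert (HQ2k : 0 < Q2 ^ k) by (apply pow_lt; lra).
  split; [apply Rmult_lt_0_compat; [apply Rmult_lt_0_compat; [apply exp_pos|lra]|lra]|].
  intros N z r HN Hz Hr.
  (* Normalisation at the target: exp z compensates exp (-V), the second factor compensates [Rn],
     and the power is the inverse of a lower bound for [Fsup] at time left [tau0]. So [f] is at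
     least 1 there. *)
  set (kap := exp z * exp (C * (2 * b ^ 2)) * (Q2 * (1 + z) ^ 2) ^ k).
  assert (HQz : 0 < (Q2 * (1 + z) ^ 2) ^ k).
  { apply pow_lt. apply Rmult_lt_0_compat; [lra|apply pow_lt; lra]. }
  assert (Hkap : 0 < kap) by (unfold kap; repeat apply Rmult_lt_0_compat; try apply exp_pos; exact HQz).
  (* A discount that cancels the errors exp (C g^2) of [super_step]; by [incr_sq_sum] it stays
     bounded away from 0. *)
  set (Rn := fun n => exp (- (C * rsum (fun j => incr b j ^ 2) (seq 1 (n - 1))))).
  set (V := fun n h => logM b n - a * INR h).
  set (tn := fun n => tau0 + (logM b N - logM b (Nat.min n N))).
  set (ff := fun n h => kap * exp (- V n h) * Rn n * Fsup k a s (tn n) (V n h + A + K)).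
  (* Below the killing level [ff] may be negative, hence the cut to 0. A leaf that has just jumped
     across still has a non-negative argument, so [f <= ff] holds at both successors. *)
  set (f := fun n h => if decide (V n h <= - A \/ n = O) then 0 else ff n h).
  assert (Htn : forall n, tau0 <= tn n).
  { intros n. unfold tn. destruct (Nat.eq_dec n 0) as [->|Hn0].
    - rewrite Nat.min_0_l. pose proof (logM_nonneg b N Hb HN). unfold logM at 2; simpl; lra.
    - pose proof (logM_le_mono b (Nat.min n N) N Hb ltac:(lia)). lra. }
  assert (Hff : forall n h, 0 <= V n h + A + K -> 0 <= ff n h).
  { intros n h Hy. unfold ff. apply Rmult_le_pos.
    - apply Rmult_le_pos; [apply Rmult_le_pos; [lra|left; apply exp_pos]|left; apply exp_pos].
    - apply Fsup_pos; [lia|lra| |exact Hy]. specialize (Htn n). lra. }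
  assert (Hf : forall n h, 0 <= f n h).
  { intros n h. unfold f. destruct (decide _) eqn:Ed; [lra|].
    apply (proj1 (decide_false _)) in Ed. apply Hff.
    destruct (Rle_dec (V n h) (- A)); [exfalso; apply Ed; auto|lra]. }
  assert (Hfle : forall n h, 0 <= V n h + A + K -> f n h <= ff n h).
  { intros n h Hy. unfold f. destruct (decide _); [apply Hff, Hy|lra]. }
  apply first_moment_bound with (f := f) (cross := fun n h => V n h <= - A) (tgt := fun h => V N h <= z).
  - exact HN.
  - exact Hf.
  - intros n h Hn Hcr. cbv beta in Hcr.
    assert (Hfn : f n h = ff n h).
    { unfold f. rewrite (proj2 (decide_false _)); [reflexivity|]. intros [H|H]; [contradiction|lia]. }
    set (g := incr b n). set (y := V n h + A + K). set (v := V n h) in *.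
    assert (Hy : K <= y) by (unfold y; lra).
    assert (E1 : V (S n) h = v + g) by (unfold V, v; rewrite logM_S by lia; unfold g, V; ring).
    assert (Ej : V (S n) (S h) = v + g - a).
    { unfold V at 1. rewrite logM_S by lia. rewrite S_INR. unfold v, g, V. ring. }
    assert (Et : tn (S n) = tn n - g).
    { unfold tn. rewrite !Nat.min_l by lia. rewrite logM_S by lia. unfold g. ring. }
    assert (Hg0 : 0 < g) by (apply incr_pos; [exact Hb|lia]).
    assert (Hgb : g <= b).
    { apply Rle_trans with (1 := incr_le b n Hb ltac:(lia)). pose proof (INR_ge_1 n ltac:(lia)).
      apply Rdiv_le_of_mul; [lra|]. rewrite <- (Rmult_1_r b) at 1. mono. }
    assert (ER : Rn (S n) = Rn n * exp (- (C * g ^ 2))).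
    { unfold Rn. replace (S n - 1)%nat with (S (n - 1)) by lia. rewrite seq_S, rsum_app.
      replace (1 + (n - 1))%nat with n by lia. rewrite <- exp_plus. f_equal. cbn [rsum fold_right].
      fold g. ring. }
    destruct (jump_prob_bounds a b n Hab ltac:(lia)) as [Hp0 Hp].
    pose proof (Htn (S n)) as HtS. rewrite Et in HtS.
    pose proof (Hstep (tn n) g (jump_prob b n) y ltac:(lra) HtS Hy Hp0 Hp) as HS.
    pose proof (INR_ge_1 n ltac:(lia)) as Hn1.
    set (Fj := Fsup k a s (tn n - g) (y + g - a)) in *.
    set (F1 := Fsup k a s (tn n - g) (y + g)) in *.
    assert (Hf1 : f (S n) h <= kap * Rn (S n) * (exp (- (v + g)) * F1)).
    { apply Rle_trans with (1 := Hfle (S n) h ltac:(rewrite E1; unfold y in *; lra)).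
      right. unfold ff. rewrite E1, Et. unfold F1. replace (v + g + A + K) with (y + g) by (unfold y; ring). ring. }
    assert (Hfj : f (S n) (S h) <= kap * Rn (S n) * (exp (- (v + g - a)) * Fj)).
    { apply Rle_trans with (1 := Hfle (S n) (S h) ltac:(rewrite Ej; unfold y in *; lra)).
      right. unfold ff. rewrite Ej, Et. unfold Fj. replace (v + g - a + A + K) with (y + g - a) by (unfold y; ring). ring. }
    pose proof (tilt_identity a b n v Fj F1 Hab ltac:(lia)) as Hid. fold g in Hid.
    apply Rle_trans with (kap * Rn (S n) * (INR n * (exp (- v) * (jump_prob b n * Fj + (1 - jump_prob b n) * F1)))).
    + rewrite <- Hid.
      assert ((INR n - 1) * f (S n) h <= (INR n - 1) * (kap * Rn (S n) * (exp (- (v + g)) * F1)))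
        by mono. lra.
    + rewrite Hfn. unfold ff. fold v. fold y.
      apply Rle_trans with (kap * Rn (S n) * (INR n * (exp (- v) * (exp (C * g ^ 2) * Fsup k a s (tn n) y)))).
      * apply Rmult_le_compat_l; [apply Rmult_le_pos; [lra|left; apply exp_pos]|].
        apply Rmult_le_compat_l; [lra|]. apply Rmult_le_compat_l; [left; apply exp_pos|exact HS].
      * right. rewrite ER. rewrite (exp_Ropp (C * g ^ 2)). pose proof (exp_pos (C * g ^ 2)). field. lra.
  - intros h Hcr Ht.
    assert (HfN : f N h = ff N h).
    { unfold f. rewrite (proj2 (decide_false _)); [reflexivity|]. intros [H|H]; [contradiction|lia]. }
    rewrite HfN. unfold ff.
    assert (Et : tn N = tau0) by (unfold tn; rewrite Nat.min_id; ring).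
    rewrite Et. set (v := V N h) in *. set (y := v + A + K).
    assert (Hy : K <= y <= z + A + K) by (unfold y; lra).
    assert (HRn : exp (- (C * (2 * b ^ 2))) <= Rn N).
    { unfold Rn. apply exp_le_compat. pose proof (incr_sq_sum b 1 (N - 1) Hb ltac:(lia)).
      assert (C * rsum (fun j => incr b j ^ 2) (seq 1 (N - 1)) <= C * (2 * b ^ 2)) by mono.
      lra. }
    assert (Hev : exp (- z) <= exp (- v)) by (apply exp_le_compat; lra).
    assert (HF : / (Q2 * (1 + z) ^ 2) ^ k <= Fsup k a s tau0 y).
    { unfold Fsup.
      assert (Hx : 0 < tau0 + y ^ 2 / (2 * INR k * a) <= Q2 * (1 + z) ^ 2).
      { replace (y ^ 2 / (2 * INR k * a)) with (be * y ^ 2) by (unfold be; field; lra).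
        assert (H1 : y ^ 2 <= ((1 + A + K) * (1 + z)) ^ 2).
        { apply pow_incr. split; [lra|]. assert (0 <= (A + K) * z) by pos. lra. }
        assert (H2 : be * y ^ 2 <= be * ((1 + A + K) * (1 + z)) ^ 2) by mono.
        assert (H3 : 0 <= be * y ^ 2) by (apply Rmult_le_pos; [lra|apply pow2_ge_0]).
        assert (H4 : 1 <= (1 + z) ^ 2) by (clear - Hz; nra).
        assert (H5 : tau0 * 1 <= tau0 * (1 + z) ^ 2) by mono.
        unfold Q2. rewrite Rpow_mult_distr in H2. lra. }
      set (xx := tau0 + y ^ 2 / (2 * INR k * a)) in *.
      assert (Hp : 1 <= Rpower tau0 (INR k - s)).
      { unfold Rpower. rewrite <- exp_0. apply exp_le_compat. apply Rmult_le_pos; [unfold s; lra|].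
        apply ln_nonneg. lra. }
      assert (Hxk : 0 < xx ^ k) by (apply pow_lt; lra).
      apply Rle_trans with (/ xx ^ k).
      - apply Rinv_le_contravar; [exact Hxk|]. apply pow_incr. lra.
      - unfold Rdiv. rewrite <- (Rmult_1_l (/ xx ^ k)) at 1.
        apply Rmult_le_compat_r; [left; apply Rinv_0_lt_compat, Hxk|].
        rewrite <- (Rmult_1_r 1). apply Rmult_le_compat; lra. }
    set (qq := (Q2 * (1 + z) ^ 2) ^ k) in *.
    apply Rle_trans with (kap * exp (- z) * exp (- (C * (2 * b ^ 2))) * / qq).
    + right. unfold kap. rewrite !exp_Ropp.
      pose proof (exp_pos z). pose proof (exp_pos (C * (2 * b ^ 2))). field. lra.
    + pose proof (exp_pos (- z)). pose proof (exp_pos (- (C * (2 * b ^ 2)))).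
      apply Rmult_le_compat; [| |apply Rmult_le_compat; [| |apply Rmult_le_compat_l|]|]; try lra; try assumption.
      * apply Rmult_le_pos; [apply Rmult_le_pos|]; lra.
      * left; apply Rinv_0_lt_compat; assumption.
      * pos.
  - assert (E1 : V 1%nat O = 0) by (unfold V; rewrite logM_1; simpl; ring).
    apply Rle_lt_trans with (2 := Hr).
    apply Rle_trans with (1 := Hfle 1%nat O ltac:(rewrite E1; lra)).
    unfold ff. rewrite E1. replace (0 + A + K) with (A + K) by ring.
    assert (ER : Rn 1%nat = 1) by (unfold Rn; simpl; rewrite Rmult_0_r, Ropp_0; apply exp_0).
    rewrite ER, Ropp_0, exp_0, !Rmult_1_r.
    assert (Ht1 : 1 + logM b N <= tn 1%nat).
    { unfold tn. rewrite Nat.min_l by lia. rewrite logM_1. lra. }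
    pose proof (logM_nonneg b N Hb HN) as HL0.
    pose proof (Fsup_upper k a s (tn 1%nat) (A + K) ltac:(lia) ltac:(lra) ltac:(lra) ltac:(lra)) as HF.
    assert (HRp : Rpower (tn 1%nat) (- s) <= Rpower (1 + logM b N) (- s)).
    { unfold Rpower. apply exp_le_compat. pose proof (ln_le_compat (1 + logM b N) (tn 1%nat) ltac:(lra) Ht1).
      assert (s * ln (1 + logM b N) <= s * ln (tn 1%nat)) by (apply Rmult_le_compat_l; [unfold s|]; lra). lra. }
    apply Rle_trans with (kap * ((A + K) * Rpower (1 + logM b N) (- s))).
    + apply Rmult_le_compat_l; [lra|]. apply Rle_trans with (1 := HF). mono.
    + right. unfold kap. rewrite Rpow_mult_distr. ring.
Qed.

(** * Limit theorems *)

Lemma as_mono (P Q : (nat -> nat) -> Prop) :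
  (forall w, valid w -> P w -> Q w) -> almost_surely P -> almost_surely Q.
Proof.
  intros H HP d Hd. apply outer_mono with (fun w => ~ P w) d; [|lra|apply HP, Hd].
  intros w Hw Hn Hp. apply Hn, H; assumption.
Qed.

Lemma as_and (P Q : (nat -> nat) -> Prop) :
  almost_surely P -> almost_surely Q -> almost_surely (fun w => P w /\ Q w).
Proof.
  intros HP HQ d Hd.
  apply outer_mono with (fun w => ~ P w \/ ~ Q w) d; [|lra|].
  - intros w _ Hn. apply not_and_or, Hn.
  - apply outer_or with (d / 4) (d / 4); [apply HP|apply HQ|]; lra.
Qed.

(** Each term j^(-1-eta) is at most 1/eta times the difference of j^(-eta) at consecutive integers,
    and these differences telescope. *)
Lemma sum_inv_pow_tail eta J N : 0 < eta -> (2 <= J)%nat ->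
  sum_f_R0 (fun i => exp (- ((1 + eta) * ln (INR (J + i))))) N
  <= / eta * exp (- (eta * ln (INR (J - 1)))).
Proof.
  intros He HJ.
  assert (Hterm : forall j, (2 <= j)%nat -> exp (- ((1 + eta) * ln (INR j))) <=
     / eta * (exp (- (eta * ln (INR (j - 1)))) - exp (- (eta * ln (INR j))))).
  { intros j Hj. pose proof (INR_ge_1 (j - 1) ltac:(lia)) as H1.
    assert (Ej : INR j = INR (j - 1) + 1) by (rewrite <- S_INR; f_equal; lia).
    set (x := INR j) in *.
    assert (Hl : ln (INR (j - 1)) <= ln x - / x).
    { replace (INR (j - 1)) with (x * (1 - / x)) by (rewrite Ej; field; lra).
      assert (0 < 1 - / x).
      { assert (/ x < 1); [|lra]. rewrite <- Rinv_1. apply Rinv_lt_contravar; lra. }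
      rewrite ln_mult by lra. pose proof (ln_le_minus_one (1 - / x) H). lra. }
    assert (H2 : exp (- (eta * ln x)) * (1 + eta * / x) <= exp (- (eta * ln (INR (j - 1))))).
    { apply Rle_trans with (exp (- (eta * ln x)) * exp (eta * / x)).
      - apply Rmult_le_compat_l; [left; apply exp_pos|apply exp_ineq1_le].
      - rewrite <- exp_plus. apply exp_le_compat.
        assert (eta * ln (INR (j - 1)) <= eta * (ln x - / x)) by mono. lra. }
    apply (Rmult_le_reg_l eta); [exact He|]. rewrite <- Rmult_assoc, Rinv_r, Rmult_1_l by lra.
    replace (- ((1 + eta) * ln x)) with (- (eta * ln x) + - ln x) by ring.
    rewrite exp_plus, exp_Ropp, (exp_Ropp (ln x)), exp_ln by lra.
    rewrite exp_Ropp in H2. lra. }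
  enough (sum_f_R0 (fun i => exp (- ((1 + eta) * ln (INR (J + i))))) N
    <= / eta * (exp (- (eta * ln (INR (J - 1)))) - exp (- (eta * ln (INR (J + N)))))).
  { pose proof (exp_pos (- (eta * ln (INR (J + N))))).
    assert (0 < / eta) by (apply Rinv_0_lt_compat, He).
    assert (0 < / eta * exp (- (eta * ln (INR (J + N))))) by pos. lra. }
  induction N as [|N IH].
  - simpl. rewrite Nat.add_0_r. apply Hterm, HJ.
  - rewrite tech5. specialize (Hterm (J + S N)%nat ltac:(lia)).
    replace (J + S N - 1)%nat with (J + N)%nat in Hterm by lia. lra.
Qed.

Lemma borel_cantelli (E : nat -> (nat -> nat) -> Prop) C eta j0 :
  0 < eta -> 0 <= C ->
  (forall j, (j0 <= j)%nat -> outer_le (E j) (C * exp (- ((1 + eta) * ln (INR j))))) ->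
  almost_surely (fun w => exists J, forall j, (J <= j)%nat -> ~ E j w).
Proof.
  intros He HC HE d Hd.
  destruct (INR_unbounded (exp (ln (C / eta / d + 1) / eta))) as [J1 HJ1].
  set (J := (J1 + j0 + 2)%nat).
  apply outer_mono with (fun w => exists i, E (J + i)%nat w) d; [|lra|].
  - intros w _ H. apply NNPP. intros Hn. apply H. exists J. intros j Hj Ej. apply Hn.
    exists (j - J)%nat. replace (J + (j - J))%nat with j by lia. exact Ej.
  - apply outer_union with (fun i => C * exp (- ((1 + eta) * ln (INR (J + i))))).
    + intros i. apply HE. unfold J; lia.
    + intros N. rewrite sum_f_R0_rsum, rsum_scal, <- sum_f_R0_rsum.
      apply Rle_trans with (C * (/ eta * exp (- (eta * ln (INR (J - 1)))))).
      { apply Rmult_le_compat_l; [exact HC|]. apply sum_inv_pow_tail; [exact He|unfold J; lia]. }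
      set (q := C / eta / d). assert (Hq : 0 <= q).
      { unfold q. repeat (apply Rdiv_ge_of_mul; [assumption|rewrite Rmult_0_l]). exact HC. }
      assert (Hl : ln (q + 1) <= eta * ln (INR (J - 1))).
      { assert (H1 : exp (ln (q + 1) / eta) <= INR (J - 1)).
        { assert (INR J1 <= INR (J - 1)) by (apply le_INR; unfold J; lia). unfold q. lra. }
        apply ln_le_compat in H1; [|apply exp_pos]. rewrite ln_exp in H1.
        apply (Rmult_le_compat_l eta) in H1; [|lra].
        replace (eta * (ln (q + 1) / eta)) with (ln (q + 1)) in H1 by (field; lra). exact H1. }
      apply Rle_trans with (C * (/ eta * / (q + 1))).
      { apply Rmult_le_compat_l; [exact HC|]. apply Rmult_le_compat_l; [left; apply Rinv_0_lt_compat, He|].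
        apply Rle_trans with (exp (- ln (q + 1))); [apply exp_le_compat; lra|].
        rewrite exp_Ropp, exp_ln; lra. }
      apply (Rmult_le_reg_r (q + 1)); [lra|].
      assert (Eq : C / eta = d * q) by (unfold q; field; lra).
      replace (C * (/ eta * / (q + 1)) * (q + 1)) with (C / eta) by (field; lra). lra.
Qed.

Lemma linear_pow_le_exp k A B del : 0 <= A -> 0 <= B -> 0 < del ->
  exists C, 0 < C /\ forall x, 0 <= x -> (A + B * x) ^ k <= C * exp (del * x).
Proof.
  intros HA HB Hd. set (m := INR (S k)). assert (Hm : 1 <= m) by (apply INR_ge_1; lia).
  set (C0 := 1 + A + B * m / del).
  assert (Hq : 0 <= B * m / del) by pos.
  exists (C0 ^ k). split; [apply pow_lt; unfold C0; lra|]. intros x Hx.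
  assert (Hdx : 0 <= del * x / m) by pos.
  pose proof (exp_ineq1_le (del * x / m)) as He.
  assert (H1 : 0 <= A + B * x <= C0 * exp (del * x / m)).
  { assert (0 <= B * x) by pos. split; [lra|].
    assert (E : B * x = B * m / del * (del * x / m)) by (field; lra).
    assert (B * m / del * (del * x / m) <= B * m / del * exp (del * x / m)) by mono.
    assert ((1 + A) * 1 <= (1 + A) * exp (del * x / m)) by mono.
    unfold C0. lra. }
  apply Rle_trans with ((C0 * exp (del * x / m)) ^ k); [apply pow_incr; exact H1|].
  rewrite Rpow_mult_distr, <- exp_mult_INR. apply Rmult_le_compat_l; [left; apply pow_lt; unfold C0; lra|].
  apply exp_le_compat. assert (Hkm : INR k <= m) by (apply le_INR; lia).
  replace (del * x) with (m * (del * x / m)) at 2 by (field; lra). mono.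
Qed.

Lemma exists_nat_between x : 0 <= x -> exists m : nat, x < INR m <= x + 1.
Proof.
  intros Hx. destruct (archimed x) as [H1 H2].
  assert (Hz : (0 <= up x)%Z) by (apply le_IZR; lra).
  exists (Z.to_nat (up x)). rewrite INR_IZR_INZ, Z2Nat.id by exact Hz. lra.
Qed.

Lemma leaf_le_height n w u : In u (bst_leaves n w) -> (length u <= height n w)%nat.
Proof.
  intros Hu. destruct (Nat.eq_dec (length u) 0) as [->|H0]; [lia|].
  apply height_ge; [lia|]. exists u. split; [exact Hu|lia].
Qed.

Lemma height_leaf n w : valid w -> exists u, In u (bst_leaves n w) /\ length u = height n w.
Proof.
  intros Hw. apply height_attained. rewrite bst_leaves_tree. intros H.
  pose proof (tree_length (prefix w (n - 1)) (prefix_valid w (n - 1) Hw)) as Hl.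
  rewrite H in Hl. discriminate.
Qed.

Lemma ln_one_plus_logM b n : 0 < b -> (1 <= n)%nat -> 1 <= ln (INR n) ->
  ln (1 + logM b n) <= ln (ln (INR n)) + ln (1 + 2 * b).
Proof.
  intros Hb Hn Hl. rewrite <- ln_mult by lra. pose proof (logM_nonneg b n Hb Hn).
  apply ln_le_compat; [lra|]. pose proof (logM_upper b n Hb Hn).
  assert (b * 1 <= b * ln (INR n)) by mono. lra.
Qed.

Lemma INR_pow2 j : INR (2 ^ j) = 2 ^ j.
Proof. rewrite pow_INR. reflexivity. Qed.

Lemma ln_INR_pow2 j : ln (INR (2 ^ j)) = INR j * ln 2.
Proof. rewrite INR_pow2. apply ln_pow. lra. Qed.

Lemma eventually_lnln X : exists N0, (3 <= N0)%nat /\ forall n, (N0 <= n)%nat ->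
  1 <= ln (INR n) /\ X <= ln (ln (INR n)).
Proof.
  destruct (INR_unbounded (exp (exp (Rmax X 0)))) as [N0 HN0]. exists (N0 + 3)%nat. split; [lia|].
  intros n Hn. assert (INR N0 <= INR n) by (apply le_INR; lia).
  assert (H1 : exp (Rmax X 0) <= ln (INR n)).
  { rewrite <- (ln_exp (exp (Rmax X 0))). apply ln_le_compat; [apply exp_pos|lra]. }
  assert (H2 : Rmax X 0 <= ln (ln (INR n))).
  { rewrite <- (ln_exp (Rmax X 0)). apply ln_le_compat; [apply exp_pos|lra]. }
  pose proof (Rmax_l X 0). pose proof (Rmax_r X 0). pose proof (exp_ineq1_le (Rmax X 0)). lra.
Qed.

(** * The four almost sure bounds and the two bounds in probability *)

Definition low_leaf (a b A : R) (N : nat) (z : R) (w : nat -> nat) : Prop :=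
  (forall n u, (1 <= n <= N)%nat -> In u (bst_leaves n w) -> ~ logM b n - a * INR (length u) <= - A) /\
  exists u, In u (bst_leaves N w) /\ logM b N - a * INR (length u) <= z.

(** To be read with [x] near log log N, when the bound is (log N)^(th - 3/2 + 2 eps). One eps comes
    from [min_lower_tail], the other swallows the polynomial in 1 + z. *)
Lemma low_leaf_bound a b eps A th beta c0 : params a b -> 0 < eps <= 1/2 ->
  0 <= A -> 0 <= th -> 0 <= beta -> 0 < c0 ->
  exists C, 0 < C /\ forall N x r, (1 <= N)%nat -> 0 <= x -> c0 * exp x <= 1 + logM b N ->
    C * exp ((th - 3/2 + 2 * eps) * x) < r -> outer_le (low_leaf a b A N (th * x + beta)) r.
Proof.
  intros Hab He HA Hth Hbeta Hc0.
  destruct (min_lower_tail a b eps Hab He) as (k & Hk). destruct (Hk A HA) as (Q & HQ & HT).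
  destruct (linear_pow_le_exp (2 * k) (1 + beta) th eps ltac:(lra) Hth ltac:(lra)) as (C1 & HC1 & Hpow).
  set (s := 3/2 - eps) in *.
  exists (Q * exp beta * C1 * exp (- (s * ln c0))).
  split. { repeat apply Rmult_lt_0_compat; try assumption; apply exp_pos. }
  intros N x r HN Hx Hc Hr. apply HT; [exact HN|assert (0 <= th * x) by pos; lra|].
  apply Rle_lt_trans with (2 := Hr).
  assert (H1 : ((1 + (th * x + beta)) ^ 2) ^ k <= C1 * exp (eps * x)).
  { rewrite <- pow_mult. replace (1 + (th * x + beta)) with (1 + beta + th * x) by ring. apply Hpow, Hx. }
  assert (H2 : Rpower (1 + logM b N) (- s) <= exp (- (s * ln c0)) * exp (- (s * x))).
  { unfold Rpower. rewrite <- exp_plus. apply exp_le_compat.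
    assert (Hl : ln c0 + x <= ln (1 + logM b N)).
    { rewrite <- (ln_exp x) at 1. rewrite <- ln_mult by (try apply exp_pos; lra).
      apply ln_le_compat; [apply Rmult_lt_0_compat; [lra|apply exp_pos]|exact Hc]. }
    assert (s * (ln c0 + x) <= s * ln (1 + logM b N)) by (apply Rmult_le_compat_l; unfold s; lra). lra. }
  pose proof (exp_pos (th * x + beta)) as E1.
  apply Rle_trans with (Q * exp (th * x + beta) * (C1 * exp (eps * x)) * (exp (- (s * ln c0)) * exp (- (s * x)))).
  - apply Rmult_le_compat; [| left; apply exp_pos| |exact H2].
    + apply Rmult_le_pos; [pos|]. apply pow_le, pow2_ge_0.
    + apply Rmult_le_compat_l; [pos|exact H1].
  - right. rewrite exp_plus.
    replace ((th - 3/2 + 2 * eps) * x) with (th * x + eps * x + - (s * x)) by (unfold s; ring).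
    rewrite !exp_plus. ring.
Qed.

Lemma Xn_lt_iff a b n w q : 0 < ln (ln (INR n)) ->
  Xn a b n w < q <-> b * ln (INR n) - a * INR (height n w) < q * ln (ln (INR n)).
Proof.
  intros Hl. unfold Xn. split; intros H.
  - apply (Rmult_lt_compat_r (ln (ln (INR n)))) in H; [|exact Hl].
    unfold Rdiv in H. rewrite Rmult_assoc, Rinv_l in H by lra. lra.
  - apply (Rmult_lt_reg_r (ln (ln (INR n)))); [exact Hl|].
    unfold Rdiv. rewrite Rmult_assoc, Rinv_l by lra. lra.
Qed.

Lemma Xn_gt_iff a b n w q : 0 < ln (ln (INR n)) ->
  q < Xn a b n w <-> q * ln (ln (INR n)) < b * ln (INR n) - a * INR (height n w).
Proof.
  intros Hl. unfold Xn. split; intros H.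
  - apply (Rmult_lt_compat_r (ln (ln (INR n)))) in H; [|exact Hl].
    unfold Rdiv in H. rewrite Rmult_assoc, Rinv_l in H by lra. lra.
  - apply (Rmult_lt_reg_r (ln (ln (INR n)))); [exact Hl|].
    unfold Rdiv. rewrite Rmult_assoc, Rinv_l by lra. lra.
Qed.

Lemma height_above a b N w q : 0 < a -> valid w -> q < logM b N - a * INR (height N w) ->
  forall u, In u (bst_leaves N w) -> q < logM b N - a * INR (length u).
Proof.
  intros Ha Hw H u Hu. pose proof (le_INR _ _ (leaf_le_height N w u Hu)).
  assert (a * INR (length u) <= a * INR (height N w)) by mono. lra.
Qed.

Theorem prob_lower a b e eta : params a b -> 0 < e -> 0 < eta ->
  exists N0, forall n, (N0 <= n)%nat -> outer_le (fun w => Xn a b n w < 3/2 - e) eta.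
Proof.
  intros Hab He Heta. pose proof Hab as (Ha & Hb & _ & _).
  set (e' := Rmin e 1). assert (He' : 0 < e' <= 1) by (unfold e'; split; [apply Rmin_glb_lt; lra|apply Rmin_r]).
  assert (Hee : e' <= e) by apply Rmin_l.
  set (A := Rmax 0 (1 - ln (eta / 4))). assert (HA : 0 <= A) by apply Rmax_l.
  assert (HAe : exp (- A) < eta / 4).
  { assert (1 - ln (eta / 4) <= A) by apply Rmax_r.
    apply Rlt_le_trans with (exp (ln (eta / 4))); [apply exp_increasing; lra|rewrite exp_ln; lra]. }
  destruct (low_leaf_bound a b (e' / 4) A (3/2 - e') b (b / 2) Hab ltac:(lra) HA ltac:(lra) ltac:(lra) ltac:(lra))
    as (C & HC & Hbd).
  destruct (exists_large [ln (4 * b); 1; 2 * ln (C / (eta / 4)) / e' + 1]) as (X & HXl).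
  assert (HX1 : ln (4 * b) <= X) by (apply HXl; simpl; auto).
  assert (HX2 : 1 <= X) by (apply HXl; simpl; auto).
  assert (HX3 : 2 * ln (C / (eta / 4)) / e' + 1 <= X) by (apply HXl; simpl; auto).
  destruct (eventually_lnln X) as (N0 & HN03 & HN0). exists N0. intros n Hn.
  destruct (HN0 n Hn) as [Hl1 Hx]. set (x := ln (ln (INR n))) in *.
  apply outer_mono with (fun w =>
    (exists n u, (1 <= n)%nat /\ In u (bst_leaves n w) /\ logM b n - a * INR (length u) <= - A)
    \/ low_leaf a b A n ((3/2 - e') * x + b) w) eta; [|lra|].
  - intros w Hw HXn. destruct (classic (exists n u, (1 <= n)%nat /\ In u (bst_leaves n w) /\
      logM b n - a * INR (length u) <= - A)) as [Hc|Hc]; [left; exact Hc|right]. split.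
    + intros n' u Hn' Hu Hle. apply Hc. exists n', u. split; [lia|]. auto.
    + destruct (height_leaf n w Hw) as (u & Hu & Hlu). exists u. split; [exact Hu|]. rewrite Hlu.
      apply Xn_lt_iff in HXn; [|fold x; lra]. fold x in HXn.
      pose proof (logM_upper b n Hb ltac:(lia)).
      assert ((3/2 - e) * x <= (3/2 - e') * x) by mono. lra.
  - apply outer_or with (eta / 4) (eta / 4); [apply never_below; assumption| |lra].
    apply Hbd; [lia|lra| |].
    + unfold x. rewrite exp_ln by lra. pose proof (logM_lower b n Hb ltac:(lia)).
      assert (4 * b <= ln (INR n)).
      { rewrite <- (exp_ln (4 * b)) by lra. rewrite <- (exp_ln (ln (INR n))) by lra.
        apply exp_le_compat. fold x. lra. }
      assert (b * (4 * b) <= b * ln (INR n)) by mono. lra.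
    + set (q := C / (eta / 4)) in *. assert (Hq : 0 < q) by pos.
      assert (Hlq : ln q < e' / 2 * x).
      { assert (2 * ln q / e' + 1 <= x) by lra.
        assert (e' / 2 * (2 * ln q / e' + 1) <= e' / 2 * x) by mono.
        replace (e' / 2 * (2 * ln q / e' + 1)) with (ln q + e' / 2) in H0 by (field; lra). lra. }
      replace ((3/2 - e' - 3/2 + 2 * (e' / 4)) * x) with (- (e' / 2 * x)) by field.
      apply Rlt_le_trans with (C * exp (- ln q)).
      * apply Rmult_lt_compat_l; [exact HC|]. apply exp_increasing. lra.
      * rewrite exp_Ropp, exp_ln by exact Hq. right. unfold q. field. lra.
Qed.

Lemma nat_log2_ge n J : (1 <= n)%nat -> (2 ^ J <= n)%nat -> (J <= Nat.log2 n)%nat.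
Proof. intros Hn H. apply Nat.log2_le_pow2; lia. Qed.

Lemma log2_facts n : (8 <= n)%nat -> let j := Nat.log2 n in
  (3 <= j)%nat /\ (2 ^ j <= n <= 2 ^ S j)%nat /\ INR j * ln 2 <= ln (INR n) <= INR (S j) * ln 2 /\
  0 < ln (INR j) /\ 0 < ln (ln (INR n)) /\ ln (INR j) - 1 <= ln (ln (INR n)) <= ln (INR j) + 1.
Proof.
  intros Hn j. assert (Hj3 : (3 <= j)%nat) by (apply nat_log2_ge; simpl; lia).
  destruct (Nat.log2_spec n ltac:(lia)) as [H1 H2]. fold j in H1, H2.
  pose proof ln2_bounds as Hl2.
  assert (Hj : 3 <= INR j) by (replace 3 with (INR 3) by (simpl; lra); apply le_INR, Hj3).
  assert (Hp : (0 < 2 ^ j)%nat) by (apply Nat.neq_0_lt_0, Nat.pow_nonzero; lia).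
  assert (L1 : INR j * ln 2 <= ln (INR n)).
  { rewrite <- ln_INR_pow2. apply ln_le_compat; [apply lt_0_INR; exact Hp|apply le_INR; lia]. }
  assert (L2 : ln (INR n) <= INR (S j) * ln 2).
  { rewrite <- ln_INR_pow2. apply ln_le_compat; [apply lt_0_INR; lia|apply le_INR; lia]. }
  assert (Hjl : 3 / 2 <= INR j * ln 2).
  { apply Rle_trans with (3 * (1/2)); [lra|]. apply Rmult_le_compat; lra. }
  assert (Hlj : 0 < ln (INR j)) by (rewrite <- ln_1; apply ln_increasing; lra).
  split; [exact Hj3|]. split; [lia|]. split; [lra|]. split; [exact Hlj|]. split.
  { rewrite <- ln_1. apply ln_increasing; lra. }
  assert (Hlln2 : -1 <= ln (ln 2)).
  { rewrite <- (ln_exp (-1)). apply ln_le_compat; [apply exp_pos|].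
    apply Rle_trans with (2 := proj1 Hl2). replace (-1) with (- (1)) by ring. rewrite exp_Ropp.
    replace (1/2) with (/ 2) by field. apply Rinv_le_contravar; [lra|].
    pose proof (exp_ineq1_le 1). lra. }
  split.
  - assert (ln (INR j * ln 2) <= ln (ln (INR n))) by (apply ln_le_compat; lra).
    rewrite ln_mult in H by lra. lra.
  - assert (ln (ln (INR n)) <= ln (INR j * 2)).
    { apply ln_le_compat; [lra|]. rewrite S_INR in L2.
      assert ((INR j + 1) * ln 2 <= (INR j + 1) * 1) by mono. lra. }
    rewrite ln_mult in H by lra. lra.
Qed.

(** Heights are monotone in [n], so a low leaf at a time in [2^j, 2^(j+1)] forces one at 2^(j+1), up
    to the constant [beta]. Its probability is about j^(th - 3/2), and 1/2 is the threshold for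
    summability. *)
Theorem as_liminf_ge a b e : params a b -> 0 < e ->
  almost_surely (fun w => exists N, forall n, (N <= n)%nat -> 1/2 - e <= Xn a b n w).
Proof.
  intros Hab He. pose proof Hab as (Ha & Hb & _ & _).
  set (e' := Rmin e (1/2)). assert (He' : 0 < e' <= 1/2) by (unfold e'; split; [apply Rmin_glb_lt; lra|apply Rmin_r]).
  assert (Hee : e' <= e) by apply Rmin_l.
  pose proof ln2_bounds as Hl2.
  set (th := 1/2 - e'). set (beta := 1 + 2 * b).
  (* The level above which V stays depends on the sample point; the estimate is therefore made for
     all integer levels simultaneously. *)
  assert (HE : almost_surely (fun w => forall A : nat, exists J, forall j, (J <= j)%nat ->
     ~ low_leaf a b (INR A) (2 ^ S j) (th * ln (INR j) + beta) w)).
  { apply as_forall. intros A.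
    destruct (low_leaf_bound a b (e' / 4) (INR A) th beta (b / 4) Hab ltac:(lra) (pos_INR A)
       ltac:(unfold th; lra) ltac:(unfold beta; lra) ltac:(lra)) as (C & HC & Hbd).
    destruct (INR_unbounded (8 * b)) as [j0 Hj0].
    apply borel_cantelli with (C := 2 * C) (eta := e' / 2) (j0 := (j0 + 1)%nat); [lra|lra|].
    intros j Hj. assert (Hjr : 1 <= INR j) by (apply INR_ge_1; lia).
    assert (Hj0r : INR j0 <= INR j) by (apply le_INR; lia).
    assert (Hp : (0 < 2 ^ S j)%nat) by (apply Nat.neq_0_lt_0, Nat.pow_nonzero; lia).
    apply Hbd; [lia|apply ln_nonneg, Hjr| |].
    - rewrite exp_ln by lra. pose proof (logM_lower b (2 ^ S j) Hb ltac:(lia)) as HL.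
      rewrite ln_INR_pow2, S_INR in HL.
      assert (b * ((INR j + 1) * (1/2)) <= b * ((INR j + 1) * ln 2)).
      { apply Rmult_le_compat_l; [lra|]. mono. }
      assert (b * (8 * b) <= b * INR j) by mono. lra.
    - replace ((th - 3/2 + 2 * (e' / 4)) * ln (INR j)) with (- ((1 + e' / 2) * ln (INR j))) by (unfold th; field).
      pose proof (exp_pos (- ((1 + e' / 2) * ln (INR j)))) as Hp2.
      assert (0 < C * exp (- ((1 + e' / 2) * ln (INR j)))) by pos. lra. }
  assert (HB : almost_surely (fun w => exists A : nat, forall n u, (1 <= n)%nat -> In u (bst_leaves n w) ->
     ~ logM b n - a * INR (length u) <= - INR A)).
  { intros d Hd. destruct (INR_unbounded (- ln d)) as [A HA].
    apply outer_mono with (fun w => exists n u, (1 <= n)%nat /\ In u (bst_leaves n w) /\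
      logM b n - a * INR (length u) <= - INR A) d; [|lra|].
    - intros w _ Hn. apply NNPP. intros Hc. apply Hn. exists A. intros n u Hn1 Hu Hle.
      apply Hc. exists n, u. auto.
    - apply never_below; [exact Hab|]. apply Rlt_le_trans with (exp (ln d)); [apply exp_increasing; lra|].
      rewrite exp_ln; lra. }
  apply as_mono with (2 := as_and _ _ HE HB). intros w Hw [H1 [A HA]]. destruct (H1 A) as [J HJ].
  exists (2 ^ (J + 3))%nat. intros n Hn. apply Rnot_lt_le. intros HX.
  assert (Hp3 : (2 ^ 3 <= 2 ^ (J + 3))%nat) by (apply Nat.pow_le_mono_r; lia). simpl in Hp3.
  destruct (log2_facts n ltac:(lia)) as (Hj3 & Hnj & Hln & Hlj & Hll & Hllj).
  set (j := Nat.log2 n) in *.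
  assert (HJj : (J <= j)%nat) by (pose proof (nat_log2_ge n (J + 3) ltac:(lia) Hn); unfold j; lia).
  apply (HJ j HJj). split.
  { intros n' u Hn' Hu. apply HA; [lia|exact Hu]. }
  destruct (height_leaf (2 ^ S j) w Hw) as (u & Hu & Hlu). exists u. split; [exact Hu|]. rewrite Hlu.
  apply Xn_lt_iff in HX; [|exact Hll].
  pose proof (logM_upper b (2 ^ S j) Hb ltac:(lia)) as HL. rewrite ln_INR_pow2 in HL.
  pose proof (le_INR _ _ (height_mono w n (2 ^ S j) Hw ltac:(lia))) as Hh.
  assert (a * INR (height n w) <= a * INR (height (2 ^ S j) w)) by mono.
  assert ((1/2 - e) * ln (ln (INR n)) <= th * ln (ln (INR n))) by (apply Rmult_le_compat_r; unfold th; lra).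
  assert (th * ln (ln (INR n)) <= th * (ln (INR j) + 1)) by (apply Rmult_le_compat_l; unfold th; lra).
  rewrite S_INR in HL.
  assert (b * ((INR j + 1) * ln 2) <= b * ln (INR n) + b).
  { assert (b * (INR j * ln 2) <= b * ln (INR n)) by mono.
    assert (b * ln 2 <= b * 1) by mono. lra. }
  unfold beta. assert (th <= 1) by (unfold th; lra). lra.
Qed.

(** [window_hit] succeeds after any prescribed time with probability as close to 1 as desired, so
    the event of failure forever has arbitrarily small covers. *)
Theorem as_liminf_le a b e N0 : params a b -> 0 < e ->
  almost_surely (fun w => exists n, (N0 <= n)%nat /\ Xn a b n w <= 1/2 + e).
Proof.
  intros Hab He. pose proof Hab as (Ha & Hb & _ & _). intros d Hd.
  set (K := (1/2 + e / 2) * ln (1 + 2 * b) + 2 * b ^ 2).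
  destruct (eventually_lnln (Rmax 1 (K / (e / 2) + 1))) as (n0 & Hn03 & Hn0).
  apply outer_mono with (fun w => forall n u, (N0 + n0 <= n)%nat -> In u (bst_leaves n w) ->
    (1/2 + e / 2) * ln (logM b n) < logM b n - a * INR (length u)) d; [|lra|apply window_hit; auto; lra].
  intros w Hw Hn n u Hnn. destruct (Hn0 n ltac:(lia)) as [Hl1 Hl].
  pose proof (Rmax_l 1 (K / (e / 2) + 1)). pose proof (Rmax_r 1 (K / (e / 2) + 1)).
  apply height_above with (1 := proj1 Ha) (2 := Hw).
  assert (HX : 1/2 + e < Xn a b n w).
  { apply Rnot_le_lt. intros Hle. apply Hn. exists n. split; [lia|exact Hle]. }
  apply Xn_gt_iff in HX; [|lra].
  pose proof (logM_lower b n Hb ltac:(lia)) as HL.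
  pose proof (ln_one_plus_logM b n Hb ltac:(lia) Hl1) as HLL.
  pose proof (logM_le_mono b 2 n Hb ltac:(lia)) as H2. rewrite logM_S, logM_1 in H2 by lia.
  pose proof (incr_pos b 1 Hb ltac:(lia)).
  assert (H3 : ln (logM b n) <= ln (1 + logM b n)) by (apply ln_le_compat; lra).
  assert (H4 : (1/2 + e / 2) * ln (logM b n) <= (1/2 + e / 2) * (ln (ln (INR n)) + ln (1 + 2 * b)))
    by mono.
  assert (H5 : K < e / 2 * ln (ln (INR n))).
  { apply Rlt_le_trans with (e / 2 * (K / (e / 2) + 1)).
    - replace (e / 2 * (K / (e / 2) + 1)) with (K + e / 2) by (field; lra). lra.
    - mono. }
  unfold K in H5. lra.
Qed.

(** If every late time fails, then so does one fixed late time, whose failure has probability as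
    small as desired by [prob_lower]. *)
Theorem as_limsup_ge a b e N0 : params a b -> 0 < e ->
  almost_surely (fun w => exists n, (N0 <= n)%nat /\ 3/2 - e <= Xn a b n w).
Proof.
  intros Hab He d Hd. destruct (prob_lower a b e d Hab He Hd) as (N1 & HN1).
  apply outer_mono with (fun w => Xn a b (N0 + N1) w < 3/2 - e) d; [|lra|apply HN1; lia].
  intros w _ Hn. apply Rnot_le_lt. intros Hle. apply Hn. exists (N0 + N1)%nat. split; [lia|exact Hle].
Qed.

Theorem prob_upper a b e eta : params a b -> 0 < e -> 0 < eta ->
  exists N0, forall n, (N0 <= n)%nat -> outer_le (fun w => 3/2 + e < Xn a b n w) eta.
Proof.
  intros Hab He Heta. pose proof Hab as (Ha & Hb & _ & _).
  set (eps := Rmin (1/2) (e / 6)).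
  assert (Heps : 0 < eps <= 1/2) by (unfold eps; split; [apply Rmin_glb_lt; lra|apply Rmin_l]).
  assert (Hepse : eps <= e / 6) by apply Rmin_r.
  destruct (min_upper_tail a b eps Hab Heps) as (c' & C' & m0 & Hc' & Hm0 & Htail).
  destruct (INR_unbounded (Rmax 0 (- ln eta / c'))) as [m1 Hm1]. set (m := (m0 + m1)%nat).
  assert (Hexp : exp (- INR m * c') < eta).
  { assert (INR m1 <= INR m) by (apply le_INR; unfold m; lia). pose proof (Rmax_r 0 (- ln eta / c')).
    assert (- ln eta < INR m * c').
    { apply Rle_lt_trans with (- ln eta / c' * c'); [right; field; lra|]. apply Rmult_lt_compat_r; lra. }
    apply Rlt_le_trans with (exp (ln eta)); [apply exp_increasing; lra|rewrite exp_ln; lra]. }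
  set (s := 3/2 + 3 * eps) in *.
  set (K := logM b m + s * ln (1 + 2 * b) + C' + 2 * b ^ 2).
  destruct (eventually_lnln (Rmax 1 (K / (e / 2)))) as (n0 & Hn03 & Hn0).
  exists (m + n0)%nat. intros n Hn. destruct (Hn0 n ltac:(lia)) as [Hl1 Hl].
  pose proof (Rmax_l 1 (K / (e / 2))). pose proof (Rmax_r 1 (K / (e / 2))).
  eapply outer_mono; [|apply Rle_refl|apply (Htail m n eta); [unfold m; lia|exact Hexp]].
  intros w Hw HX. cbv beta. apply height_above with (1 := proj1 Ha) (2 := Hw).
  apply Xn_gt_iff in HX; [|lra].
  pose proof (logM_lower b n Hb ltac:(lia)) as HL.
  pose proof (ln_one_plus_logM b n Hb ltac:(lia) Hl1) as HLL.
  assert (s * ln (1 + logM b n) <= s * (ln (ln (INR n)) + ln (1 + 2 * b))) by (apply Rmult_le_compat_l; unfold s; lra).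
  assert (K <= e / 2 * ln (ln (INR n))).
  { apply Rle_trans with (e / 2 * (K / (e / 2))); [right; field; lra|]. mono. }
  assert (s * ln (ln (INR n)) <= (3/2 + e / 2) * ln (ln (INR n))) by (apply Rmult_le_compat_r; unfold s; lra).
  unfold K in *. lra.
Qed.

Lemma ln_le_linear del x : 0 < del -> 0 < x -> ln x <= del * x - ln del.
Proof.
  intros Hd Hx. pose proof (ln_le_minus_one (del * x) ltac:(pos)) as H.
  rewrite ln_mult in H by lra. lra.
Qed.

(** For fixed [m] the failure bound of [min_upper_tail] does not decay along N = 2^j. So [m] grows
    like (2/c') log j: the probability drops below j^(-2), while the price log M_m is only of order
    log log j. Monotonicity of the height fills the gaps between powers of 2. *)
Theorem as_limsup_le a b e : params a b -> 0 < e ->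
  almost_surely (fun w => exists N, forall n, (N <= n)%nat -> Xn a b n w <= 3/2 + e).
Proof.
  intros Hab He. pose proof Hab as (Ha & Hb & _ & _).
  set (eps := Rmin (1/2) (e / 12)).
  assert (Heps : 0 < eps <= 1/2) by (unfold eps; split; [apply Rmin_glb_lt; lra|apply Rmin_l]).
  assert (Hepse : eps <= e / 12) by apply Rmin_r.
  destruct (min_upper_tail a b eps Hab Heps) as (c' & C' & m0 & Hc' & Hm0 & Htail).
  set (s := 3/2 + 3 * eps) in *. pose proof ln2_bounds as Hl2.
  set (E := fun j w => forall u, In u (bst_leaves (2 ^ j) w) ->
     (3/2 + e) * (ln (INR j) - 1) - b - 2 * b ^ 2 < logM b (2 ^ j) - a * INR (length u)).
  assert (HE : almost_surely (fun w => exists J, forall j, (J <= j)%nat -> ~ E j w)).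
  { set (del := e * c' / (8 * b)).
    assert (Hdel : 0 < del) by (unfold del; apply Rdiv_lt_0_compat; [apply Rmult_lt_0_compat|]; lra).
    set (M0 := INR m0 + 1).
    set (C4 := b * (del * M0 - ln del) + b).
    set (Kst := C4 + s * ln (1 + 2 * b) + C' + (3/2 + e) + b + 2 * b ^ 2).
    set (C5 := 2 / c' * - ln (c' / 4) + M0).
    destruct (exists_large [1; exp (Kst / (e / 2)); 2 * C5]) as (jx & Hjx).
    destruct (INR_unbounded jx) as [j0 Hj0].
    apply borel_cantelli with (C := 1) (eta := 1) (j0 := j0); [lra|lra|].
    intros j Hj. assert (Hjr : jx < INR j) by (pose proof (le_INR _ _ Hj); lra).
    assert (J1 : 1 <= INR j) by (pose proof (Hjx 1 ltac:(simpl; auto)); lra).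
    assert (J2 : exp (Kst / (e / 2)) <= INR j).
    { pose proof (Hjx (exp (Kst / (e / 2))) ltac:(simpl; auto)); lra. }
    assert (J3 : 2 * C5 <= INR j) by (pose proof (Hjx (2 * C5) ltac:(simpl; auto)); lra).
     set (x := ln (INR j)).
    assert (Hx : 0 <= x) by (apply ln_nonneg, J1).
    assert (H2c : 0 < 2 / c') by pos.
    assert (H2cx : 0 <= 2 / c' * x) by pos.
    destruct (exists_nat_between (2 / c' * x + INR m0)) as (m & Hm1 & Hm2).
    { pose proof (pos_INR m0); lra. }
    assert (Hmm0 : (m0 <= m)%nat) by (apply INR_le; lra).
    assert (HmN : (m <= 2 ^ j)%nat).
    { apply INR_le. apply Rle_trans with (INR j).
      - pose proof (ln_le_linear (c' / 4) (INR j) ltac:(lra) ltac:(lra)) as Hln. fold x in Hln.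
        assert (2 / c' * x <= 2 / c' * (c' / 4 * INR j - ln (c' / 4))) by mono.
        replace (2 / c' * (c' / 4 * INR j - ln (c' / 4))) with (INR j / 2 + 2 / c' * - ln (c' / 4)) in H by (field; lra).
        unfold C5, M0 in J3. lra.
      - apply le_INR. apply Nat.lt_le_incl, Nat.pow_gt_lin_r; lia. }
    eapply outer_mono; [|apply Rle_refl|apply (Htail m (2 ^ j)%nat); [split; [exact Hmm0|exact HmN]|]].
    - intros w Hw H u Hu. apply Rle_lt_trans with (2 := H u Hu). fold x.
      assert (HLm : logM b m <= e / 4 * x + C4).
      { apply Rle_trans with (1 := logM_upper b m Hb ltac:(lia)).
        pose proof (INR_ge_1 m ltac:(lia)).
        pose proof (ln_le_linear del (INR m) Hdel ltac:(lra)) as Hln.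
        assert (b * ln (INR m) <= b * (del * (2 / c' * x + M0) - ln del)).
        { apply Rmult_le_compat_l; [lra|]. apply Rle_trans with (1 := Hln).
          assert (del * INR m <= del * (2 / c' * x + M0)) by (apply Rmult_le_compat_l; unfold M0; lra). lra. }
        assert (Eq : b * (del * (2 / c' * x + M0) - ln del) = e / 4 * x + b * (del * M0 - ln del)).
        { assert (Hd2 : b * del * (2 / c') = e / 4) by (unfold del; field; lra).
          rewrite <- Hd2. ring. }
        unfold C4. lra. }
      assert (HLN : ln (1 + logM b (2 ^ j)) <= x + ln (1 + 2 * b)).
      { unfold x. rewrite <- ln_mult by lra. pose proof (logM_nonneg b (2 ^ j) Hb ltac:(lia)).
        apply ln_le_compat; [lra|]. pose proof (logM_upper b (2 ^ j) Hb ltac:(lia)) as HLu.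
        rewrite ln_INR_pow2 in HLu.
        assert (b * (INR j * ln 2) <= b * (INR j * 1)).
        { apply Rmult_le_compat_l; [lra|]. mono. }
        assert (b * 1 <= b * INR j) by mono. lra. }
      assert (s * ln (1 + logM b (2 ^ j)) <= s * (x + ln (1 + 2 * b))) by (apply Rmult_le_compat_l; unfold s; lra).
      assert (HK : Kst <= e / 2 * x).
      { assert (Kst / (e / 2) <= x).
        { unfold x. rewrite <- (ln_exp (Kst / (e / 2))). apply ln_le_compat; [apply exp_pos|exact J2]. }
        apply Rle_trans with (e / 2 * (Kst / (e / 2))); [right; field; lra|]. mono. }
      assert (s * x <= (3/2 + e / 4) * x) by (apply Rmult_le_compat_r; unfold s; lra).
      unfold Kst in HK. lra.
    - rewrite Rmult_1_l. apply exp_increasing.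
      assert (2 * x < INR m * c').
      { apply Rle_lt_trans with (2 / c' * x * c'); [right; field; lra|]. apply Rmult_lt_compat_r; [lra|].
        pose proof (pos_INR m0). lra. }
      lra. }
  apply as_mono with (2 := HE). intros w Hw [J HJ].
  exists (2 ^ (J + 3))%nat. intros n Hn. apply Rnot_lt_le. intros HX.
  assert (Hp3 : (2 ^ 3 <= 2 ^ (J + 3))%nat) by (apply Nat.pow_le_mono_r; lia). simpl in Hp3.
  destruct (log2_facts n ltac:(lia)) as (Hj3 & Hnj & Hln & Hlj & Hll & Hllj).
  set (j := Nat.log2 n) in *.
  assert (HJj : (J <= j)%nat) by (pose proof (nat_log2_ge n (J + 3) ltac:(lia) Hn); unfold j; lia).
  assert (Hp : (0 < 2 ^ j)%nat) by (apply Nat.neq_0_lt_0, Nat.pow_nonzero; lia).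
  apply (HJ j HJj). unfold E. apply height_above with (1 := proj1 Ha) (2 := Hw).
  apply Xn_gt_iff in HX; [|exact Hll].
  pose proof (logM_lower b (2 ^ j) Hb ltac:(lia)) as HL. rewrite ln_INR_pow2 in HL.
  pose proof (le_INR _ _ (height_mono w (2 ^ j) n Hw ltac:(lia))) as Hh.
  assert (a * INR (height (2 ^ j) w) <= a * INR (height n w)) by mono.
  assert ((3/2 + e) * (ln (INR j) - 1) <= (3/2 + e) * ln (ln (INR n))) by mono.
  rewrite S_INR in Hln.
  assert (b * ln (INR n) <= b * (INR j * ln 2) + b).
  { assert (b * ln (INR n) <= b * ((INR j + 1) * ln 2)) by mono.
    assert (b * ln 2 <= b * 1) by mono. lra. }
  lra.
Qed.

Theorem theorem1 (a b : R) (ha : 0 < a)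
  (hae : 2 * (a - 1) * exp a + 1 = 0) (hb : b = 2 * a * exp a) :
  almost_surely (fun w =>
    (* liminf_n Xn = 1/2 *)
    (forall e, 0 < e ->
       (exists N, forall n, (N <= n)%nat -> 1/2 - e <= Xn a b n w) /\
       (forall N, exists n, (N <= n)%nat /\ Xn a b n w <= 1/2 + e)) /\
    (* limsup_n Xn = 3/2 *)
    (forall e, 0 < e ->
       (exists N, forall n, (N <= n)%nat -> Xn a b n w <= 3/2 + e) /\
       (forall N, exists n, (N <= n)%nat /\ 3/2 - e <= Xn a b n w)))
  /\ 1/2 < 3/2
  /\ (* convergence in probability to 3/2 *)
  (forall e, 0 < e -> forall eta, 0 < eta ->
     exists N, forall n, (N <= n)%nat ->
       outer_le (fun w => Rabs (Xn a b n w - 3/2) > e) eta).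
Proof.
  pose proof (params_intro a b ha hae hb) as Hab. split; [|split; [lra|]].
  - set (ei := fun i => / INR (S i)).
    assert (Hei : forall i, 0 < ei i) by (intros i; apply Rinv_0_lt_compat, lt_0_INR; lia).
    assert (Hsmall : forall e, 0 < e -> exists i, ei i <= e).
    { intros e He. destruct (INR_unbounded (/ e)) as [i Hi]. exists i. unfold ei.
      rewrite <- (Rinv_inv e). apply Rinv_le_contravar; [apply Rinv_0_lt_compat, He|].
      rewrite S_INR. lra. }
    assert (H : almost_surely (fun w => forall i,
      (((exists N, forall n, (N <= n)%nat -> 1/2 - ei i <= Xn a b n w) /\
        (forall N, exists n, (N <= n)%nat /\ Xn a b n w <= 1/2 + ei i)) /\
       ((exists N, forall n, (N <= n)%nat -> Xn a b n w <= 3/2 + ei i) /\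
        (forall N, exists n, (N <= n)%nat /\ 3/2 - ei i <= Xn a b n w))))).
    { apply as_forall. intros i. repeat apply as_and.
      - apply as_liminf_ge; auto.
      - apply as_forall. intros N. apply as_liminf_le; auto.
      - apply as_limsup_le; auto.
      - apply as_forall. intros N. apply as_limsup_ge; auto. }
    apply as_mono with (2 := H). intros w _ Hw. split; intros e He; destruct (Hsmall e He) as [i Hi];
      destruct (Hw i) as [[[N1 H1] H2] [[N3 H3] H4]].
    + split; [exists N1; intros n Hn; specialize (H1 n Hn); lra|].
      intros N. destruct (H2 N) as (n & Hn & Hx). exists n. split; [exact Hn|lra].
    + split; [exists N3; intros n Hn; specialize (H3 n Hn); lra|].
      intros N. destruct (H4 N) as (n & Hn & Hx). exists n. split; [exact Hn|lra].
  - intros e He eta Heta.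
    destruct (prob_lower a b e (eta / 4) Hab He ltac:(lra)) as [N1 H1].
    destruct (prob_upper a b e (eta / 4) Hab He ltac:(lra)) as [N2 H2].
    exists (N1 + N2)%nat. intros n Hn.
    apply outer_mono with (fun w => Xn a b n w < 3/2 - e \/ 3/2 + e < Xn a b n w) eta; [|lra|].
    + intros w _ HX. destruct (Rle_dec 0 (Xn a b n w - 3/2)) as [H|H].
      * rewrite Rabs_pos_eq in HX by exact H. right. lra.
      * rewrite Rabs_left in HX by lra. left. lra.
    + apply outer_or with (eta / 4) (eta / 4); [apply H1; lia|apply H2; lia|lra].
Qed.
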